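(* Let $\{Z_x^{\mathcal S}\}_{x\in\mathcal X}$ be a zero mean Gaussian field with variance-covariance matrix $\Sigma^{\mathcal S}=(-Q\circ\mathcal S)^{-1}$, and let $\mathbb X=\{X_t\}_{t\ge 0}$ be a realization, independent of $\{Z_x^{\mathcal S}\}_{x\in\mathcal X}$, of the Markov process with generator $Q$. Then for all $x,y\in\mathcal X$ and every bounded Borel measurable function $F:\mathbb R^{\mathcal X}\to\mathbb R$, $$\mathbf E\left[Z_x^{\mathcal S}Z_y^{\mathcal S}\,F\left(\frac{(Z_u^{\mathcal S})^2}{2},\ u\in\mathcal X\right)\right]=\int \mathbf E\left[F\left(\frac{(Z_u^{\mathcal S})^2}{2}+l_\infty^u,\ u\in\mathcal X\right)H_\infty\right]d\mu_{xy},$$ where the inner expectation $\mathbf E$ on the right is over the Gaussian field and the integral $\int\cdot\,d\mu_{xy}$ is over the paths of $\mathbb X$.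
   Context: **Generator.** $\mathcal X$ is a countable (finite or countably infinite) set and $Q=((q_{xy}))_{x,y\in\mathcal X}$ is a symmetric real matrix with $q_{xy}=q_{yx}\ge 0$ for $x\ne y$, $q_{xx}<0$, and $\sum_{y\in\mathcal X}q_{xy}\le 0$ for every $x$. It is assumed that either (i) $Q$ is irreducible and $\sum_{y}q_{xy}<0$ for at least one $x\in\mathcal X$, or (ii) $\sum_y q_{xy}<0$ for every $x\in\mathcal X$. Let $p_{xy}=-q_{xy}/q_{xx}$ for $x\neq y$, $p_{xx}=0$, $P=((p_{xy}))$, and let $Q^{diag}$ be the diagonal matrix with the same diagonal as $Q$, so $Q=Q^{diag}(I-P)$. Under these assumptions every entry of $\sum_{n\ge0}P^n$ is finite. **Process.** $\mathbb X=\{X_t\}_{t\ge0}$ is the (reversible) continuous-time Markov process on $\mathcal X\cup\{\Delta\}$ with generator $Q$, where $\Delta\notin\mathcal X$ is an absorbing ''cemetery''. It is described by its embedded jump chain $Y_0,Y_1,\dots$ with transition probabilities $p_{xy}$ on $\mathcal X$ and probability $p(x,\Delta)=1-\sum_{y\in\mathcal X}p_{xy}$ of jumping from $x$ to $\Delta$, and its jump times $0=S_0<S_1<S_2<\cdots$: $X_t=Y_n$ on $[S_n,S_{n+1})$, and conditionally on the jump chain the holding times $S_{i+1}-S_i$ in the states $Y_i\in\mathcal X$ are independent, exponential with rate $-q_{Y_iY_i}$. Let $\eta\in\{0,1,2,\dots\}\cup\{\infty\}$ be such that $Y_\eta$ is the last state of $\mathcal X$ visited before the jump to $\Delta$, which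 occurs at time $S_{\eta+1}$ ($\eta=\infty$ if $\Delta$ is never reached by a jump). After a jump to $\Delta$ (or after an accumulation point of the jump times, if any) the process is in no state of $\mathcal X$. $\mathbf P_x,\mathbf E_x$ denote probability and expectation for the process started at $Y_0=x$. The occupation times are $l_t^u=\int_0^t 1_{\{X_s=u\}}\,ds$ for $t\in[0,\infty]$, $u\in\mathcal X$. **Signs.** $\mathcal S$ is a matrix indexed by $\mathcal X\times\mathcal X$ with $\mathcal S(x,x)=1$, $\mathcal S(x,y)=\mathcal S(y,x)\in\{-1,1\}$ for all $x\ne y$. A transition from $x$ to $y$ is negative if $\mathcal S(x,y)=-1$ and positive otherwise; transitions to $\Delta$ are positive. The sign process is $H_t=\prod_{i\ge1:\,S_i\le t}\mathcal S(Y_{i-1},Y_i)$ (with $H_0=1$ and $\mathcal S(\cdot,\Delta)=1$), i.e. $H_t=1$ or $-1$ according to whether the number of negative transitions up to time $t$ is even or odd. On $\{\eta<\infty\}$, $H_\infty=\prod_{i=1}^{\eta}\mathcal S(Y_{i-1},Y_i)$. **Inverses.** $\circ$ is the entrywise (Hadamard) product. If $\tilde Q=\tilde R(I-\tilde P)$ with $\tilde R$ diagonal with negative entries and $|\tilde P|$ (entrywise absolute value) a sub-Markov matrix such that all entries of $\sum_{n\ge0}|\tilde P|^n$ are finite, define $\tilde Q^{-1}=\left(\sum_{n\ge0}\tilde P^n\right)\tilde R^{-1}$ and $(-\tilde Q)^{-1}=-\tilde Q^{-1}$. This applies to $Q=Q^{diag}(I-P)$ and to $Q\circ\mathcal S=Q^{diag}(I-P\circ\mathcal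 S)$. An infinite matrix is called positive definite if all its finite principal submatrices are; $\Sigma^{\mathcal S}$ is symmetric and positive definite in this sense. **The measure $\mu_{xy}$.** For $x,y\in\mathcal X$, $\mu_{xy}$ is the conditional probability measure, for the process started at $x$, given that the process eventually enters $\Delta$ with $y$ being the last state it stays in before being killed, scaled by the factor $-Q^{-1}(x,y)$: for events $C$ of the process, $\mu_{xy}\{C\}=-Q^{-1}(x,y)\,\mathbf P_x\{C\mid \eta<\infty,\ Y_\eta=y\}$. $\mathbb R^{\mathcal X}$ carries the product Borel $\sigma$-algebra.
   Formalization: If the event that y is the last state before Δ has probability 0, the conditional law defining μ_xy is undefined; it is then read as the law of the path killed at the end of a visit to y, all visits equally weighted (scaled by -Q^{-1}(x,y)). *)

(* Defs.v *)
From HB Require Import structures.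
From mathcomp Require Import all_boot all_order all_algebra.
From mathcomp Require Import all_classical all_reals all_analysis.
From mathcomp Require Import measurable_realfun.

Set Implicit Arguments.
Unset Strict Implicit.
Unset Printing Implicit Defensive.
Import Order.TTheory GRing.Theory Num.Theory.
Import numFieldNormedType.Exports.

Local Open Scope classical_set_scope.
Local Open Scope ring_scope.

Section InfiniteMatrices.
Context {R : realType}.

(* Unordered sum of a real family: it is the usual sum as soon as the positive
   or the negative part is summable, which is the case in all uses below. *)
Definition csum (I : choiceType) (f : I -> R) : \bar R :=
  (\esum_(i in [set: I]) (EFin \o f)^\+ i -
   \esum_(i in [set: I]) (EFin \o f)^\- i)%E.

Context {X : countType}.
Implicit Types A B : X -> X -> R.

Definition mxmul A B : X -> X -> R :=
  fun x y => fine (csum (fun z => A x z * B z y)).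

Definition mxpow A (n : nat) : X -> X -> R :=
  iter n (mxmul A) (fun x y => (x == y)%:R).

Definition hadamard A B : X -> X -> R := fun x y => A x y * B x y.

(* The matrix P in the factorization A = D (I - P), D the diagonal of A. *)
Definition jump_mx A : X -> X -> R :=
  fun x y => if x == y then 0 else - A x y / A x x.

(* A^-1 = (\sum_n P^n) D^-1, where A = D (I - P) is the above factorization. *)
Definition inv_mx A : X -> X -> R :=
  fun x y => fine (csum (fun n => mxpow (jump_mx A) n x y)) / A y y.

Definition irreducible_mx A : Prop :=
  forall x y, exists s : seq X,
    path (fun u v => (u != v) && (0 < A u v)) x s /\ last x s = y.

Definition is_generator (Q : X -> X -> R) : Prop :=
  [/\ forall x y, Q x y = Q y x,
      forall x y, x != y -> 0 <= Q x y,
      forall x, Q x x < 0,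
      forall x, (csum (Q x) <= 0)%E &
      (irreducible_mx Q /\ exists x, (csum (Q x) < 0)%E)
      \/ (forall x, (csum (Q x) < 0)%E)].

Definition is_sign_matrix (S : X -> X -> R) : Prop :=
  [/\ forall x, S x x = 1,
      forall x y, S x y = S y x &
      forall x y, S x y = 1 \/ S x y = -1].

End InfiniteMatrices.

Section GaussianFields.
Context {R : realType}.

(* [normal_prob m s] has standard deviation [s] only if [s != 0]; the
   degenerate normal law is a Dirac mass. *)
Definition is_gaussian_law (L : set R -> \bar R) : Prop :=
  exists m s : R, forall B, measurable B ->
    L B = if s == 0 then \d_m B else normal_prob m s B.

Definition is_centered_gaussian_field (X : countType) d (T : measurableType d)
    (P : probability T R) (Z : X -> {RV P >-> R}) (Sigma : X -> X -> R) : Prop :=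
  [/\ forall (s : seq X) (a : X -> R), is_gaussian_law
        (fun B => P ((fun w => \sum_(u <- s) a u * Z u w) @^-1` B)),
      forall u, ('E_P[Z u] = 0)%E &
      forall u v, covariance P (Z u) (Z v) = (Sigma u v)%:E].

End GaussianFields.

(* R^X with its product Borel sigma-algebra. *)
Definition coord_cylinders (X : countType) (R : realType) : set (set (X -> R)) :=
  [set C | exists u, exists2 B : set R, measurable B & C = [set f | B (f u)]].

Notation fields X R := (g_sigma_algebraType (@coord_cylinders X R)).

(* A trajectory is coded by its jump chain Y_0, Y_1, ... and its jump times
   S_0, S_1, ...; [None] is the cemetery.  A time [S_n] is [+oo] when fewer
   than [n] jumps occur. *)
Definition traj_cylinders (X : countType) (R : realType) :
    set (set ((nat -> option X) * (nat -> \bar R))) :=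
  [set C | (exists n z, C = [set w : _ * _ | w.1 n = z]) \/
     (exists n, exists2 B : set (\bar R),
        measurable B & C = [set w : _ * _ | B (w.2 n)])].

Notation trajectories X R := (g_sigma_algebraType (@traj_cylinders X R)).

Section Trajectories.
Context {R : realType} {X : countType}.
Implicit Types w : trajectories X R.

Definition chain w (n : nat) : option X := w.1 n.
Definition jump_time w (n : nat) : \bar R := w.2 n.
Definition holding_time w (n : nat) : \bar R :=
  (jump_time w n.+1 - jump_time w n)%E.

Definition regular_traj w : Prop :=
  [/\ jump_time w 0 = 0%E,
      forall n, chain w n <> None -> (jump_time w n < jump_time w n.+1)%E &
      forall n, chain w n = None -> jump_time w n.+1 = +oo%E].

(* X_t; it is [None] from the jump to the cemetery on, and also from an
   accumulation point of the jump times on. *)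
Definition state w (t : R) : option X :=
  if pselect (exists n, (jump_time w n <= t%:E < jump_time w n.+1)%E) is left ex
  then chain w (ex_minn ex) else None.

Definition occupation w (t : \bar R) (u : X) : \bar R :=
  (\int[lebesgue_measure]_(s in [set s : R | (0 <= s)%R /\ s%:E <= t])
     (\1_[set r : R | state w r = Some u] s)%:E)%E.

(* [None] stands for eta = oo. *)
Definition eta w : option nat :=
  if pselect (exists n, chain w n.+1 == None) is left ex
  then Some (ex_minn ex) else None.

Definition jump_sign (S : X -> X -> R) (a b : option X) : R :=
  if (a, b) is (Some u, Some v) then S u v else 1.

(* The value on eta = oo is a dummy one. *)
Definition final_sign (S : X -> X -> R) w : R :=
  if eta w is Some n
  then \prod_(1 <= i < n.+1) jump_sign S (chain w i.-1) (chain w i) else 0.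

(* The process dies at the end of its stay in Y_n. *)
Definition kill_after (n : nat) w : trajectories X R :=
  (fun k => if (k <= n)%N then chain w k else None,
   fun k => if (k <= n.+1)%N then jump_time w k else +oo%E).

End Trajectories.

Section MarkovProcess.
Context {R : realType} {X : countType}.
Variable Q : X -> X -> R.

Definition jump_prob (a b : option X) : R :=
  match a, b with
  | Some u, Some v => jump_mx Q u v
  | Some u, None => 1 - fine (csum (jump_mx Q u))
  | None, Some _ => 0
  | None, None => 1
  end.

Context {d : measure_display} {T : measurableType d}.

(* [W] is the process and [P x] the probability for the process started at x.
   The last clause says that, conditionally on the jump chain, the holding
   times in the states of X are independent and exponential. *)
Definition is_markov_process (P : X -> probability T R)
    (W : {mfun T >-> trajectories X R}) : Prop :=
  [/\ forall w, regular_traj (W w),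
      forall x n (z : nat -> option X),
        P x [set w | forall i, (i <= n)%N -> chain (W w) i = z i] =
        ((z 0%N == Some x)%:R * \prod_(i < n) jump_prob (z i) (z i.+1))%:E &
      forall x n (z : nat -> option X) (B : nat -> set R),
        (forall i, measurable (B i)) ->
        P x [set w | forall i, (i <= n)%N -> chain (W w) i = z i /\
               (z i <> None -> (EFin @` B i) (holding_time (W w) i))] =
        (P x [set w | forall i, (i <= n)%N -> chain (W w) i = z i] *
         \prod_(i < n.+1)
           (if z i is Some u then exponential_prob (- Q u u) (B i) else 1))%E].

End MarkovProcess.

Section ConditionedMeasure.
Context {R : realType} {X : countType}.

Definition killed_from (y : X) : set (trajectories X R) :=
  [set w | exists n, eta w = Some n /\ chain w n = Some y].

(* Conditional law, for a process of law [L], given that it is killed from y.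
   If y has no direct transition to the cemetery, the conditioning event is
   null; the conditional law is then read as that of the process killed at the
   end of one of its visits to y, all visits being equally weighted.  Since the
   holding time at y is independent of the next jump, this second formula gives
   the elementary conditional law whenever the latter makes sense. *)
Definition killed_from_law (L : set (trajectories X R) -> \bar R) (y : X)
    (C : set (trajectories X R)) : \bar R :=
  (if L (killed_from y) == 0 then
     (\sum_(0 <= n <oo) L [set w | chain w n = Some y /\ C (kill_after n w)]) *
     ((fine (\sum_(0 <= n <oo) L [set w | chain w n = Some y]))^-1)%:E
   else L (C `&` killed_from y) * ((fine (L (killed_from y)))^-1)%:E)%E.

Definition mu_meas (Q : X -> X -> R) d (T : measurableType d)
    (P : X -> probability T R) (W : {mfun T >-> trajectories X R}) (x y : X) :
    set (trajectories X R) -> \bar R :=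
  fun C => ((- inv_mx Q x y)%:E * killed_from_law (distribution (P x) W) y C)%E.

End ConditionedMeasure.

(* Main.v *)
Require Import Defs.
From HB Require Import structures.
From mathcomp Require Import all_boot all_order all_algebra.
From mathcomp Require Import all_classical all_reals all_analysis.
From mathcomp Require Import measurable_realfun.
From mathcomp Require Import ring lra.

(** Both sides are integrals of [F] against finite signed measures on [R^X], so by
   uniqueness of Laplace transforms it suffices to take
   [F f = exp (- \sum_i k_i f(u_i))] with [k_i >= 0].
   On the Gaussian side, multiplying by [exp (- k Z_u^2 / 2)] keeps the field
   Gaussian, up to a constant [c], and changes the covariance by the rank-one
   update [G - k / (1 + k G(u,u)) G(.,u) G(u,.)].
   On the path side, the jump chain and the exponential holding times give
   [\int exp (- \sum_i k_i l^{u_i}) H d mu_xy] as a sum over paths: it is the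
   Green function of [Q o S] with additional killing at the rate [k_i] at [u_i].
   A first-visit decomposition shows that adding a killing rate is the same
   rank-one update, and for no killing the Green function is the covariance of
   the field.  Hence both sides are [c G(x,y)] with the same [c] and [G]. *)

Set Implicit Arguments.
Unset Strict Implicit.
Unset Printing Implicit Defensive.
Import Order.TTheory GRing.Theory Num.Theory.
Import numFieldNormedType.Exports.

Local Open Scope classical_set_scope.
Local Open Scope ring_scope.

(** * Monotone classes *)

Section BoundedMonotoneClass.
Context {d : measure_display} {T : measurableType d} {R : realType}.
Implicit Types F G : T -> R.

(** The signs are the main obstacle. The weight H makes the path side a signed measure, which is
    represented by a positive measure together with an integrable density. Signs also affect the
    Green function: nothing in its series shows that 1 + k G(u,u) is positive. That positivity is
    borrowed from the field, where G(u,u) is a variance under the tilted measure; hence the two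
    rank-one updates are matched one weight at a time. No density of the field is used. Gaussian
    laws enter through integrals of cos(th + Y), the phase th replacing complex exponentials. The
    constant c is the total mass E exp(- sum_i k_i Z_{u_i}^2 / 2). It reappears on the path side
    because the Laplace functional of a sum of independent fields factors. Finally, mu_xy is given
    by one of two formulas, according to whether death from y has positive probability. A boolean
    [kill] runs through the path computations to treat both at once; the factor by which they differ
    cancels in the normalization. *)

Definition bounded_measurable F :=
  measurable_fun setT F /\ exists M : R, forall x, `|F x| <= M.

Lemma bounded_measurable_cst (k : R) : bounded_measurable (cst k : T -> R).
Proof. by split; [exact: measurable_cst|exists `|k|]. Qed.

Lemma bounded_measurable_indic (C : set T) :
  measurable C -> bounded_measurable (\1_C : T -> R).
Proof.
move=> mC; split; first exact: measurable_indic.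
by exists 1 => x; rewrite indicE; case: (_ \in _); rewrite ?normr1 ?normr0 ?ler01.
Qed.

Lemma bounded_measurableZD (a : R) F G :
  bounded_measurable F -> bounded_measurable G ->
  bounded_measurable (fun x => a * F x + G x).
Proof.
move=> [mF [M FM]] [mG [N GN]]; split.
  by apply: measurable_funD => //; exact: measurable_funM.
exists (`|a| * M + N) => x; rewrite (le_trans (ler_normD _ _))// lerD//.
by rewrite normrM ler_wpM2l.
Qed.

Lemma bounded_measurableM F G : bounded_measurable F -> bounded_measurable G ->
  bounded_measurable (fun x => F x * G x).
Proof.
move=> [mF [M FM]] [mG [N GN]]; split; first exact: measurable_funM.
by exists (M * N) => x; rewrite normrM ler_pM.
Qed.

Variable H : (T -> R) -> Prop.
Hypothesis H_lin : forall a F G, bounded_measurable F -> bounded_measurable G ->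
  H F -> H G -> H (fun x => a * F x + G x).
Hypothesis H_lim : forall (Fn : nat -> T -> R) F (M : R),
  (forall n, measurable_fun setT (Fn n)) -> (forall n x, `|Fn n x| <= M) ->
  (forall x, Fn n x @[n --> \oo] --> F x) -> (forall n, H (Fn n)) -> H F.

(** The sets with indicator in [H] form a Dynkin system: complements come from linearity, countable
    disjoint unions from bounded limits of finite ones. *)
Lemma monotone_class_indic (D : set (set T)) :
  @measurable _ T = <<s D >> -> setI_closed D ->
  H (cst 1) -> (forall C, D C -> H (\1_C)) ->
  forall C, measurable C -> H (\1_C).
Proof.
move=> mD DI H1 HD C; rewrite mD.
have mDm : D `<=` @measurable _ T by rewrite mD; exact: sub_gen_smallest.
apply: (@dynkin_induction _ T D (fun C => H (\1_C))) => //.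
- rewrite (_ : \1_[set: T] = cst 1 :> (T -> R))//.
  by apply/funext => x; rewrite indicT.
- move=> S mS HS.
  rewrite (_ : \1_(~` S) = (fun x => -1 * \1_S x + cst 1 x) :> (T -> R)).
    apply: H_lin => //; first exact: bounded_measurable_indic.
    exact: bounded_measurable_cst.
  by apply/funext => x; rewrite !indicE in_setC; case: (x \in S) => /=; ring.
- move=> F mF tF HF.
  pose S n := \big[setU/set0]_(i < n) F i.
  have mS n : measurable (S n) by exact: bigsetU_measurable.
  have HS n : H (\1_(S n)).
    elim: n => [|n IH].
      rewrite (_ : \1_(S 0%N) = (fun x => -1 * cst 1 x + cst 1 x) :> (T -> R)).
        by apply: H_lin => //; exact: bounded_measurable_cst.
      by apply/funext => x; rewrite /S big_ord0 indic0 /=; ring.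
    rewrite (_ : \1_(S n.+1) = (fun x => 1 * \1_(S n) x + \1_(F n) x) :> (T -> R)).
      by apply: H_lin => //; exact: bounded_measurable_indic.
    apply/funext => x.
    have -> : S n.+1 = S n `|` F n by rewrite /S big_ord_recr.
    rewrite mul1r !indicE in_setU.
    case: (boolP (x \in S n)) => [xS|_]; last by rewrite /= add0r.
    case: (boolP (x \in F n)) => [xF|_]; last by rewrite addr0.
    exfalso; move: xS xF; rewrite !inE /S.
    rewrite -bigcup_mkord => -[k /= kn Fkx] Fnx.
    have := tF k n I I (ex_intro _ x (conj Fkx Fnx)).
    by move=> kE; rewrite kE ltnn in kn.
  apply: (H_lim (Fn := fun n => \1_(S n)) (M := 1)) => //.
  - by move=> n x; rewrite indicE; case: (_ \in _); rewrite ?normr1 ?normr0 ?ler01.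
  - move=> x; apply: cvg_near_cst.
    rewrite !indicE; have [/set_mem[k _ Fkx]|xN] := boolP (x \in \bigcup_k F k).
      exists k.+1 => // n /= kn; rewrite indicE (_ : x \in S n)//.
      by apply/mem_set; rewrite /S -bigcup_mkord; exists k.
    near=> n; rewrite indicE (_ : x \in S n = false)//; apply/negbTE.
    apply: contra xN => /set_mem; rewrite /S -bigcup_mkord => -[k _ Fkx].
    by apply/mem_set; exists k.
Unshelve. end_near.
Qed.

Import HBNNSimple.

(** A nonnegative function is a bounded increasing limit of simple functions, which are linear
    combinations of indicators; the general case splits into positive and negative parts. *)
Lemma monotone_class_bounded :
  (forall C, measurable C -> H (\1_C)) ->
  forall F, bounded_measurable F -> H F.
Proof.
move=> H1.
have Hlin2 (r : seq R) (A : R -> set T) : (forall y, measurable (A y)) ->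
    bounded_measurable (fun x => \sum_(y <- r) (y * \1_(A y) x)) /\
    H (fun x => \sum_(y <- r) (y * \1_(A y) x)).
  move=> mA; elim: r => [|y r [bIH IH]].
    under eq_fun do rewrite big_nil.
    split; first exact: bounded_measurable_cst.
    rewrite (_ : (fun _ => _) = (fun x => -1 * \1_setT x + \1_setT x)).
      by apply: H_lin; first [exact: H1|exact: bounded_measurable_indic].
    by apply/funext => x; ring.
  under eq_fun do rewrite big_cons.
  have bA := @bounded_measurable_indic (A y) (mA y).
  by split; [exact: bounded_measurableZD|apply: H_lin => //; exact: H1].
have Hge0 F : bounded_measurable F -> (forall x, 0 <= F x) -> H F.
  move=> [mF [M FM]] F0.
  have mF' : measurable_fun setT (EFin \o F) by exact/measurable_EFinP.
  pose f n := nnsfun_approx measurableT mF' n.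
  have fF n x : f n x <= F x.
    rewrite /f nnsfun_approxE -lee_fin.
    by apply: (@le_approx _ _ _ setT (EFin \o F)) => // y _; rewrite lee_fin.
  apply: (H_lim (Fn := fun n => f n) (M := M)).
  - by move=> n; exact: measurable_funPT.
  - move=> n x; rewrite ger0_norm; last exact: fun_ge0.
    by rewrite (le_trans (fF n x))// (le_trans (ler_norm _)).
  - move=> x.
    exact: (fine_cvg (@cvg_nnsfun_approx _ _ _ _ measurableT _ mF' (fun x _ => F0 x) x I)).
  - move=> n.
    rewrite (_ : (f n : T -> R) = (fun x => \sum_(y <- finmap.enum_fset (fset_set (range (f n))))
        (y * \1_(f n @^-1` [set y]) x))).
      have mf y : measurable (f n @^-1` [set y]).
        exact: measurable_funPTI.
      exact: (Hlin2 _ _ mf).2.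
    by apply/funext => x; rewrite [LHS]fimfunE fsbig_finite.
move=> F [mF [M FM]].
have bFp : bounded_measurable (fun x => Num.max (F x) 0).
  split; first exact: measurable_maxr.
  exists M => x; have := FM x; case: (leP (F x) 0) => // _.
  by rewrite normr0 => /(le_trans (normr_ge0 _)).
have bFn : bounded_measurable (fun x => Num.max (- F x) 0).
  split; first by apply: measurable_maxr => //; exact: measurableT_comp.
  exists M => x; have := FM x; case: (leP (- F x) 0) => // _.
    by rewrite normr0 => /(le_trans (normr_ge0 _)).
  by rewrite normrN.
rewrite (_ : F = (fun x => -1 * Num.max (- F x) 0 + Num.max (F x) 0)).
  by apply: H_lin => //; apply: Hge0 => // x; rewrite le_max lexx orbT.
apply/funext => x; case: (leP (F x) 0); case: (leP (- F x) 0); lra.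
Qed.

End BoundedMonotoneClass.

(** * Laplace functionals determine weighted laws *)

Section LaplaceUniqueness.
Context {R : realType}.
Implicit Types s t a : R.

Lemma expr_1B_ge (x : R) n : 0 <= x <= 1 -> 1 - n%:R * x <= (1 - x) ^+ n.
Proof.
move=> /andP[x0 x1]; elim: n => [|n IH]; first by rewrite expr0; lra.
rewrite exprS (@le_trans _ _ ((1 - x) * (1 - n%:R * x)))//; last first.
  by rewrite ler_wpM2l// subr_ge0.
rewrite -natr1; have : 0 <= n%:R * x * x by rewrite !mulr_ge0.
nra.
Qed.

Lemma expr_1B_le (x : R) n : 0 <= x <= 1 -> (1 - x) ^+ n <= expR (- (n%:R * x)).
Proof.
move=> /andP[x0 x1]; rewrite -mulrN expRM_natl lerXn2r// ?nnegrE ?expR_ge0//.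
  by rewrite subr_ge0.
by rewrite -[1 - x]/(1 + - x) expR_ge1Dx.
Qed.

(** exp(n a) is the square of exp(n a / 2), which is at least c (n + 1); this leaves a multiple of 1
    / (n + 1). *)
Lemma cvg_nat_expRN a : 0 < a -> n%:R * expR (- (n%:R * a)) @[n --> \oo] --> (0 : R).
Proof.
move=> a0; pose c := Num.min 1 (a / 2).
have c0 : 0 < c by rewrite lt_min ltr01 divr_gt0.
have cn n : c * n.+1%:R <= expR (n%:R * (a / 2)).
  apply: le_trans (expR_ge1Dx _); rewrite -natr1 mulrDr addrC lerD//.
    by rewrite mulr1 ge_min lexx.
  by rewrite mulrC ler_wpM2l// ge_min lexx orbT.
apply: (@squeeze_cvgr _ _ _ _ (cst 0) (fun n => c ^- 2 * harmonic n)).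
- apply: nearW => n; rewrite mulr_ge0 ?expR_ge0//= expRN.
  rewrite [in X in X^-1](_ : n%:R * a = n%:R * (a / 2) + n%:R * (a / 2)); last by field.
  rewrite expRD; set y := c * n.+1%:R.
  have y0 : 0 < y by rewrite mulr_gt0// ltr0n.
  have -> : c ^- 2 * harmonic n = n.+1%:R * (y * y)^-1.
    by rewrite /y /harmonic /=; field; rewrite gt_eqF ?ltr0n//= gt_eqF.
  rewrite ler_pM ?invr_ge0 ?mulr_ge0 ?expR_ge0 ?ler_nat//.
  rewrite lef_pV2 ?posrE ?mulr_gt0 ?expR_gt0//.
  by rewrite ler_pM ?cn// ltW.
- exact: cvg_cst.
- by rewrite -[X in _ --> X](mulr0 (c ^- 2)); apply: cvgMr; exact: cvg_harmonic.
Qed.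

(* The exponent is about [n exp(n s)], so that [(1 - exp(- n t))^N] is close to
   [exp(- n exp(n (s - t)))]. *)
Definition ray_exponent s (n : nat) : nat := Num.truncn (n%:R * expR (n%:R * s)).

(** For s < t Bernoulli's inequality bounds the power below by 1 - n exp(- n (t - s)). For t <= s
    the power is at most exp(1 - n), so that the boundary t = s goes to 0 and the limit is the
    indicator of an open ray. *)
Lemma cvg_ray_exponent s t : 0 <= t ->
  (1 - expR (- (n%:R * t))) ^+ ray_exponent s n @[n --> \oo] --> ((s < t)%R%:R : R).
Proof.
move=> t0.
have e01 n : 0 <= expR (- (n%:R * t)) <= 1.
  by rewrite expR_ge0/= -expR0 ler_expR oppr_le0 mulr_ge0.
have Nle n : (ray_exponent s n)%:R <= n%:R * expR (n%:R * s).
  by rewrite /ray_exponent truncn_le// mulr_ge0// expR_ge0.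
have Nge n : n%:R * expR (n%:R * s) - 1 <= (ray_exponent s n)%:R.
  rewrite lerBlDr natr1 ltW// /ray_exponent.
  by have /andP[] := @truncn_itv R _ (mulr_ge0 (ler0n R n) (expR_ge0 (n%:R * s))).
have [st|ts] := ltP s t.
  apply: (@squeeze_cvgr _ _ _ _ (fun n => 1 - n%:R * expR (- (n%:R * (t - s)))) (cst 1)).
  - apply: nearW => n; rewrite (le_trans _ (expr_1B_ge _ (e01 n)))/=; last first.
      rewrite lerD2l lerN2 (le_trans (ler_wpM2r (expR_ge0 _) (Nle n)))//.
      by rewrite -mulrA -expRD ler_wpM2l// ler_expR; lra.
    by rewrite exprn_ile1 ?subr_ge0 ?gerBl; case/andP: (e01 n).
  - rewrite -[X in _ --> X]subr0; apply: cvgB; first exact: cvg_cst.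
    by apply: cvg_nat_expRN; rewrite subr_gt0.
  - exact: cvg_cst.
apply: (@squeeze_cvgr _ _ _ _ (cst 0) (fun n => expR 1 * harmonic n)).
- apply: nearW => n; rewrite exprn_ge0 ?subr_ge0//=; last by case/andP: (e01 n).
  rewrite (le_trans (expr_1B_le _ (e01 n)))//.
  rewrite (@le_trans _ _ (expR (1 - n%:R)))//.
    rewrite ler_expR lerNl opprB.
    rewrite (le_trans _ (ler_wpM2r (expR_ge0 _) (Nge n)))// mulrBl mul1r -mulrA -expRD.
    rewrite lerB//; last by case/andP: (e01 n).
    by rewrite ler_peMr// -expR0 ler_expR -mulrBr mulr_ge0// subr_ge0.
  rewrite expRD ler_wpM2l ?expR_ge0// expRN /harmonic lef_pV2 ?posrE ?expR_gt0//.
  by rewrite -natr1 addrC expR_ge1Dx.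
- exact: cvg_cst.
- by rewrite -[X in _ --> X](mulr0 (expR 1)); apply: cvgMr; exact: cvg_harmonic.
Qed.

(** * Laplace functionals and generating sets on the space of fields *)

Section fields.
Context {X : countType}.
Implicit Types (L : seq (X * R)) (f : fields X R).

Lemma measurable_coord (u : X) : measurable_fun setT (fun f => f u : R).
Proof.
move=> _ B mB; rewrite setTI; apply: sub_gen_smallest.
by exists u; exists B.
Qed.

Lemma measurable_fieldsP d (T : measurableType d) (phi : T -> fields X R) :
  (forall u, measurable_fun setT (fun x => phi x u)) -> measurable_fun setT phi.
Proof.
move=> mphi; refine (@measurability _ _ T (fields X R) setT phi (@coord_cylinders X R) erefl _).
move=> _ [_ [u [B mB ->]] <-].
exact: (mphi u).
Qed.

(** A point may occur several times in the list and its weights then add up; so products of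
    functionals are concatenations of lists. *)
Definition laplace L f : R := expR (- \sum_(p <- L) p.2 * f p.1).

Lemma laplace_cat L L' f : laplace (L ++ L') f = laplace L f * laplace L' f.
Proof. by rewrite /laplace big_cat/= opprD expRD. Qed.

Lemma laplace_gt0 L f : 0 < laplace L f. Proof. exact: expR_gt0. Qed.

Lemma laplace_le1 L f : (forall p, p \in L -> 0 <= p.2) ->
  (forall u, 0 <= f u) -> laplace L f <= 1.
Proof.
move=> L0 f0; rewrite /laplace -expR0 ler_expR oppr_le0 big_seq sumr_ge0// => p pL.
by rewrite mulr_ge0 ?L0.
Qed.

Lemma measurable_laplace L : measurable_fun setT (laplace L : fields X R -> R).
Proof.
apply: measurableT_comp => //; apply: measurableT_comp => //.
apply: measurable_sum => p; apply: measurable_funM => //.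
exact: measurable_coord.
Qed.

Definition ray_sets : set (set (fields X R)) :=
  [set C | exists L, C = [set f | forall p, p \in L -> p.2 < f p.1]].

Lemma ray_sets_generate : @measurable _ (fields X R) = <<s ray_sets >>.
Proof.
apply/seteqP; split; last first.
  apply: smallest_sub; first exact: sigma_algebra_measurable.
  move=> _ [L ->]; elim: L => [|p L IH].
    by rewrite (_ : [set f | _] = setT)//; apply/seteqP; split.
  rewrite (_ : [set f | _] = (fun f : fields X R => f p.1) @^-1` `]p.2, +oo[ `&`
      [set f | forall q, q \in L -> q.2 < f q.1]).
    apply: measurableI => //; rewrite -[X in measurable X]setTI.
    by apply: (measurable_coord p.1) => //; exact: measurable_itv.
  apply/seteqP; split=> f /=.
    move=> h; split; first by rewrite in_itv/= andbT; apply: h; rewrite mem_head.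
    by move=> q qL; apply: h; rewrite in_cons qL orbT.
  move=> [+ h] q; rewrite in_itv/= andbT => h1.
  by rewrite in_cons => /predU1P[->//|/h].
apply: smallest_sub; first exact: smallest_sigma_algebra.
move=> _ [u [B mB ->]].
(* The inclusion is restated as measurability of the coordinate for the sigma-algebra generated by
   [ray_sets], where it suffices to test open rays. *)
have : measurable_fun setT (fun f : g_sigma_algebraType ray_sets => (f : X -> R) u).
  apply: (@measurability _ _ _ _ _ _ (@RGenOInfty.G R)).
    exact: RGenOInfty.measurableE.
  move=> _ [_ [a ->] <-]; rewrite setTI; apply: sub_gen_smallest.
  exists [:: (u, a)]; apply/seteqP; split=> f /=.
    by rewrite in_itv/= andbT => h q; rewrite inE => /eqP ->.
  by move=> h; rewrite in_itv/= andbT; apply: (h (u, a)); rewrite mem_head.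
by move=> /(_ measurableT _ mB); rewrite setTI.
Qed.

Lemma ray_sets_setI : setI_closed ray_sets.
Proof.
move=> _ _ [L ->] [L' ->]; exists (L ++ L'); apply/seteqP; split=> f /=.
  by move=> [h h'] p; rewrite mem_cat => /orP[/h|/h'].
by move=> h; split=> p pL; apply: h; rewrite mem_cat pL ?orbT.
Qed.

End fields.

(** * Images of signed densities *)

Section weighted_integral.
Context {d1 d2 : measure_display} {T1 : measurableType d1} {T2 : measurableType d2}.
Variables (m : {measure set T1 -> \bar R}) (phi : T1 -> T2) (w : T1 -> R).
Hypothesis mphi : measurable_fun setT phi.
Hypothesis iw : m.-integrable setT (EFin \o w).

Let mw : measurable_fun setT w.
Proof. by apply/measurable_EFinP; exact: measurable_int iw. Qed.

Lemma integrable_weighted (F : T2 -> R) : bounded_measurable F ->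
  m.-integrable setT (fun x => (w x * F (phi x))%:E).
Proof.
move=> [mF [M FM]].
apply: (@le_integrable _ _ _ m _ measurableT _ (fun x => `|M|%:E * (EFin \o w) x)%E).
- apply/measurable_EFinP; apply: measurable_funM => //.
  exact: measurableT_comp.
- move=> x _; rewrite /= lee_fin !normrM mulrC ler_wpM2r// normr_id.
  by rewrite (le_trans (FM _))// ler_norm.
- exact: integrableZl.
Qed.

Lemma integral_weightedZD a (F G : T2 -> R) :
  bounded_measurable F -> bounded_measurable G ->
  (\int[m]_x (w x * (a * F (phi x) + G (phi x)))%:E =
   a%:E * \int[m]_x (w x * F (phi x))%:E + \int[m]_x (w x * G (phi x))%:E)%E.
Proof.
move=> bF bG.
under eq_integral do rewrite mulrDr mulrCA EFinD EFinM.
rewrite integralD//; last 2 first.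
- by apply: integrableZl => //; exact: integrable_weighted.
- exact: integrable_weighted.
by rewrite integralZl//; exact: integrable_weighted.
Qed.

Lemma integral_weighted_cvg (Fn : nat -> T2 -> R) F (M : R) :
  (forall n, measurable_fun setT (Fn n)) -> (forall n x, `|Fn n x| <= M) ->
  (forall x, Fn n (phi x) @[n --> \oo] --> F (phi x)) ->
  (\int[m]_x (w x * Fn n (phi x))%:E @[n --> \oo] -->
   \int[m]_x (w x * F (phi x))%:E)%E.
Proof.
move=> mF FM Fcvg.
have mwF n : measurable_fun setT (fun x => w x * Fn n (phi x)).
  by apply: measurable_funM => //; exact: measurableT_comp.
have wcvg x : (w x * Fn n (phi x))%:E @[n --> \oo] --> (w x * F (phi x))%:E.
  by apply: cvg_EFin; [exact: nearW|apply: cvgMr; exact: Fcvg].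
have mwFE n : measurable_fun setT (fun x => (w x * Fn n (phi x))%:E).
  exact/measurable_EFinP.
have [] // := @dominated_convergence _ _ _ m setT measurableT
    (fun n x => (w x * Fn n (phi x))%:E) (fun x => (w x * F (phi x))%:E)
    (fun x => `|M|%:E * (abse \o (EFin \o w)) x)%E.
- exact: (emeasurable_fun_cvg (fun n x => (w x * Fn n (phi x))%:E)).
- exact: aeW.
- by apply: integrableZl => //; exact: integrable_abse.
- apply: aeW => x n _; rewrite /= lee_fin normrM mulrC ler_wpM2r//.
  by rewrite (le_trans (FM _ _))// ler_norm.
Qed.

End weighted_integral.

Section weighted_integral_unique.
Context {d1 d2 d : measure_display} {T1 : measurableType d1}
  {T2 : measurableType d2} {T : measurableType d}.
Variables (m1 : {measure set T1 -> \bar R}) (m2 : {measure set T2 -> \bar R}).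
Variables (phi1 : T1 -> T) (phi2 : T2 -> T) (w1 : T1 -> R) (w2 : T2 -> R).
Hypotheses (mphi1 : measurable_fun setT phi1) (mphi2 : measurable_fun setT phi2).
Hypotheses (iw1 : m1.-integrable setT (EFin \o w1))
  (iw2 : m2.-integrable setT (EFin \o w2)).

(** The images under [phi1] and [phi2] of the signed measures with densities [w1] and [w2] give the
    same integral to [F]. *)
Definition weighted_eq (F : T -> R) : Prop :=
  (\int[m1]_x (w1 x * F (phi1 x))%:E = \int[m2]_x (w2 x * F (phi2 x))%:E)%E.

Lemma weighted_eqZD a (F G : T -> R) : bounded_measurable F ->
  bounded_measurable G -> weighted_eq F -> weighted_eq G ->
  weighted_eq (fun x => a * F x + G x).
Proof. by move=> bF bG HF HG; rewrite /weighted_eq !integral_weightedZD// HF HG. Qed.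

(** Convergence is asked only on the images of [phi1] and [phi2], which allows limits that hold at
    nonnegative fields only. *)
Lemma weighted_eq_cvg (Fn : nat -> T -> R) F (M : R) :
  (forall n, measurable_fun setT (Fn n)) -> (forall n x, `|Fn n x| <= M) ->
  (forall x, Fn n (phi1 x) @[n --> \oo] --> F (phi1 x)) ->
  (forall x, Fn n (phi2 x) @[n --> \oo] --> F (phi2 x)) ->
  (forall n, weighted_eq (Fn n)) -> weighted_eq F.
Proof.
move=> mFn FM FF1 FF2 HFn.
have c1 := integral_weighted_cvg mphi1 iw1 mFn FM FF1.
have c2 := integral_weighted_cvg mphi2 iw2 mFn FM FF2.
rewrite /weighted_eq -(cvg_lim _ c1)// -(cvg_lim _ c2)//; congr (limn _).
by apply/funext => n; exact: HFn.
Qed.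

Lemma weighted_eq_bounded (D : set (set T)) :
  @measurable _ T = <<s D >> -> setI_closed D ->
  weighted_eq (cst 1) -> (forall C, D C -> weighted_eq (\1_C)) ->
  forall F, bounded_measurable F -> weighted_eq F.
Proof.
move=> mD DI H1 HD.
have H_lim (Fn : nat -> T -> R) F (M : R) :
    (forall n, measurable_fun setT (Fn n)) -> (forall n x, `|Fn n x| <= M) ->
    (forall x, Fn n x @[n --> \oo] --> F x) ->
    (forall n, weighted_eq (Fn n)) -> weighted_eq F.
  by move=> mFn FM FF; apply: weighted_eq_cvg FM _ _.
apply: (monotone_class_bounded weighted_eqZD H_lim).
exact: (monotone_class_indic weighted_eqZD H_lim mD DI).
Qed.

End weighted_integral_unique.

(* Both sides are signed measures on fields: [wi] is the density of the i-th one
   with respect to the image of [mi] by [phii]. *)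
Theorem laplace_unique (X : countType)
    (d1 d2 : measure_display) (T1 : measurableType d1) (T2 : measurableType d2)
    (m1 : {measure set T1 -> \bar R}) (m2 : {measure set T2 -> \bar R})
    (phi1 : T1 -> fields X R) (phi2 : T2 -> fields X R)
    (w1 : T1 -> R) (w2 : T2 -> R) :
  measurable_fun setT phi1 -> measurable_fun setT phi2 ->
  m1.-integrable setT (EFin \o w1) -> m2.-integrable setT (EFin \o w2) ->
  (forall x u, 0 <= phi1 x u) -> (forall x u, 0 <= phi2 x u) ->
  (forall L : seq (X * R), (forall p, p \in L -> 0 <= p.2) ->
    (\int[m1]_x (w1 x * laplace L (phi1 x))%:E =
     \int[m2]_x (w2 x * laplace L (phi2 x))%:E)%E) ->
  forall F : fields X R -> R, bounded_measurable F ->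
    (\int[m1]_x (w1 x * F (phi1 x))%:E = \int[m2]_x (w2 x * F (phi2 x))%:E)%E.
Proof.
move=> mphi1 mphi2 iw1 iw2 phi10 phi20 Llap.
pose H := weighted_eq m1 m2 phi1 phi2 w1 w2.
have H_lin := weighted_eqZD mphi1 mphi2 iw1 iw2.
have H_limr (Fn : nat -> fields X R -> R) (F : fields X R -> R) (M : R) :
    (forall n, measurable_fun setT (Fn n)) -> (forall n x, `|Fn n x| <= M) ->
    (forall x, (forall u, 0 <= x u) -> Fn n x @[n --> \oo] --> F x) ->
    (forall n, H (Fn n)) -> H F.
  move=> mFn FM FF; apply: (weighted_eq_cvg mphi1 mphi2 iw1 iw2 mFn FM) => x.
    by apply: FF; exact: phi10.
  by apply: FF; exact: phi20.
have Hext (F G : fields X R -> R) :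
    (forall f, (forall u, 0 <= f u) -> F f = G f) -> H G -> H F.
  move=> FG; rewrite /H /weighted_eq => HG.
  under eq_integral do rewrite FG//.
  by under [in RHS]eq_integral do rewrite FG//.
(* Absolute values make the Laplace functionals bounded on all fields; on the nonnegative fields
   taken by [phi1] and [phi2] they change nothing. *)
pose abs (f : fields X R) : fields X R := fun u => `|f u|.
have mabs : measurable_fun setT abs.
  apply: measurable_fieldsP => u; apply: measurableT_comp => //.
  exact: measurable_coord.
pose nneg (L : seq (X * R)) := forall p, p \in L -> 0 <= p.2.
have blap L : nneg L -> bounded_measurable (fun f => laplace L (abs f)).
  move=> L0; split.
    by apply: measurableT_comp mabs; exact: measurable_laplace.
  exists 1 => f; rewrite ger0_norm; last exact/ltW/laplace_gt0.
  by apply: laplace_le1 => // u; exact: normr_ge0.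
(* The spare Laplace factor makes the class stable under multiplication by 1 - [laplace L]:
   expanding the product only lengthens the list. *)
pose A F := bounded_measurable F /\
  forall L, nneg L -> H (fun f => F f * laplace L (abs f)).
have A1 : A (cst 1).
  split; first exact: bounded_measurable_cst.
  move=> L L0; apply: (Hext _ (fun f => laplace L f)); last exact: Llap.
  move=> f f0; rewrite mul1r; congr laplace.
  by apply/funext => u; rewrite /abs ger0_norm.
have AM F L : nneg L -> A F -> A (fun f => F f * (1 - laplace L (abs f))).
  move=> L0 [bF HF]; split.
    apply: bounded_measurableM => //.
    rewrite (_ : (fun _ => _) = (fun f => -1 * laplace L (abs f) + cst 1 f)).
      by apply: bounded_measurableZD; [exact: blap|exact: bounded_measurable_cst].
    by apply/funext => f /=; ring.
  move=> L' L'0.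
  rewrite (_ : (fun _ => _) = (fun f => -1 * (F f * laplace (L ++ L') (abs f)) +
      F f * laplace L' (abs f))).
    have LL' : nneg (L ++ L') by move=> p; rewrite mem_cat => /orP[/L0|/L'0].
    by apply: H_lin; [apply: bounded_measurableM => //; exact: blap
      |apply: bounded_measurableM => //; exact: blap|exact: HF|exact: HF].
  by apply/funext => f; rewrite laplace_cat; ring.
have AX F L n : nneg L -> A F -> A (fun f => F f * (1 - laplace L (abs f)) ^+ n).
  move=> L0 AF; elim: n => [|n IH].
    by rewrite (_ : (fun _ => _) = F)//; apply/funext => f; rewrite expr0 mulr1.
  rewrite (_ : (fun _ => _) = (fun f => F f * (1 - laplace L (abs f)) ^+ n *
    (1 - laplace L (abs f)))); first exact: AM.
  by apply/funext => f; rewrite exprSr mulrA.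
(* By [cvg_ray_exponent] these polynomials in Laplace functionals tend to the indicator of an
   element of [ray_sets]. *)
pose ray L n f : R := \prod_(p <- L)
  (1 - expR (- (n%:R * abs f p.1))) ^+ ray_exponent p.2 n.
have Aray L n : A (ray L n).
  elim: L => [|p L IH].
    by rewrite (_ : ray _ _ = cst 1)//; apply/funext => f; rewrite /ray big_nil.
  rewrite (_ : ray _ _ = (fun f => ray L n f *
      (1 - laplace [:: (p.1, n%:R)] (abs f)) ^+ ray_exponent p.2 n)).
    by apply: AX => // q; rewrite inE => /eqP ->.
  by apply/funext => f; rewrite /ray big_cons /laplace big_seq1 mulrC.
have Hray C : ray_sets C -> H (\1_C).
  move=> [L ->]; apply: (H_limr (ray L) _ 1).
  - by move=> n; have [[]] := Aray L n.
  - move=> n f; rewrite /ray normr_prod; apply: Num.Theory.prodr_ile1 => p _.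
    have e1 : expR (- (n%:R * abs f p.1)) <= 1.
      by rewrite -expR0 ler_expR oppr_le0 mulr_ge0// normr_ge0.
    by rewrite normr_ge0/= normrX exprn_ile1// ger0_norm ?subr_ge0// gerBl expR_ge0.
  - move=> f f0; rewrite indicE.
    have -> : (f \in [set g : fields X R | forall p, p \in L -> p.2 < g p.1])%:R =
        \prod_(p <- L) ((p.2 < abs f p.1)%R%:R : R).
      elim: L => [|p L IH].
        by rewrite big_nil mem_set.
      rewrite big_cons -IH /abs ger0_norm//; have [pf|pf] := ltP p.2 (f p.1); last first.
        rewrite mul0r memNset//= => h.
        by have := h p (mem_head _ _); rewrite ltNge pf.
      rewrite mul1r; congr (_%:R); congr nat_of_bool.
      apply/idP/idP => /set_mem/= h; apply/mem_set => /= q qL.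
        by apply: h; rewrite in_cons qL orbT.
      by move: qL; rewrite in_cons => /predU1P[->//|]; exact: h.
    rewrite /ray; elim: L => [|p L IH].
      by rewrite big_nil; under eq_fun do rewrite big_nil; exact: cvg_cst.
    rewrite big_cons; under eq_fun do rewrite big_cons.
    by apply: cvgM => //; apply: cvg_ray_exponent; exact: normr_ge0.
  - move=> n; have [bF HF] := Aray L n.
    have := HF [::] (fun p => ltac:(by [])).
    by under [X in H X]eq_fun do rewrite /laplace big_nil oppr0 expR0 mulr1.
apply: (weighted_eq_bounded mphi1 mphi2 iw1 iw2 (@ray_sets_generate X)
  (@ray_sets_setI X)) => //.
have := A1.2 [::] (fun p => ltac:(by [])).
by under [X in H X]eq_fun do rewrite /laplace big_nil oppr0 expR0 mulr1.
Qed.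

End LaplaceUniqueness.

(** * The normal characteristic function *)

Local Notation "'d1 f" := (partial1of2 f) (at level 10, f at next level).

Section NormalCharacteristic.
Context {R : realType}.
Implicit Types m s t y th : R.
Notation mu := (@lebesgue_measure R).

(** The fundamental theorem of calculus on [-(n+1), n+1], followed by dominated convergence. It
    provides integration by parts on the whole line. *)
Lemma integral_deriveT_eq0 (F f : R -> R) :
  (forall x, is_derive x (1 : R) F (f x)) -> continuous f ->
  mu.-integrable setT (EFin \o f) ->
  F n%:R @[n --> \oo] --> 0 -> F (- n%:R) @[n --> \oo] --> 0 ->
  (\int[mu]_x (f x)%:E = 0)%E.
Proof.
move=> Ff cf intf Fp Fn.
pose I n : set R := `[- n.+1%:R, n.+1%:R]%classic.
have cF : continuous F.
  by move=> x; apply/differentiable_continuous/derivable1_diffP; have [] := Ff x.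
have intI n : (\int[mu]_(x in I n) (f x)%:E = (F n.+1%:R - F (- n.+1%:R))%:E)%E.
  rewrite EFinB; apply: continuous_FTC2.
  - by rewrite gtrN// ltr0n.
  - exact: continuous_subspaceT.
  - split; first by move=> x _; have [] := Ff x.
      by apply: cvg_at_right_filter; exact: cF.
    by apply: cvg_at_left_filter; exact: cF.
  - by move=> x _; rewrite derive1E derive_val.
have mf : measurable_fun setT f by exact: continuous_measurable_fun.
have [] // := @dominated_convergence _ _ _ mu setT measurableT
    (fun n x => ((EFin \o f) \_ (I n)) x) (EFin \o f) (abse \o (EFin \o f)).
- move=> n; apply/(measurable_restrictT _ _).1; first exact: measurable_itv.
  by apply: measurable_funTS; exact/measurable_EFinP.
- exact/measurable_EFinP.
- apply: aeW => x _; apply: cvg_near_cst.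
  near=> n; rewrite patchE mem_set// /I /= in_itv/= -ler_norml.
  rewrite (@le_trans _ _ n%:R) ?ler_nat//.
  by near: n; exact: nbhs_infty_ger.
- exact: integrable_abse.
- apply: aeW => x n _; rewrite patchE; case: ifP => //= _.
  by rewrite normr0 lee_fin.
move=> _ _ /cvg_lim h; rewrite -[LHS]h//; apply/cvg_lim => //.
rewrite [X in X @ _ --> _](_ : _ = (fun n => (F n.+1%:R - F (- n.+1%:R))%:E)).
  apply: cvg_EFin; first exact: nearW.
  rewrite -[X in _ --> X](subrr 0); apply: cvgB.
    by rewrite (cvg_shiftS (fun n => F n%:R)).
  by rewrite (cvg_shiftS (fun n => F (- n%:R))).
by apply/funext => n; rewrite -intI [RHS]integral_mkcond.
Unshelve. end_near.
Qed.

Lemma is_derive_normal_fun m s y : s != 0 ->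
  is_derive y (1 : R) (normal_fun m s) (- ((y - m) / s ^+ 2) * normal_fun m s y).
Proof.
move=> s0; rewrite /normal_fun.
have h : is_derive y (1 : R) (fun x : R => - (x - m) ^+ 2 / (s ^+ 2 *+ 2))
    (- ((y - m) / s ^+ 2)).
  apply: is_derive_eq; rewrite scaler0 add0r subr0 /GRing.scale/= mulr1.
  by field.
by apply: is_derive_eq; rewrite mulrC.
Qed.

Lemma continuous_normal_fun m s : s != 0 -> continuous (normal_fun m s).
Proof.
move=> s0 y; apply/differentiable_continuous/derivable1_diffP.
by have [] := @is_derive_normal_fun m s y s0.
Qed.

Lemma integrable_normal_fun m s : s != 0 ->
  mu.-integrable setT (EFin \o normal_fun m s).
Proof.
move=> s0.
rewrite (_ : EFin \o _ = (fun y => (normal_peak s)^-1%:E * (normal_pdf m s y)%:E)%E).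
  by apply: integrableZl => //; exact: integrable_normal_pdf.
apply/funext => y; rewrite /= normal_pdfE// -EFinM mulrA mulVf ?mul1r//.
by rewrite gt_eqF// normal_peak_gt0.
Qed.

(** Half of the Gaussian exponent absorbs the linear factor, by 1 + x <= exp x and completion of a
    square; the other half is a normal function of doubled variance. This gives an integrable bound
    for the derivative in the phase. *)
Lemma le_normal_fun_sqrt2 m s y : s != 0 ->
  `|y - m| * normal_fun m s y <= `|s| * normal_fun m (Num.sqrt 2 * s) y.
Proof.
move=> s0; rewrite /normal_fun.
have -> : (Num.sqrt 2 * s) ^+ 2 *+ 2 = s ^+ 2 * 4.
  by rewrite exprMn sqr_sqrtr//; ring.
set u := y - m.
have -> : - u ^+ 2 / (s ^+ 2 *+ 2) = - u ^+ 2 / (s ^+ 2 * 4) - u ^+ 2 / (s ^+ 2 * 4).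
  by field.
rewrite expRD mulrCA [leRHS]mulrC ler_wpM2l ?expR_ge0// expRN.
rewrite ler_pdivrMr ?expR_gt0// (le_trans _ (ler_wpM2l (normr_ge0 s) (expR_ge1Dx _)))//.
have n0 : 0 < `|s| by rewrite normr_gt0.
rewrite -[u ^+ 2]real_normK ?num_real// -[s ^+ 2]real_normK ?num_real//.
rewrite -subr_ge0 (_ : _ - _ = `|s| * (`|u| / (2 * `|s|) - 1) ^+ 2).
  by rewrite mulr_ge0// sqr_ge0.
by field; rewrite gt_eqF.
Qed.

(** As a function F of t, the integral satisfies F'(t) = - t s^2 F(t), by differentiation under the
    integral and integration by parts. Hence F(t) exp(t^2 s^2 / 2) is constant. *)
Lemma integral_normal_fun_phase m s th t : s != 0 ->
  \int[mu]_y (cos (th + t * (y - m)) * normal_fun m s y) =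
  cos th * expR (- (t ^+ 2 * s ^+ 2 / 2)) * \int[mu]_y normal_fun m s y.
Proof.
move=> s0.
pose ph t y := th + t * (y - m).
have mph u : measurable_fun setT (ph u).
  apply: measurable_funD => //; apply: measurable_funM => //.
  exact: measurable_funB.
pose f u y := cos (ph u y) * normal_fun m s y.
pose g u y := (y - m) * sin (ph u y) * normal_fun m s y.
have intn := integrable_normal_fun m s0.
have intG : mu.-integrable setT
    (EFin \o (fun y => `|s| * normal_fun m (Num.sqrt 2 * s) y)).
  rewrite (_ : _ \o _ = (fun y => `|s|%:E * (normal_fun m (Num.sqrt 2 * s) y)%:E)%E)//.
  apply: integrableZl => //; apply: integrable_normal_fun.
  by rewrite mulf_neq0// gt_eqF// sqrtr_gt0.
have intf u : mu.-integrable setT (EFin \o f u).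
  apply: (le_integrable measurableT _ _ intn).
    apply/measurable_EFinP; apply: measurable_funM; last exact: measurable_normal_fun.
    by apply: measurableT_comp (mph u); apply: continuous_measurable_fun; exact: continuous_cos.
  move=> y _ /=; rewrite lee_fin normrM ler_piMl//.
  by rewrite ler_norml cos_geN1 cos_le1.
have g_ub u y : `|g u y| <= `|s| * normal_fun m (Num.sqrt 2 * s) y.
  rewrite (le_trans _ (le_normal_fun_sqrt2 m y s0))// /g !normrM.
  rewrite [`|normal_fun _ _ _|]ger0_norm ?normal_fun_ge0// ler_wpM2r ?normal_fun_ge0//.
  by rewrite ler_piMr// ler_norml sin_geN1 sin_le1.
have intg u : mu.-integrable setT (EFin \o g u).
  apply: (le_integrable measurableT _ _ intG).
    apply/measurable_EFinP; apply: measurable_funM; last exact: measurable_normal_fun.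
    apply: measurable_funM; first exact: measurable_funB.
    by apply: measurableT_comp (mph u); apply: continuous_measurable_fun; exact: continuous_sin.
  move=> y _ /=; rewrite lee_fin (le_trans (g_ub u y))//.
  exact: ler_norm.
have derf u y : is_derive u (1 : R) (f^~ y) (- g u y).
  rewrite /f /ph /g.
  have h : is_derive u (1 : R) (fun u0 => cos (th + u0 * (y - m)))
      (- (y - m) * sin (th + u * (y - m))).
    by apply: is_derive_eq; rewrite /GRing.scale/=; ring.
  apply: (@is_derive_eq _ _ _ ((fun u0 => cos (th + u0 * (y - m))) * cst (normal_fun m s y))).
  by rewrite /ph /GRing.scale/=; ring.
(* Integration by parts: the y-derivative of sin(ph u y) times the normal function has integral
   zero. *)
have ibp u : u * \int[mu]_y f u y = (s ^+ 2)^-1 * \int[mu]_y g u y.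
  have dsin y : is_derive y (1 : R) (fun y => sin (ph u y) * normal_fun m s y)
      (u * f u y - (s ^+ 2)^-1 * g u y).
    have h : is_derive y (1 : R) (fun x : R => sin (th + u * (x - m))) (u * cos (th + u * (y - m))).
      by apply: is_derive_eq; rewrite /GRing.scale/=; ring.
    have h2 := @is_derive_normal_fun m s y s0.
    apply: (@is_derive_eq _ _ _ ((fun x : R => sin (th + u * (x - m))) * normal_fun m s)).
    by rewrite /f /g /ph /GRing.scale/=; field.
  (* Both boundary terms at once, with e = 1 and e = -1. By [le_normal_fun_sqrt2] they are at most
     |s| / (n - |m|). *)
  have cvg0 (e : R) : `|e| = 1 ->
      sin (ph u (e * n%:R)) * normal_fun m s (e * n%:R) @[n --> \oo] --> 0.
    move=> e1; apply/(@cvgr0Pnorm_le _ R^o) => eps eps0; near=> n.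
    have nm : `|m| + `|s| / eps < n%:R by near: n; exact: nbhs_infty_gtr.
    rewrite normrM (@le_trans _ _ (normal_fun m s (e * n%:R)))//.
      rewrite [`|normal_fun _ _ _|]ger0_norm ?normal_fun_ge0//.
      by rewrite ler_piMl ?normal_fun_ge0// ler_norml sin_geN1 sin_le1.
    have := le_normal_fun_sqrt2 m (e * n%:R) s0.
    have h1 : normal_fun m (Num.sqrt 2 * s) (e * n%:R) <= 1.
      rewrite -expR0 ler_expR mulNr oppr_le0 mulr_ge0 ?sqr_ge0// invr_ge0.
      by rewrite mulrn_wge0// sqr_ge0.
    have h2 : n%:R - `|m| <= `|e * n%:R - m|.
      rewrite (le_trans _ (lerB_normD _ _))//?normrN.
      by rewrite normrM e1 mul1r normr_nat.
    move=> /(fun h => le_trans h (ler_wpM2l (normr_ge0 s) h1)); rewrite mulr1.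
    move=> /(le_trans (ler_wpM2r (normal_fun_ge0 _ _ _) h2)) h3.
    have h4 : `|s| / eps < n%:R - `|m| by rewrite ltrBrDl.
    have h5 : 0 < n%:R - `|m| by rewrite (le_lt_trans _ h4)// divr_ge0// ltW.
    rewrite -(ler_pM2l h5) (le_trans h3)//.
    by move: h4; rewrite ltr_pdivrMr// => /ltW.
  have intI : mu.-integrable setT (fun y => (u * f u y - (s ^+ 2)^-1 * g u y)%:E).
    under eq_fun do rewrite EFinB EFinM (EFinM (s ^+ 2)^-1).
    by apply: integrableB => //; apply: integrableZl => //; [exact: intf|exact: intg].
  have := integral_deriveT_eq0 dsin _ intI.
  have h : continuous (fun y => u * f u y - (s ^+ 2)^-1 * g u y).
    have cn := @continuous_normal_fun m s s0.
    have cph : continuous (ph u).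
      move=> y; apply: cvgD; first exact: cvg_cst.
      apply: cvgMr; apply: cvgB; first exact: cvg_id.
      exact: cvg_cst.
    move=> y; apply: cvgB; apply: cvgMr; apply: cvgM.
    - by apply: (cvg_comp _ _ (cph y)); exact: continuous_cos.
    - exact: cn.
    - apply: cvgM; first by apply: cvgB; [exact: cvg_id|exact: cvg_cst].
      by apply: (cvg_comp _ _ (cph y)); exact: continuous_sin.
    - exact: cn.
  move=> /(_ h).
  have c1 := cvg0 1 (normr1 _); have c2 := cvg0 (-1) (normrN1 _).
  under [X in X @ \oo --> _ -> _]eq_fun do rewrite -[X in ph u X]mul1r -[X in normal_fun m s X]mul1r.
  move=> /(_ c1).
  under [X in X @ \oo --> _ -> _]eq_fun do rewrite -mulN1r.
  move=> /(_ c2) h0.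
  have : \int[mu]_y (u * f u y - (s ^+ 2)^-1 * g u y) = 0 by rewrite /Rintegral h0.
  rewrite RintegralB//; last 2 first.
  - by rewrite (_ : _ \o _ = (fun y => u%:E * (f u y)%:E)%E)//; apply: integrableZl => //; exact: intf.
  - by rewrite (_ : _ \o _ = (fun y => (s ^+ 2)^-1%:E * (g u y)%:E)%E)//; apply: integrableZl => //; exact: intg.
  rewrite !RintegralZl//.
  by move=> /eqP; rewrite subr_eq0 => /eqP.
pose F u := \int[mu]_y f u y.
have dF u : is_derive u (1 : R) F (- (u * s ^+ 2 * F u)).
  have uI : `]u - 1, u + 1[%classic u by rewrite /= in_itv/=; apply/andP; split; lra.
  have dub v y : `|('d1 f) v y| <= `|s| * normal_fun m (Num.sqrt 2 * s) y.
    by rewrite partial1of2E (@derive_val _ _ _ _ _ _ _ (derf v y)) normrN.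
  apply: DeriveDef.
    apply: (@derivable_under_integral _ _ _ mu f setT measurableT u (u - 1) (u + 1) uI _ _
      (fun y => `|s| * normal_fun m (Num.sqrt 2 * s) y)) => //.
    by move=> y; rewrite mulr_ge0// normal_fun_ge0.
  rewrite -derive1E.
  rewrite (@differentiation_under_integral _ _ _ mu f setT measurableT u (u - 1) (u + 1) uI _ _
      (fun y => `|s| * normal_fun m (Num.sqrt 2 * s) y))//; last first.
    by move=> y; rewrite mulr_ge0// normal_fun_ge0.
  rewrite (_ : (fun y => _) = (fun y => -1 * g u y)).
    rewrite RintegralZl//.
    rewrite -[u * s ^+ 2 * _]mulrA (mulrC (s ^+ 2)) mulrA ibp mulN1r.
    by congr (- _); field.
  by apply/funext => y; rewrite partial1of2E (@derive_val _ _ _ _ _ _ _ (derf u y)) mulN1r.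
(* Integrating factor of the equation [dF]. *)
pose K u := F u * expR (u ^+ 2 * (s ^+ 2 / 2)).
have dK u : is_derive u (1 : R) K 0.
  have h : is_derive u (1 : R) (fun v : R => expR (v ^+ 2 * (s ^+ 2 / 2)))
      (u * s ^+ 2 * expR (u ^+ 2 * (s ^+ 2 / 2))).
    by apply: is_derive_eq; rewrite /GRing.scale/=; field.
  have h2 := dF u.
  apply: (@is_derive_eq _ _ _ (F * (fun v : R => expR (v ^+ 2 * (s ^+ 2 / 2))))).
  by rewrite /GRing.scale/=; ring.
have := is_derive_0_is_cst t 0 dK.
rewrite /K expr0n/= mul0r expR0 mulr1.
have -> : F 0 = cos th * \int[mu]_y normal_fun m s y.
  rewrite /F /f /ph; under eq_Rintegral do rewrite mul0r addr0.
  by rewrite RintegralZl.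
move=> h; rewrite -[LHS]/(F t) [RHS]mulrAC -h -[RHS]mulrA -expRD.
by rewrite [X in expR X](_ : _ = 0) ?expR0 ?mulr1//; field.
Unshelve. all: end_near.
Qed.

Lemma integral_normal_phase m s th t : s != 0 ->
  (\int[mu]_y (cos (th + t * y) * normal_pdf m s y)%:E =
   (cos (th + t * m) * expR (- (t ^+ 2 * s ^+ 2 / 2)))%:E)%E.
Proof.
move=> s0.
have intp : mu.-integrable setT (fun y => (cos (th + t * y) * normal_pdf m s y)%:E).
  apply: (le_integrable measurableT _ _ (integrable_normal_pdf m s)).
    apply/measurable_EFinP; apply: measurable_funM; last exact: measurable_normal_pdf.
    apply: (measurableT_comp (f := cos)); last first.
      by apply: measurable_funD => //; exact: measurable_funM.
    by apply: continuous_measurable_fun; exact: continuous_cos.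
  move=> y _ /=; rewrite lee_fin normrM ler_piMl//.
  by rewrite ler_norml cos_geN1 cos_le1.
rewrite -[LHS]fineK; last exact: integrable_fin_num.
congr EFin; rewrite -/(Rintegral mu setT _).
have pE y : normal_pdf m s y = normal_peak s * normal_fun m s y by rewrite normal_pdfE.
have -> : \int[mu]_y (cos (th + t * y) * normal_pdf m s y) =
    \int[mu]_y (normal_peak s *
      (cos ((th + t * m) + t * (y - m)) * normal_fun m s y)).
  apply: eq_Rintegral => y _; rewrite pE mulrCA.
  by rewrite (_ : th + t * m + t * (y - m) = th + t * y)//; ring.
have I1 : normal_peak s * \int[mu]_y normal_fun m s y = 1.
  rewrite -RintegralZl//; last exact: integrable_normal_fun.
  under eq_Rintegral do rewrite -pE.
  by rewrite /Rintegral integral_normal_pdf.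
rewrite RintegralZl//; last first.
  apply: (le_integrable measurableT _ _ (integrable_normal_fun m s0)).
    apply/measurable_EFinP; apply: measurable_funM; last exact: measurable_normal_fun.
    apply: (measurableT_comp (f := cos)); last first.
      apply: measurable_funD => //; apply: measurable_funM => //.
      exact: measurable_funB.
    by apply: continuous_measurable_fun; exact: continuous_cos.
  move=> y _ /=; rewrite lee_fin normrM ler_piMl//.
  by rewrite ler_norml cos_geN1 cos_le1.
by rewrite integral_normal_fun_phase// mulrCA I1 mulr1.
Qed.

End NormalCharacteristic.

(** * Integrals of bounded functions against finite measures and normal laws *)

Section BoundedIntegrals.
Context {R : realType}.
Implicit Types m s : R.
Notation mu := (@lebesgue_measure R).

Lemma bounded_integrable d (T : measurableType d)
    (m : {finite_measure set T -> \bar R}) (F : T -> R) :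
  bounded_measurable F -> m.-integrable setT (EFin \o F).
Proof.
move=> [mF [M FM]].
apply: (le_integrable measurableT _ _ (finite_measure_integrable_cst m `|M| measurableT)).
  exact/measurable_EFinP.
by move=> x _ /=; rewrite lee_fin normr_id (le_trans (FM x))// ler_norm.
Qed.

Lemma bounded_Fubini d1 d2 (T1 : measurableType d1) (T2 : measurableType d2)
    (m1 : {finite_measure set T1 -> \bar R}) (m2 : {finite_measure set T2 -> \bar R})
    (g : T1 * T2 -> R) : bounded_measurable g ->
  (\int[m1]_x \int[m2]_y (g (x, y))%:E = \int[m2]_y \int[m1]_x (g (x, y))%:E)%E.
Proof.
move=> [mg [M gM]].
have mgE : measurable_fun setT (EFin \o g) by exact/measurable_EFinP.
apply: (@Fubini _ _ _ _ _ m1 m2 (EFin \o g)); apply/integrable12ltyP => //.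
apply: (@le_lt_trans _ _ (\int[m1]_x \int[m2]_y (cst `|M|%:E y))%E).
  apply: ge0_le_integral => //.
  - by move=> x _; apply: integral_ge0.
  - by apply: (@measurable_fun_fubini_tonelli_F _ _ _ _ _ m2 (fun z => `|(EFin \o g) z|%E)) => //; exact: measurableT_comp.
  move=> x _; apply: ge0_le_integral => //.
  - apply: measurableT_comp => //; exact: (measurableT_comp mgE (measurable_pair1 x)).
  - by move=> y _ /=; rewrite lee_fin (le_trans (gM _))// ler_norm.
under eq_integral do rewrite integral_cst//.
rewrite integral_cst//= lte_mul_pinfty// ?mule_ge0//.
  by rewrite fin_numM// fin_num_measure.
by rewrite -ge0_fin_numE// fin_num_measure.
Qed.

Lemma integral_indicM d (T : measurableType d) (m : {measure set T -> \bar R})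
    (w : T -> R) (C : set T) : measurable C ->
  (\int[m]_x (w x * \1_C x)%:E = \int[m]_(x in C) (w x)%:E)%E.
Proof.
move=> mC; rewrite [RHS]integral_mkcond; apply: eq_integral => x _.
by rewrite patchE indicE; case: (x \in C); rewrite ?mulr1 ?mulr0.
Qed.

(** Passes from sets to bounded functions for measures known by their values on sets: normal laws,
    Dirac masses and restrictions. *)
Lemma weighted_eq_density d1 d (T1 : measurableType d1) (T : measurableType d)
    (m1 : {finite_measure set T1 -> \bar R}) (m : {measure set T -> \bar R})
    (phi : T1 -> T) (w : T -> R) :
  measurable_fun setT phi -> m.-integrable setT (EFin \o w) ->
  (forall C, measurable C -> m1 (phi @^-1` C) = \int[m]_(x in C) (w x)%:E)%E ->
  forall F, bounded_measurable F ->
    (\int[m1]_x (F (phi x))%:E = \int[m]_x (w x * F x)%:E)%E.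
Proof.
move=> mphi iw m1E F bF.
have i1 : m1.-integrable setT (EFin \o cst 1).
  by apply: bounded_integrable; exact: bounded_measurable_cst.
have h C : measurable C -> weighted_eq m1 m phi id (cst 1) w \1_C.
  move=> mC; rewrite /weighted_eq.
  have mpC : measurable (phi @^-1` C) by rewrite -[X in measurable X]setTI; exact: mphi.
  under eq_integral do rewrite mul1r -[\1_C (phi _)]/(\1_(phi @^-1` C) _).
  by rewrite integral_indicM// -m1E// integral_indic// setIT.
have mid : measurable_fun setT (id : T -> T) by exact: measurable_id.
suff : weighted_eq m1 m phi id (cst 1) w F.
  by rewrite /weighted_eq; under eq_integral do rewrite mul1r.
apply: (weighted_eq_bounded mphi mid i1 iw (D := @measurable _ T)) => //.
- by rewrite sigma_algebra_id//; exact: sigma_algebra_measurable.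
- by move=> A B; exact: measurableI.
- rewrite (_ : cst 1 = \1_[set: T])//; first exact: h.
  by apply/funext => x; rewrite indicT.
Qed.

Lemma integral_normal_prob m s (F : R -> R) : s != 0 -> bounded_measurable F ->
  (\int[normal_prob m s]_x (F x)%:E = \int[mu]_x (normal_pdf m s x * F x)%:E)%E.
Proof.
move=> s0 bF.
by apply: (@weighted_eq_density _ _ _ _ (normal_prob m s) mu id) => //;
  exact: integrable_normal_pdf.
Qed.

Lemma bounded_measurable_cos_phase (th t : R) :
  bounded_measurable (fun x : R => cos (th + t * x)).
Proof.
split.
  apply: (measurableT_comp (f := cos)).
    by apply: continuous_measurable_fun; exact: continuous_cos.
  by apply: measurable_funD => //; exact: measurable_funM.
by exists 1 => x; rewrite ler_norml cos_geN1 cos_le1.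
Qed.

Lemma integral_normal_prob_phase m s th t : s != 0 ->
  (\int[normal_prob m s]_x (cos (th + t * x))%:E =
   (cos (th + t * m) * expR (- (t ^+ 2 * s ^+ 2 / 2)))%:E)%E.
Proof.
move=> s0; rewrite integral_normal_prob//; last exact: bounded_measurable_cos_phase.
by under eq_integral do rewrite mulrC; rewrite integral_normal_phase.
Qed.

(* Completing the square. *)
Lemma integral_std_normal_expR (g b : R) : 0 <= g ->
  (\int[mu]_x (normal_pdf 0 1 x * expR (- (g * x ^+ 2 / 2 + b * x)))%:E =
   ((Num.sqrt (1 + g))^-1 * expR (b ^+ 2 / (2 * (1 + g))))%:E)%E.
Proof.
move=> g0; set q := Num.sqrt (1 + g).
have q0 : 0 < q by rewrite sqrtr_gt0; lra.
have q2 : q ^+ 2 = 1 + g by rewrite sqr_sqrtr//; lra.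
have qN0 : q^-1 != 0 by rewrite invr_eq0 gt_eqF.
rewrite (_ : (fun x => _) = (fun x =>
    (q^-1 * expR (b ^+ 2 / (2 * (1 + g))))%:E *
    (normal_pdf (- b / (1 + g)) q^-1 x)%:E)%E).
  by rewrite integralZl//; [rewrite integral_normal_pdf mule1|exact: integrable_normal_pdf].
apply/funext => x; rewrite -EFinM; congr EFin.
have pE m s y : s != 0 -> normal_pdf m s y = normal_peak s * normal_fun m s y.
  by move=> s0; rewrite normal_pdfE.
rewrite !pE ?oner_eq0// /normal_fun.
have -> : normal_peak q^-1 = q * normal_peak 1.
  rewrite /normal_peak expr1n mul1r.
  have -> : q^-1 ^+ 2 * pi *+ 2 = q^-1 ^+ 2 * (pi *+ 2) :> R by ring.
  rewrite sqrtrM ?sqr_ge0// sqrtr_sqr gtr0_norm ?invr_gt0//. by rewrite invfM invrK.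
have g1 : 1 + g != 0 by apply/eqP => h; move: g0; lra.
have h : expR (- (x - 0) ^+ 2 / (1 ^+ 2 *+ 2)) * expR (- (g * x ^+ 2 / 2 + b * x)) =
    expR (b ^+ 2 / (2 * (1 + g))) *
    expR (- (x - - b / (1 + g)) ^+ 2 / (q^-1 ^+ 2 *+ 2)) :> R.
  by rewrite -!expRD exprVn q2 subr0 expr1n; congr expR; field.
transitivity (normal_peak 1 *
    (expR (- (x - 0) ^+ 2 / (1 ^+ 2 *+ 2)) * expR (- (g * x ^+ 2 / 2 + b * x)))).
  exact: (esym (mulrA _ _ _)).
by rewrite h; field; rewrite gt_eqF.
Qed.

End BoundedIntegrals.

(** * Tilting a Gaussian field by exponentials of its squares *)

Section DifferenceQuotients.
Context {R : realType}.

Lemma cvg_difference_quotient (f : R -> R) (l : R) (h : nat -> R) :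
  is_derive (0 : R) (1 : R) f l -> (forall n, h n != 0) ->
  h n @[n --> \oo] --> 0 -> (f (h n) - f 0) / h n @[n --> \oo] --> l.
Proof.
move=> df h0 hcvg.
have [dd dE] := df.
have : e^-1 *: ((f \o shift 0) (e *: (1 : R)) - f 0) @[e --> (0 : R)^'] --> l.
  by rewrite -dE; exact: dd.
move/cvgr_dnbhsP => /(_ h (conj h0 hcvg)).
apply: cvg_trans; apply: near_eq_cvg; apply: nearW => n /=.
by rewrite addr0 /GRing.scale/= mulr1 mulrC.
Qed.

Lemma normr_sin_le (x : R) : `|sin x| <= `|x|.
Proof.
wlog x0 : x / 0 <= x.
  move=> h; have [|/ltW x0] := leP 0 x; first exact: h.
  by rewrite -normrN -sinN -[leRHS]normrN; apply: h; rewrite oppr_ge0.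
have [c _] := @MVT_segment R sin cos 0 x x0 (fun y _ => is_derive_sin y)
  (continuous_subspaceT (@continuous_sin R)).
rewrite sin0 !subr0 => ->; rewrite normrM ler_piMl//.
exact: cos_max.
Qed.

(** A bounded substitute for x, dominated by |x|: it lets moments be computed from integrals of
    sines and cosines. *)
Lemma cvg_harmonic_sin (x : R) : n.+1%:R * sin (x / n.+1%:R) @[n --> \oo] --> x.
Proof.
have d : is_derive (0 : R) (1 : R) (fun h : R => sin (h * x)) x.
  by apply: is_derive_eq; rewrite /GRing.scale/= mul0r cos0; ring.
have h0 (n : nat) : @harmonic R n != 0 by rewrite gt_eqF// harmonic_gt0.
have h := cvg_difference_quotient d h0 (@cvg_harmonic R).
rewrite (_ : (fun n => _) = (fun n =>
  (sin (@harmonic R n * x) - sin (0 * x)) / @harmonic R n)); first exact: h.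
apply/funext => n.
by rewrite mul0r sin0 subr0 /harmonic/= invrK mulrC (mulrC x).
Qed.

Lemma cvg_harmonic_expR (x : R) :
  n.+1%:R ^+ 2 * (1 - expR (- (x / n.+1%:R ^+ 2))) @[n --> \oo] --> x.
Proof.
have d : is_derive (0 : R) (1 : R) (fun h : R => expR (- (h * x))) (- x).
  by apply: is_derive_eq; rewrite /GRing.scale/= mul0r oppr0 expR0; ring.
pose h (n : nat) : R := harmonic n * harmonic n.
have h0 n : h n != 0 by rewrite mulf_neq0// gt_eqF// harmonic_gt0.
have hc : h n @[n --> \oo] --> 0.
  by rewrite -[X in _ --> X](mulr0 0); apply: cvgM; exact: cvg_harmonic.
have hN := cvgN (cvg_difference_quotient d h0 hc); rewrite opprK in hN.
rewrite (_ : (fun n => _) = (fun n =>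
  - ((expR (- (h n * x)) - expR (- (0 * x))) / h n))); first exact: hN.
apply/funext => n /=.
rewrite mul0r oppr0 expR0 -[RHS]mulNr opprB /h /harmonic /= -invfM invrK mulrC.
by rewrite -expr2 (mulrC x).
Qed.

End DifferenceQuotients.

Section TiltedGaussian.
Context {R : realType} {X : countType} {d : measure_display}
  {T : measurableType d}.
Variables (P : probability T R) (Z : X -> T -> R).
Hypothesis mZ : forall u, measurable_fun setT (Z u).
Implicit Types (L : seq (X * R)) (Sg : X -> X -> R) (e : T -> R).

Definition lincomb L (v : T) : R := \sum_(p <- L) p.2 * Z p.1 v.

(** The covariance of [lincomb L] with [Z u] when [Sg] is the covariance of the field. *)
Definition covcomb Sg L (u : X) : R := \sum_(p <- L) p.2 * Sg p.1 u.

(** The variance of [lincomb L] when [Sg] is the covariance of the field. *)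
Definition quadcomb Sg L : R := \sum_(q <- L) q.2 * covcomb Sg L q.1.

Lemma quadcomb_cons Sg u (k : R) L : (forall x y, Sg x y = Sg y x) ->
  quadcomb Sg ((u, k) :: L) =
  k ^+ 2 * Sg u u + 2 * k * covcomb Sg L u + quadcomb Sg L.
Proof.
move=> symS; rewrite /quadcomb big_cons /= /covcomb big_cons /=.
rewrite -/(covcomb Sg L u) mulrDr -addrA -[RHS]addrA.
congr (_ + _); first by ring.
under eq_bigr do rewrite big_cons mulrDr.
rewrite big_split /= addrA; congr (_ + _).
have -> : \sum_(q <- L) q.2 * (k * Sg u q.1) = k * covcomb Sg L u.
  by rewrite /covcomb mulr_sumr; apply: eq_bigr => q _; rewrite mulrCA symS.
ring.
Qed.

Lemma quadcomb_scale Sg (t : R) L :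
  quadcomb Sg [seq (p.1, t * p.2) | p <- L] = t ^+ 2 * quadcomb Sg L.
Proof.
rewrite /quadcomb big_map mulr_sumr; apply: eq_bigr => q _ /=.
rewrite /covcomb big_map /= mulr_sumr mulr_sumr mulr_sumr.
by apply: eq_bigr => p _; ring.
Qed.

Lemma lincomb_scale (t : R) L v :
  lincomb [seq (p.1, t * p.2) | p <- L] v = t * lincomb L v.
Proof.
by rewrite /lincomb big_map mulr_sumr; apply: eq_bigr => q _ /=; rewrite mulrA.
Qed.

Lemma measurable_lincomb L : measurable_fun setT (lincomb L).
Proof. by apply: measurable_sum => p; exact: measurable_funM. Qed.

(* Under the finite measure of density [e], the field is a centered Gaussian
   field of covariance [Sg], up to the total mass [c]. *)
Definition tilted e (c : R) Sg : Prop :=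
  [/\ measurable_fun setT e, forall v, 0 < e v <= 1, 0 < c,
      forall x y, Sg x y = Sg y x &
      forall L th, (\int[P]_v (cos (th + lincomb L v) * e v)%:E =
                    (cos th * c * expR (- (quadcomb Sg L / 2)))%:E)%E].

Hypothesis Z_sqr_integrable :
  forall u, P.-integrable setT (fun v => (Z u v ^+ 2)%:E).

Lemma lincomb_sqr_integrable L : P.-integrable setT (fun v => (lincomb L v ^+ 2)%:E).
Proof.
elim: L => [|p L IH].
  rewrite (_ : (fun _ => _) = cst 0%E); first exact: integrable0.
  by apply/funext => v; rewrite /lincomb big_nil expr0n.
apply: (le_integrable measurableT _ _ (g := fun v => (2 * p.2 ^+ 2)%:E * (Z p.1 v ^+ 2)%:E +
   2%:E * (lincomb L v ^+ 2)%:E)%E).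
- apply/measurable_EFinP; apply: measurable_funX; exact: measurable_lincomb.
- move=> v _; rewrite -!EFinM -EFinD /= lee_fin [leLHS]ger0_norm ?sqr_ge0//.
  rewrite (le_trans _ (ler_norm _))//.
  rewrite /lincomb big_cons -/(lincomb L v).
  set a := p.2; set z := Z p.1 v; set b := lincomb L v.
  have : 0 <= (a * z - b) ^+ 2 by rewrite sqr_ge0.
  nra.
- by apply: integrableD => //; apply: integrableZl.
Qed.

(** With Y = [lincomb L] and N = n + 1, the square of 2 N sin(Y / 2N) equals 2 N^2 (1 - cos(Y / N)).
    It tends to Y^2, is dominated by Y^2, and its integral is given by the phase identity of
    [tilted]. *)
Lemma tilted_lincomb_sqr e c Sg L : tilted e c Sg ->
  (\int[P]_v (lincomb L v ^+ 2 * e v)%:E = (c * quadcomb Sg L)%:E)%E.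
Proof.
move=> [me e01 c0 symS tilt].
have N0 (n : nat) : n.+1%:R != 0 :> R by rewrite pnatr_eq0.
pose f n v := (2 * n.+1%:R * sin (lincomb L v / 2 / n.+1%:R)) ^+ 2 * e v.
have fE n v : f n v = 2 * n.+1%:R ^+ 2 *
    (e v - cos (0 + lincomb [seq (p.1, n.+1%:R^-1 * p.2) | p <- L] v) * e v).
  rewrite /f add0r lincomb_scale.
  have -> : n.+1%:R^-1 * lincomb L v = lincomb L v / 2 / n.+1%:R *+ 2.
    by move: (n.+1%:R : R) (N0 n) => N N0'; rewrite mulr2n; field.
  rewrite cos_mulr2n cos2sin2; ring.
have e_le v : e v <= 1 by case/andP: (e01 v).
have e_ge v : 0 <= e v by case/andP: (e01 v) => /ltW.
have ie : P.-integrable setT (EFin \o e).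
  by apply: bounded_integrable; split => //; exists 1 => v; rewrite ger0_norm.
have ice n : P.-integrable setT (fun v =>
    (cos (0 + lincomb [seq (p.1, n.+1%:R^-1 * p.2) | p <- L] v) * e v)%:E).
  apply: bounded_integrable; split.
    apply: measurable_funM => //; apply: (measurableT_comp (f := cos)).
      by apply: continuous_measurable_fun; exact: continuous_cos.
    by apply: measurable_funD => //; exact: measurable_lincomb.
  by exists 1 => v; rewrite normrM mulr_ile1// ?cos_max// ger0_norm.
have If n : (\int[P]_v (f n v)%:E = (2 * c * (n.+1%:R ^+ 2 *
    (1 - expR (- (quadcomb Sg L / 2 / n.+1%:R ^+ 2)))))%:E)%E.
  under eq_integral do rewrite fE EFinM EFinB.
  rewrite integralZl//; last exact: integrableB.
  rewrite integralB// tilt.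
  have -> : (\int[P]_v (e v)%:E = c%:E)%E.
    have := tilt [::] 0; rewrite cos0 mul1r /quadcomb big_nil mul0r oppr0 expR0 mulr1 => <-.
    by apply: eq_integral => v _; rewrite /lincomb big_nil addr0 cos0 mul1r.
  rewrite -EFinB -EFinM cos0 mul1r quadcomb_scale; congr EFin.
  rewrite (_ : n.+1%:R^-1 ^+ 2 * quadcomb Sg L / 2 = quadcomb Sg L / 2 / n.+1%:R ^+ 2).
    by ring.
  by move: (n.+1%:R : R) (N0 n) => N N0'; field.
have [] // := @dominated_convergence _ _ _ P setT measurableT
    (fun n v => (f n v)%:E) (fun v => (lincomb L v ^+ 2 * e v)%:E)
    (fun v => (lincomb L v ^+ 2)%:E).
- move=> n; apply/measurable_EFinP; apply: measurable_funM => //.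
  apply: measurable_funX; apply: measurable_funM => //.
  apply: (measurableT_comp (f := sin)).
    by apply: continuous_measurable_fun; exact: continuous_sin.
  by do 2 apply: measurable_funM => //; exact: measurable_lincomb.
- apply/measurable_EFinP; apply: measurable_funM => //.
  by apply: measurable_funX; exact: measurable_lincomb.
- apply: aeW => v _; apply: cvg_EFin; first exact: nearW.
  apply: cvgMl; rewrite expr2 /f; under eq_fun do rewrite expr2.
  suff h : 2 * n.+1%:R * sin (lincomb L v / 2 / n.+1%:R) @[n --> \oo] --> lincomb L v.
    by apply: cvgM.
  rewrite -[X in _ --> X](_ : 2 * (lincomb L v / 2) = _); last by field.
  by under eq_fun do rewrite -mulrA; apply: cvgMr; exact: cvg_harmonic_sin.
- exact: lincomb_sqr_integrable.
- apply: aeW => v n _; rewrite /= lee_fin /f normrM [`|e v|]ger0_norm//.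
  rewrite ger0_norm ?sqr_ge0// (le_trans (ler_wpM2l (sqr_ge0 _) (e_le v)))// mulr1.
  rewrite -ler_sqrt ?sqr_ge0// !sqrtr_sqr normrM.
  rewrite (le_trans (ler_wpM2l (normr_ge0 _) (normr_sin_le _)))// -normrM.
  rewrite (_ : 2 * n.+1%:R * (lincomb L v / 2 / n.+1%:R) = lincomb L v)//.
  by move: (n.+1%:R : R) (N0 n) => N N0'; field.
move=> _ _ h.
rewrite -(cvg_lim _ h)//; apply/cvg_lim => //.
rewrite (_ : [sequence _]_n = (fun n => (2 * c * (n.+1%:R ^+ 2 *
    (1 - expR (- (quadcomb Sg L / 2 / n.+1%:R ^+ 2)))))%:E)).
  apply: cvg_EFin; first exact: nearW.
  rewrite -[X in _ --> X](_ : 2 * c * (quadcomb Sg L / 2) = _); last by field.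
  by apply: cvgMr; exact: cvg_harmonic_expR.
by apply/funext => n; rewrite /= If.
Qed.

(** Polarization of the second moments of Z x + Z y and Z x - Z y. *)
Lemma tilted_covariance e c Sg x y : tilted e c Sg ->
  (\int[P]_v (Z x v * Z y v * e v)%:E = (c * Sg x y)%:E)%E.
Proof.
move=> te; have [me e01 c0 symS tilt] := te.
have e_le v : e v <= 1 by case/andP: (e01 v).
have e_ge v : 0 <= e v by case/andP: (e01 v) => /ltW.
have ile L : P.-integrable setT (fun v => (lincomb L v ^+ 2 * e v)%:E).
  apply: (le_integrable measurableT _ _ (lincomb_sqr_integrable L)).
    apply/measurable_EFinP; apply: measurable_funM => //.
    by apply: measurable_funX; exact: measurable_lincomb.
  by move=> v _ /=; rewrite lee_fin normrM ler_piMr// ger0_norm.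
have E (v : T) : Z x v * Z y v * e v =
    1 / 4 * (lincomb [:: (x, 1); (y, 1)] v ^+ 2 * e v -
             lincomb [:: (x, 1); (y, -1)] v ^+ 2 * e v).
  by rewrite /lincomb !big_cons !big_nil /=; field.
under eq_integral do rewrite E EFinM EFinB.
rewrite integralZl//; last exact: integrableB.
rewrite integralB// !(tilted_lincomb_sqr _ te) -EFinB -EFinM; congr EFin.
rewrite /quadcomb /covcomb !big_cons !big_nil /= (symS y x); by field.
Qed.

Lemma tilted_variance_ge0 e c Sg u : tilted e c Sg -> 0 <= Sg u u.
Proof.
move=> te; have [_ e01 c0 _ _] := te.
rewrite -(pmulr_rge0 _ c0) -lee_fin -(tilted_covariance u u te).
apply: integral_ge0 => v _; rewrite lee_fin mulr_ge0// ?sqr_ge0//.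
by case/andP: (e01 v) => /ltW.
Qed.

(** The rank-one term is a product of functions of x and y, so its quadratic form is a square. *)
Lemma quadcomb_rank1 Sg u (k : R) L : (forall x y, Sg x y = Sg y x) ->
  quadcomb (fun x y => Sg x y - k * Sg x u * Sg u y) L =
  quadcomb Sg L - k * covcomb Sg L u ^+ 2.
Proof.
move=> symS; rewrite /quadcomb expr2.
have -> : covcomb Sg L u * covcomb Sg L u =
    \sum_(q <- L) q.2 * Sg q.1 u * covcomb Sg L u by rewrite -mulr_suml.
rewrite mulr_sumr -sumrB; apply: eq_bigr => q _.
have -> : covcomb (fun x y => Sg x y - k * Sg x u * Sg u y) L q.1 =
    covcomb Sg L q.1 - k * covcomb Sg L u * Sg u q.1.
  by rewrite /covcomb mulr_sumr mulr_suml -sumrB; apply: eq_bigr => p _; ring.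
by rewrite (symS u q.1); ring.
Qed.

(* [exp(- k z^2 / 2)] is the average of [cos(sqrt k n z)] over a standard normal
   [n]; averaging over the field first leaves a Gaussian integral over [n]. *)
Lemma tilted_sqr e c Sg u (k : R) : 0 <= k -> tilted e c Sg ->
  tilted (fun v => e v * expR (- (k * (Z u v ^+ 2 / 2))))
    (c / Num.sqrt (1 + k * Sg u u))
    (fun x y => Sg x y - k / (1 + k * Sg u u) * Sg x u * Sg u y).
Proof.
move=> k0 te; have [me e01 c0 symS tilt] := te.
have S0 := tilted_variance_ge0 u te.
have g0 : 0 < 1 + k * Sg u u by rewrite ltr_pwDl// mulr_ge0.
have e_le v : e v <= 1 by case/andP: (e01 v).
have e_ge v : 0 <= e v by case/andP: (e01 v) => /ltW.
split.
- apply: measurable_funM => //; apply: measurableT_comp => //.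
  apply: measurableT_comp => //; apply: measurable_funM => //.
  by apply: measurable_funM => //; exact: measurable_funX.
- move=> v; have /andP[e1 e2] := e01 v; rewrite mulr_gt0 ?expR_gt0//=.
  rewrite mulr_ile1 ?expR_ge0//.
  by rewrite -expR0 ler_expR oppr_le0 mulr_ge0// divr_ge0// sqr_ge0.
- by rewrite divr_gt0// sqrtr_gt0.
- by move=> x y; rewrite symS (symS x u) (symS u y); ring.
move=> L th.
pose q := Num.sqrt k.
have q2 : q ^+ 2 = k by rewrite sqr_sqrtr.
pose N : probability _ R := normal_prob 0 (1 : R).
pose f (z : T * R) := cos (th + lincomb L z.1 + q * Z u z.1 * z.2) * e z.1.
have bf : bounded_measurable f.
  split; last first.
    by exists 1 => z; rewrite normrM mulr_ile1// ?cos_max// ger0_norm.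
  apply: measurable_funM; last exact: measurableT_comp.
  apply: (measurableT_comp (f := cos)).
    by apply: continuous_measurable_fun; exact: continuous_cos.
  apply: measurable_funD.
    apply: measurable_funD => //.
    by apply: (measurableT_comp (f := lincomb L)) => //; exact: measurable_lincomb.
  apply: measurable_funM => //; apply: measurable_funM => //.
  exact: measurableT_comp.
transitivity (\int[P]_v \int[N]_n (f (v, n))%:E)%E.
  apply: eq_integral => v _.
  under eq_integral do rewrite /f /= mulrC EFinM.
  rewrite integralZl//; last first.
    by apply: bounded_integrable; exact: bounded_measurable_cos_phase.
  rewrite integral_normal_prob_phase ?oner_eq0// mulr0 addr0 -EFinM; congr EFin.
  rewrite mulrCA -mulrA; congr (_ * (_ * expR _)).
  by rewrite exprMn q2 expr1n; field.
rewrite bounded_Fubini//.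
pose b := covcomb Sg L u.
pose K := expR (- (quadcomb Sg L / 2)).
(* For fixed n the added phase q n Z u is one more entry of the list, so the hypothesis on [e]
   applies to (u, q n) :: L. The phase is left free: it is [th] for the result and 0 for the bound
   below. *)
have fE (n : R) (th' : R) :
    (\int[P]_v (cos (th' + lincomb L v + q * Z u v * n) * e v)%:E =
     (cos th' * c * K * expR (- (k * Sg u u * n ^+ 2 / 2 + q * b * n)))%:E)%E.
  rewrite -[RHS](_ : (cos th' * c * expR (- (quadcomb Sg ((u, q * n) :: L) / 2)))%:E = _)%E.
    rewrite -tilt; apply: eq_integral => v _.
    by rewrite {2}/lincomb big_cons -/(lincomb L v) /=; congr ((cos _ * _)%:E); ring.
  rewrite quadcomb_cons// -/b /K -[in RHS]mulrA -expRD exprMn q2.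
  by congr ((_ * expR _)%:E); field.
under eq_integral do rewrite fE.
rewrite -[LHS](_ : (\int[N]_n ((cos th * c * K)%:E *
    (expR (- (k * Sg u u * n ^+ 2 / 2 + q * b * n)))%:E) = _)%E)//.
(* If [Sg u u] = 0 the formula does not show that this is bounded. The bound comes from [fE] at
   phase 0: c K times the exponential is the integral of a function that is at most 1. *)
have bE : bounded_measurable (fun n : R => expR (- (k * Sg u u * n ^+ 2 / 2 + q * b * n))).
  split.
    apply: measurableT_comp => //; apply: measurableT_comp => //.
    apply: measurable_funD; last exact: measurable_funM.
    by apply: measurable_funM => //; apply: measurable_funM => //; exact: measurable_funX.
  have cK : 0 < c * K by rewrite mulr_gt0// expR_gt0.
  exists (c * K)^-1 => n; rewrite ger0_norm ?expR_ge0//.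
  rewrite -(ler_pM2l cK) divff ?gt_eqF//.
  have := fE n 0; rewrite cos0 mul1r => h.
  rewrite -lee_fin -h.
  apply: (@le_trans _ _ (\int[P]_v (cst 1%:E v))%E).
    apply: le_integral => //.
    - apply: (@bounded_integrable R _ T P (fun v => cos (0 + lincomb L v + q * Z u v * n) * e v)).
      split; last by exists 1 => v; rewrite normrM mulr_ile1// ?cos_max// ger0_norm.
      apply: measurable_funM => //.
      apply: (measurableT_comp (f := cos)).
        by apply: continuous_measurable_fun; exact: continuous_cos.
      apply: measurable_funD; last by apply: measurable_funM => //; exact: measurable_funM.
      by apply: measurable_funD => //; exact: measurable_lincomb.
    - exact: finite_measure_integrable_cst.
    - move=> v _; rewrite lee_fin (le_trans (ler_norm _))// normrM mulr_ile1//.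
        exact: cos_max.
      by rewrite ger0_norm.
  by rewrite integral_cst//= probability_setT mule1.
rewrite integralZl//; last exact: bounded_integrable.
rewrite /N integral_normal_prob ?oner_eq0// integral_std_normal_expR ?mulr_ge0//.
rewrite -EFinM; congr EFin; rewrite quadcomb_rank1//.
rewrite -/b /K.
have -> : - ((quadcomb Sg L - k / (1 + k * Sg u u) * b ^+ 2) / 2) =
    - (quadcomb Sg L / 2) + (q * b) ^+ 2 / (2 * (1 + k * Sg u u)).
  by rewrite exprMn q2; field; rewrite gt_eqF.
rewrite expRD; ring.
Qed.

End TiltedGaussian.

(** * Characteristic functions of centered Gaussian variables *)

Section CenteredGaussian.
Context {R : realType} {d : measure_display} {T : measurableType d}.
Variable P : probability T R.

Lemma gaussian_law_phase (Y : T -> R) (m s : R) : measurable_fun setT Y ->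
  (forall B, measurable B ->
    P (Y @^-1` B) = if s == 0 then \d_m B else normal_prob m s B) ->
  forall th t, (\int[P]_v (cos (th + t * Y v))%:E =
    (cos (th + t * m) * expR (- (t ^+ 2 * s ^+ 2 / 2)))%:E)%E.
Proof.
move=> mY law th t.
have bF := bounded_measurable_cos_phase th t.
have [s0|s0] := eqVneq s 0.
  rewrite (@weighted_eq_density _ _ _ _ _ P \d_m Y (cst 1) mY _ _ _ bF).
  - rewrite integral_dirac//; first by rewrite diracT mul1e mul1r s0 expr0n/= mulr0 mul0r oppr0 expR0 mulr1.
    by under eq_fun do rewrite mul1r; apply/measurable_EFinP; case: bF.
  - by apply: bounded_integrable; exact: bounded_measurable_cst.
  - move=> C mC; apply: etrans (law C mC) _.
    by rewrite s0 eqxx; apply/esym; apply: etrans (integral_cst _ mC 1) _; rewrite mul1e.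
rewrite -integral_normal_prob_phase//.
rewrite (@weighted_eq_density _ _ _ _ _ P (normal_prob m s) Y (cst 1) mY _ _ _ bF).
- by under eq_integral do rewrite mul1r.
- by apply: bounded_integrable; exact: bounded_measurable_cst.
- move=> C mC; apply: etrans (law C mC) _.
  by rewrite (negbTE s0); apply/esym; apply: etrans (integral_cst _ mC 1) _; rewrite mul1e.
Qed.

(* The mean and the variance are read off from the behaviour of the
   characteristic function at 0. *)
Lemma gaussian_law_centered_phase (Y : T -> R) (q : R) : measurable_fun setT Y ->
  is_gaussian_law (fun B => P (Y @^-1` B)) ->
  P.-integrable setT (fun v => (Y v ^+ 2)%:E) ->
  (\int[P]_v (Y v)%:E = 0)%E -> (\int[P]_v (Y v ^+ 2)%:E = q%:E)%E ->
  forall th, (\int[P]_v (cos (th + Y v))%:E = (cos th * expR (- (q / 2)))%:E)%E.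
Proof.
move=> mY [m [s law]] iY2 EY EY2.
have ph := gaussian_law_phase mY law.
have iY : P.-integrable setT (EFin \o Y).
  apply: (le_integrable measurableT _ _ (g := fun v => 1%:E + (Y v ^+ 2)%:E)%E).
  - exact/measurable_EFinP.
  - move=> v _; rewrite -EFinD /= lee_fin [leRHS]ger0_norm ?addr_ge0 ?sqr_ge0//.
    by rewrite -[Y v ^+ 2]real_normK ?num_real//; have := sqr_ge0 (`|Y v| - 1); nra.
  - by apply: integrableD => //; exact: finite_measure_integrable_cst.
(* The mean of Y is the limit of the means of N sin(Y / N). The characteristic function evaluates
   these, and their limit is m. *)
have m0 : m = 0.
  have sinE (x : R) : sin x = cos (- (pi / 2) + x).
    by rewrite addrC cosB cos_pihalf sin_pihalf mulr0 mulr1 add0r.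
  have Isin n : (\int[P]_v (n.+1%:R * sin (Y v / n.+1%:R))%:E =
      (n.+1%:R * sin (m / n.+1%:R) *
       expR (- (s ^+ 2 / 2 / n.+1%:R ^+ 2)))%:E)%E.
    under eq_integral do rewrite sinE EFinM [Y _ / _]mulrC.
    rewrite integralZl//; last first.
      apply: bounded_integrable; split.
        apply: (measurableT_comp (f := cos)); last first.
          by apply: measurable_funD => //; exact: measurable_funM.
        by apply: continuous_measurable_fun; exact: continuous_cos.
      by exists 1 => v; exact: cos_max.
    rewrite ph -EFinM; congr EFin; rewrite [n.+1%:R^-1 * m]mulrC -sinE [LHS]mulrA.
    by congr (_ * expR _); rewrite exprVn; move: (n.+1%:R ^+ 2)^-1 => N; ring.
  have [] // := @dominated_convergence _ _ _ P setT measurableT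
      (fun n v => (n.+1%:R * sin (Y v / n.+1%:R))%:E) (EFin \o Y)
      (abse \o (EFin \o Y)).
  - move=> n; apply/measurable_EFinP; apply: measurable_funM => //.
    apply: (measurableT_comp (f := sin)); last exact: measurable_funM.
    by apply: continuous_measurable_fun; exact: continuous_sin.
  - exact/measurable_EFinP.
  - apply: aeW => v _; apply: cvg_EFin; first exact: nearW.
    exact: cvg_harmonic_sin.
  - exact: integrable_abse.
  - apply: aeW => v n _; rewrite /= lee_fin normrM.
    rewrite (le_trans (ler_wpM2l (normr_ge0 _) (normr_sin_le _)))// -normrM.
    by rewrite mulrC divfK// pnatr_eq0.
  move=> _ _ /cvg_lim h.
  have : lim (EFin (n.+1%:R * sin (m / n.+1%:R) *
       expR (- (s ^+ 2 / 2 / n.+1%:R ^+ 2))) @[n --> \oo]) = m%:E.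
    apply/cvg_lim => //; apply: cvg_EFin; first exact: nearW.
    rewrite -[X in _ --> X]mulr1; apply: cvgM; first exact: cvg_harmonic_sin.
    rewrite (_ : (fun n => _) = (fun n => 1 - @harmonic R n * (@harmonic R n *
      (n.+1%:R ^+ 2 * (1 - expR (- (s ^+ 2 / 2 / n.+1%:R ^+ 2))))))).
      rewrite -[X in _ --> X]subr0; apply: cvgB; first exact: cvg_cst.
      rewrite -(mul0r (0 * (s ^+ 2 / 2))).
      apply: cvgM; first exact: cvg_harmonic.
      apply: cvgM; first exact: cvg_harmonic.
      exact: cvg_harmonic_expR.
    apply/funext => n; rewrite /harmonic /=.
    by move: (n.+1%:R : R) (pnatr_eq0 R n.+1) => N /negbT N0; field.
  move=> h2; have := h; rewrite /= EY => /(_ (@ereal_hausdorff R)).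
  under eq_fun do rewrite Isin.
  by rewrite h2 => -[].
(* Y is viewed as a field indexed by [unit] with candidate variance s^2, so that [tilted_covariance]
   identifies s^2 with the second moment q. *)
have phq L (th : R) : (\int[P]_v (cos (th + lincomb (fun _ : unit => Y) L v) * cst 1 v)%:E =
    (cos th * 1 * expR (- (quadcomb (fun _ _ => s ^+ 2) L / 2)))%:E)%E.
  pose t := \sum_(p <- L) p.2.
  have -> : quadcomb (fun _ _ : unit => s ^+ 2) L = t ^+ 2 * s ^+ 2.
    rewrite /quadcomb /covcomb -mulr_suml -mulr_suml -/t; ring.
  have := ph th t; rewrite m0 mulr0 addr0 mulr1 => <-.
  by apply: eq_integral => v _; rewrite /lincomb -mulr_suml mulr1.
have tY : tilted P (fun _ : unit => Y) (cst 1) 1 (fun _ _ => s ^+ 2).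
  split => //; by move=> v /=; rewrite ltr01 lexx.
have := tilted_covariance (fun _ => mY) (fun _ => iY2) tt tt tY.
under eq_integral do rewrite mulr1 -expr2.
rewrite EY2 mul1r => -[->] th.
have := ph th 1; rewrite m0 mulr0 addr0 expr1n mul1r => <-.
by apply: eq_integral => v _; rewrite mul1r.
Qed.

End CenteredGaussian.

(** * The Gaussian field as an untilted case *)

Section GaussianField.
Context {R : realType} {X : countType} {d : measure_display}
  {T : measurableType d}.
Variables (P : probability T R) (Z : X -> {RV P >-> R}) (Sg : X -> X -> R).
Hypothesis gZ : is_centered_gaussian_field Z Sg.

Lemma gaussian_field_integralM u v : (\int[P]_w (Z u w * Z v w)%:E = (Sg u v)%:E)%E.
Proof.
have [_ EZ covZ] := gZ.
rewrite -covZ unlock !EZ /=; rewrite unlock; apply: eq_integral => w _ /=.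
by congr EFin; rewrite -[RHS]/((Z u w - 0) * (Z v w - 0)) !subr0.
Qed.

Lemma gaussian_field_sqr_integrable u :
  P.-integrable setT (fun w => (Z u w ^+ 2)%:E).
Proof.
apply/integrableP; split.
  by apply/measurable_EFinP; exact: measurable_funX.
under eq_integral do rewrite /= ger0_norm ?sqr_ge0// expr2.
by rewrite gaussian_field_integralM ltry.
Qed.

Lemma gaussian_fieldM_integrable u v :
  P.-integrable setT (fun w => (Z u w * Z v w)%:E).
Proof.
apply: (le_integrable measurableT _ _
  (g := fun w => (Z u w ^+ 2)%:E + (Z v w ^+ 2)%:E)%E).
- by apply/measurable_EFinP; exact: measurable_funM.
- move=> w _; rewrite -EFinD /= lee_fin [leRHS]ger0_norm ?addr_ge0 ?sqr_ge0//.
  rewrite normrM -[Z u w ^+ 2]real_normK ?num_real// -[Z v w ^+ 2]real_normK ?num_real//.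
  have := sqr_ge0 (`|Z u w| - `|Z v w|).
  have := normr_ge0 (Z u w); have := normr_ge0 (Z v w); nra.
- by apply: integrableD => //; exact: gaussian_field_sqr_integrable.
Qed.

Lemma gaussian_field_integrable u : P.-integrable setT (fun w => (Z u w)%:E).
Proof.
apply: (le_integrable measurableT _ _ (g := fun v => 1%:E + (Z u v ^+ 2)%:E)%E).
- exact/measurable_EFinP.
- move=> v _; rewrite -EFinD /= lee_fin [leRHS]ger0_norm ?addr_ge0 ?sqr_ge0//.
  by rewrite -[Z u v ^+ 2]real_normK ?num_real//; have := sqr_ge0 (`|Z u v| - 1); nra.
- apply: integrableD => //; first exact: finite_measure_integrable_cst.
  exact: gaussian_field_sqr_integrable.
Qed.

Lemma tilted_gaussian_field : tilted P (fun u => Z u : T -> R) (cst 1) 1 Sg.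
Proof.
have [lawZ EZ covZ] := gZ.
have symS x y : Sg x y = Sg y x.
  by apply/EFin_inj; rewrite -!covZ covarianceC.
split => //; first by move=> v /=; rewrite ltr01 lexx.
move=> L th.
under eq_integral do rewrite mulr1.
rewrite mulr1.
apply: gaussian_law_centered_phase.
- exact: measurable_lincomb.
(* The definition of a Gaussian field attaches one coefficient to each point, while [L] may repeat
   points: the weights at a point are added up. *)
- have [m [s law]] := lawZ (undup [seq p.1 | p <- L])
    (fun u => \sum_(p <- L | p.1 == u) p.2).
  exists m, s => B mB; rewrite -law//; congr (P (_ @^-1` B)).
  apply/funext => w; rewrite /lincomb.
  under [RHS]eq_bigr do rewrite mulr_suml big_mkcond.
  rewrite exchange_big /= big_seq [RHS]big_seq; apply: eq_bigr => p pL.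
  rewrite (bigD1_seq p.1) ?undup_uniq//=; last by rewrite mem_undup map_f.
  rewrite eqxx big1 ?addr0// => u; rewrite eq_sym => /negbTE ->//.
- by apply: lincomb_sqr_integrable => // u; exact: gaussian_field_sqr_integrable.
- under eq_integral do rewrite /lincomb -sumEFin.
  rewrite integral_sum//; last first.
    move=> p; under eq_fun do rewrite EFinM.
    by apply: integrableZl => //; exact: gaussian_field_integrable.
  rewrite big1// => p _; under eq_integral do rewrite EFinM.
  rewrite integralZl//; last exact: gaussian_field_integrable.
  by have := EZ p.1; rewrite unlock => ->; rewrite mule0.
- rewrite /lincomb.
  under eq_integral do rewrite expr2 mulr_suml -sumEFin.
  have iZZ p q : P.-integrable setT (fun w => (p.2 * q.2)%:E * (Z p.1 w * Z q.1 w)%:E)%E.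
    by apply: integrableZl => //; exact: gaussian_fieldM_integrable.
  have E (p : X * R) (w : T) : ((p.2 * Z p.1 w) * \sum_(q <- L) q.2 * Z q.1 w)%:E =
      (\sum_(q <- L) ((p.2 * q.2)%:E * (Z p.1 w * Z q.1 w)%:E))%E.
    rewrite mulr_sumr -sumEFin; apply: eq_bigr => q _.
    by rewrite -EFinM; congr EFin; ring.
  rewrite integral_sum//; last first.
    by move=> p; under eq_fun do rewrite E; apply: integrable_sum => // q _; exact: iZZ.
  rewrite -sumEFin; apply: eq_bigr => p _.
  under eq_integral do rewrite E.
  rewrite integral_sum//.
  rewrite /covcomb mulr_sumr -sumEFin; apply: eq_bigr => q _.
  rewrite integralZl//; last exact: gaussian_fieldM_integrable.
  by rewrite gaussian_field_integralM -EFinM symS; congr EFin; ring.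
Qed.

End GaussianField.

(** * Absolutely summable families *)

Section RealSums.
Context {R : realType}.

Section countable_sums.
Context {I : countType}.
Implicit Types f g h : I -> R.

(** A family over a countable type is moved to the integers along [pickle] and extended by 0. Sums
    become integrals for the counting measure, and integration theory supplies linearity, comparison
    and dominated convergence. *)
Definition enum_fun f (n : nat) : R := if pickle_inv n is Some x then f x else 0.

Definition abs_summable f : Prop :=
  (@counting nat R).-integrable setT (EFin \o enum_fun f).

Definition rsum f : R := fine (csum f).

Lemma esum_enum_fun f : (forall x, 0 <= f x) ->
  (\esum_(x in [set: I]) (f x)%:E = \int[@counting nat R]_n (enum_fun f n)%:E)%E.
Proof.
move=> f0.
have ef0 n : (0 <= (enum_fun f n)%:E)%E.
  by rewrite lee_fin /enum_fun; case: (pickle_inv n).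
rewrite ge0_integral_count// nneseries_esumT//.
have bij : set_bij [set: I] (range (@pickle I)) pickle.
  split; [by move=> x _; exists x|by move=> x y _ _ /(pcan_inj pickleK)|].
  by move=> _ [x _ <-]; exists x.
rewrite -[RHS](_ : \esum_(n in range (@pickle I)) (enum_fun f n)%:E = _)%E.
  rewrite (reindex_esum _ _ _ _ bij); apply: eq_esum => x _.
  by rewrite /enum_fun pickleK_inv.
rewrite esum_mkcond; apply: eq_esum => n _; case: ifPn => // nI.
rewrite /enum_fun; case E : (pickle_inv n) => [x|]//.
exfalso; move/negP: nI; apply; apply/mem_set; exists x => //.
by have := @pickle_invK I n; rewrite E.
Qed.

Lemma csum_integral f : csum f = (\int[@counting nat R]_n (enum_fun f n)%:E)%E.
Proof.
rewrite /csum integralE; congr (_ - _)%E.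
  rewrite -[LHS](_ : \esum_(x in [set: I]) (Num.max (f x) 0)%:E = _)%E; last first.
    by apply: eq_esum => x _; rewrite funeposE /= EFin_max.
  rewrite esum_enum_fun; last by move=> x; rewrite le_max lexx orbT.
  apply: eq_integral => n _; rewrite funeposE /enum_fun /=.
  by case: (pickle_inv n) => [x|]; rewrite ?EFin_max// maxxx.
rewrite -[LHS](_ : \esum_(x in [set: I]) (Num.max (- f x) 0)%:E = _)%E; last first.
  by apply: eq_esum => x _; rewrite funenegE /= EFin_max EFinN.
rewrite esum_enum_fun; last by move=> x; rewrite le_max lexx orbT.
apply: eq_integral => n _; rewrite funenegE /enum_fun /=.
by case: (pickle_inv n) => [x|]; rewrite ?EFin_max ?EFinN// oppe0 maxxx.
Qed.

Lemma rsumE f : abs_summable f -> csum f = (rsum f)%:E.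
Proof. by move=> sf; rewrite /rsum fineK// csum_integral integrable_fin_num. Qed.

Lemma abs_summable_le f g : (forall x, `|f x| <= g x) -> abs_summable g ->
  abs_summable f.
Proof.
move=> fg; apply: le_integrable => // n _; rewrite /= lee_fin /enum_fun.
case: (pickle_inv n) => [x|]; last by rewrite normr0.
by rewrite (le_trans (fg x))// ler_norm.
Qed.

Lemma abs_summable_ge0P f : (forall x, 0 <= f x) ->
  (\esum_(x in [set: I]) (f x)%:E < +oo)%E -> abs_summable f.
Proof.
move=> f0; rewrite esum_enum_fun// => fy; apply/integrableP; split => //.
rewrite (eq_integral (fun n => (enum_fun f n)%:E))// => n _ /=.
by rewrite ger0_norm// /enum_fun; case: (pickle_inv n).
Qed.

Let enum_fun_ZD a f g n :
  enum_fun (fun x => a * f x + g x) n = a * enum_fun f n + enum_fun g n.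
Proof. by rewrite /enum_fun; case: (pickle_inv n) => //; rewrite mulr0 addr0. Qed.

Lemma abs_summableZD a f g : abs_summable f -> abs_summable g ->
  abs_summable (fun x => a * f x + g x).
Proof.
move=> sf sg; rewrite /abs_summable.
rewrite (_ : _ \o _ = fun n => (a%:E * (enum_fun f n)%:E + (enum_fun g n)%:E)%E).
  by apply: integrableD => //; exact: integrableZl.
by apply/funext => n; rewrite /= enum_fun_ZD EFinD EFinM.
Qed.

Lemma rsumZD a f g : abs_summable f -> abs_summable g ->
  rsum (fun x => a * f x + g x) = a * rsum f + rsum g.
Proof.
move=> sf sg; apply/EFin_inj; rewrite -rsumE; last exact: abs_summableZD.
rewrite EFinD EFinM -!rsumE// !csum_integral.
under eq_integral do rewrite enum_fun_ZD EFinD EFinM.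
by rewrite integralD//; [rewrite integralZl|exact: integrableZl].
Qed.

Lemma abs_summable0 : abs_summable (fun=> 0).
Proof.
rewrite /abs_summable (_ : _ \o _ = cst 0%E); first exact: integrable0.
by apply/funext => n; rewrite /enum_fun /=; case: (pickle_inv n).
Qed.

Lemma rsum0 : rsum (fun=> 0) = 0.
Proof.
rewrite /rsum csum_integral integral0_eq// => n _.
by rewrite /enum_fun; case: (pickle_inv n).
Qed.

Lemma abs_summableZ a f : abs_summable f -> abs_summable (fun x => a * f x).
Proof.
move=> sf; have := abs_summableZD a sf abs_summable0.
by under eq_fun do rewrite addr0.
Qed.

Lemma rsumZ a f : abs_summable f -> rsum (fun x => a * f x) = a * rsum f.
Proof.
move=> sf; have := rsumZD a sf abs_summable0.
by under eq_fun do rewrite addr0; rewrite rsum0 addr0.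
Qed.

Lemma abs_summableD f g : abs_summable f -> abs_summable g ->
  abs_summable (fun x => f x + g x).
Proof.
move=> sf sg; have := abs_summableZD 1 sf sg.
by under eq_fun do rewrite mul1r.
Qed.

Lemma rsumD f g : abs_summable f -> abs_summable g ->
  rsum (fun x => f x + g x) = rsum f + rsum g.
Proof.
move=> sf sg; have := rsumZD 1 sf sg.
by under eq_fun do rewrite mul1r; rewrite mul1r.
Qed.

Lemma abs_summable_sum (J : Type) (r : seq J) (F : J -> I -> R) :
  (forall j, abs_summable (F j)) ->
  abs_summable (fun x => \sum_(j <- r) F j x).
Proof.
move=> sF; elim: r => [|j r IH].
  by under eq_fun do rewrite big_nil; exact: abs_summable0.
by under eq_fun do rewrite big_cons; exact: abs_summableD.
Qed.

Lemma rsum_sum (J : Type) (r : seq J) (F : J -> I -> R) :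
  (forall j, abs_summable (F j)) ->
  rsum (fun x => \sum_(j <- r) F j x) = \sum_(j <- r) rsum (F j).
Proof.
move=> sF; elim: r => [|j r IH].
  by under eq_fun do rewrite big_nil; rewrite big_nil rsum0.
under eq_fun do rewrite big_cons.
by rewrite rsumD// ?big_cons ?IH//; exact: abs_summable_sum.
Qed.

Lemma le_rsum f g : abs_summable f -> abs_summable g ->
  (forall x, f x <= g x) -> rsum f <= rsum g.
Proof.
move=> sf sg fg; rewrite -lee_fin -!rsumE// !csum_integral.
apply: le_integral => // n _; rewrite lee_fin /enum_fun.
by case: (pickle_inv n).
Qed.

Lemma rsum_ge0 f : (forall x, 0 <= f x) -> 0 <= rsum f.
Proof.
move=> f0; rewrite /rsum csum_integral fine_ge0// integral_ge0// => n _.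
by rewrite lee_fin /enum_fun; case: (pickle_inv n).
Qed.

Lemma abs_summable_norm f : abs_summable f -> abs_summable (fun x => `|f x|).
Proof.
move=> /integrable_abse; rewrite /abs_summable.
rewrite (_ : abse \o _ = EFin \o enum_fun (fun x => `|f x|))//.
apply/funext => n; rewrite /enum_fun /=.
by case: (pickle_inv n) => // ; rewrite normr0.
Qed.

Lemma ler_norm_rsum f : abs_summable f -> `|rsum f| <= rsum (fun x => `|f x|).
Proof.
move=> sf; rewrite ler_norml; apply/andP; split.
  rewrite lerNl -mulN1r -rsumZ//; apply: le_rsum.
  - exact: abs_summableZ.
  - exact: abs_summable_norm.
  - by move=> x; rewrite mulN1r -normrN ler_norm.
by apply: le_rsum => //; [exact: abs_summable_norm|move=> x; exact: ler_norm].
Qed.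

Let enum_fun_pred1 f x n : enum_fun (fun z => (z == x)%:R * f z) n =
  f x * \1_[set pickle x] n.
Proof.
rewrite /enum_fun indicE; case E : (pickle_inv n) => [z|].
  have nE : pickle z = n by have := @pickle_invK I n; rewrite E.
  have [zx|zx] := eqVneq z x; first by rewrite -nE zx mem_set// mulrC.
  rewrite memNset ?mul0r ?mulr0// => /= nx.
  by move/eqP: zx; apply; apply: (pcan_inj pickleK); rewrite nE nx.
rewrite memNset ?mulr0// => /= nx; move: E.
by rewrite nx pickleK_inv.
Qed.

Let integrable_pred1 x :
  (@counting nat R).-integrable setT (EFin \o \1_[set @pickle I x]).
Proof.
apply/integrableP; split; first exact/measurable_EFinP.
rewrite (eq_integral (EFin \o \1_[set @pickle I x])) => [|n _ /=]; last by rewrite ger0_norm.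
by rewrite integral_indic// setIT /= /counting asboolT ?ltry//; exact: finite_set1.
Qed.

Lemma abs_summable_pred1 f x : abs_summable (fun z => (z == x)%:R * f z).
Proof.
have := integrableZl measurableT (f x) (integrable_pred1 x).
congr (_.-integrable _ _); apply/funext => n.
by rewrite /= enum_fun_pred1 EFinM.
Qed.

Lemma rsum_pred1 f x : rsum (fun z => (z == x)%:R * f z) = f x.
Proof.
rewrite /rsum csum_integral.
under eq_integral do rewrite enum_fun_pred1 EFinM.
rewrite (integralZl measurableT (integrable_pred1 x)).
rewrite integral_indic// setIT /= /counting asboolT ?fset_set1 ?finmap.cardfs1 ?mule1//.
Qed.

Lemma rsum_ge_term f x : abs_summable f -> (forall z, 0 <= f z) -> f x <= rsum f.
Proof.
move=> sf f0; rewrite -[leLHS](rsum_pred1 f x); apply: le_rsum => //.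
  exact: abs_summable_pred1.
by move=> z; case: eqP => _; rewrite ?mul1r// mul0r.
Qed.

End countable_sums.

Section series.
Implicit Types f g : nat -> R.

Lemma enum_fun_nat f : enum_fun f = f.
Proof. by apply/funext => n; rewrite /enum_fun -[n]/(pickle n) pickleK_inv. Qed.

Lemma cvg_rsum f : abs_summable f -> \sum_(0 <= i < n) f i @[n --> \oo] --> rsum f.
Proof.
have ge0 g : (forall n, 0 <= g n) -> abs_summable g ->
    \sum_(0 <= i < n) g i @[n --> \oo] --> rsum g.
  move=> g0 sg.
  have h : (\sum_(0 <= k < n) (g k)%:E)%E @[n --> \oo] --> (rsum g)%:E.
    rewrite -rsumE// csum_integral enum_fun_nat ge0_integral_count//.
    by apply: is_cvg_nneseries => *; rewrite lee_fin.
  have E : (fun n => \sum_(0 <= k < n) (g k)%:E)%E =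
      EFin \o (fun n => \sum_(0 <= k < n) g k) by apply/funext => n; rewrite /= sumEFin.
  rewrite E in h.
  exact: (fine_cvg h).
move=> sf.
have sp : abs_summable (fun n => Num.max (f n) 0).
  apply: abs_summable_le (abs_summable_norm sf) => n.
  by rewrite ger0_norm ?le_max ?lexx ?orbT// ge_max ler_norm normr_ge0.
have sn : abs_summable (fun n => Num.max (- f n) 0).
  apply: abs_summable_le (abs_summable_norm sf) => n.
  rewrite ger0_norm ?le_max ?lexx ?orbT// ge_max normr_ge0 andbT.
  by rewrite -normrN ler_norm.
have fE n : f n = -1 * Num.max (- f n) 0 + Num.max (f n) 0.
  by case: (leP (f n) 0); case: (leP (- f n) 0); lra.
rewrite (_ : rsum f = - rsum (fun n => Num.max (- f n) 0) +
    rsum (fun n => Num.max (f n) 0)); last first.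
  by rewrite -mulN1r -rsumZD//; congr rsum; apply/funext.
rewrite (_ : (fun n => _) = (fun n => - (\sum_(0 <= i < n) Num.max (- f i) 0) +
    \sum_(0 <= i < n) Num.max (f i) 0)); last first.
  apply/funext => n; rewrite -sumrN -big_split; apply: eq_bigr => i _ /=.
  by rewrite {1}fE mulN1r.
apply: cvgD; last by apply: ge0 => // n; rewrite le_max lexx orbT.
by apply: cvgN; apply: ge0 => // n; rewrite le_max lexx orbT.
Qed.

Lemma abs_summable_bounded f (M : R) : (forall n, 0 <= f n) ->
  (forall n, \sum_(0 <= i < n) f i <= M) -> abs_summable f.
Proof.
move=> f0 fM; apply: abs_summable_ge0P => //.
rewrite -nneseries_esumT//.
apply: (@le_lt_trans _ _ M%:E); last exact: ltry.
apply: lime_le; first by apply: is_cvg_nneseries => *; rewrite lee_fin.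
by apply: nearW => n; rewrite sumEFin lee_fin.
Qed.

Lemma ler_sum_rsum f n : abs_summable f -> (forall n, 0 <= f n) ->
  \sum_(0 <= i < n) f i <= rsum f.
Proof.
move=> sf f0; have h := cvg_rsum sf; rewrite -(cvg_lim _ h)//.
apply: nondecreasing_cvgn_le; last by apply/cvg_ex; eexists; exact: h.
by apply/nondecreasing_seqP => k; rewrite big_nat_recr//= lerDl.
Qed.

Lemma sum_convolution f g n :
  \sum_(0 <= k < n) \sum_(i < k.+1) f i * g (k - i)%N =
  \sum_(i < n) f i * \sum_(0 <= j < n - i) g j.
Proof.
elim: n => [|n IH]; first by rewrite big_nil big_ord0.
rewrite big_nat_recr//= IH.
have -> : \sum_(i < n) f i * (\sum_(0 <= j < n - i) g j) =
    \sum_(i < n.+1) f i * (\sum_(0 <= j < n - i) g j).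
  by rewrite [RHS]big_ord_recr/= subnn big_nil mulr0 addr0.
rewrite -big_split; apply: eq_bigr => i _ /=.
have ni : (i <= n)%N by rewrite -ltnS.
by rewrite subSn// big_nat_recr//= mulrDr.
Qed.

(* The partial sums of the convolution converge by dominated convergence. *)
Lemma Cauchy_product f g : abs_summable f -> abs_summable g ->
  abs_summable (fun n => \sum_(i < n.+1) f i * g (n - i)%N) /\
  rsum (fun n => \sum_(i < n.+1) f i * g (n - i)%N) = rsum f * rsum g.
Proof.
move=> sf sg.
have saf := abs_summable_norm sf; have sag := abs_summable_norm sg.
pose M := rsum (fun n => `|g n|).
have GM n : \sum_(0 <= j < n) `|g j| <= M by exact: ler_sum_rsum.
have sconv : abs_summable (fun n => \sum_(i < n.+1) f i * g (n - i)%N).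
  apply: (@abs_summable_le _ _ (fun n => \sum_(i < n.+1) `|f i| * `|g (n - i)%N|)).
    by move=> n; rewrite (le_trans (ler_norm_sum _ _ _))// ler_sum// => i _; rewrite normrM.
  apply: (@abs_summable_bounded _ (rsum (fun n => `|f n|) * M)).
    by move=> n; apply: sumr_ge0 => i _; rewrite mulr_ge0.
  move=> n; rewrite (sum_convolution (fun n => `|f n|) (fun n => `|g n|)).
  rewrite (@le_trans _ _ (\sum_(i < n) `|f i| * M))//.
    by apply: ler_sum => i _; rewrite ler_wpM2l.
  rewrite -mulr_suml ler_wpM2r ?rsum_ge0//.
  by rewrite -(big_mkord xpredT (fun i => `|f i|)); exact: ler_sum_rsum.
split => //.
have h := cvg_rsum sconv; rewrite -(cvg_lim _ h)//; apply/cvg_lim => //.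
(* The contribution of [f i] to the n-th partial sum of the convolution; it is dominated by M |f i|
   and tends to f i times the sum of g. *)
pose F n i : R := if (i < n)%N then f i * \sum_(0 <= j < n - i) g j else 0.
have FE n : \sum_(0 <= k < n) \sum_(i < k.+1) f i * g (k - i)%N =
    fine (\int[@counting nat R]_i (F n i)%:E)%E.
  have sF : abs_summable (F n).
    apply: (@abs_summable_le _ _ (fun i => M * `|f i|)); last exact: abs_summableZ.
    move=> i; rewrite /F; case: ifPn => _; last by rewrite normr0 mulr_ge0// rsum_ge0.
    rewrite normrM mulrC ler_wpM2r// (le_trans (ler_norm_sum _ _ _))//.
  have := csum_integral (F n); rewrite enum_fun_nat => <-.
  rewrite -/(rsum (F n)) sum_convolution.
  have hF := cvg_rsum sF; rewrite -(cvg_lim _ hF)//; apply/esym/cvg_lim => //.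
  apply: cvg_near_cst; exists n => // m /= nm.
  rewrite (big_cat_nat (leq0n n) nm)/= [X in _ + X]big_nat_cond [X in _ + X]big1 ?addr0.
    rewrite big_mkord; apply: eq_bigr => i _; rewrite /F ltn_ord//.
  by move=> i /andP[/andP[ni _] _]; rewrite /F ltnNge ni.
under eq_fun do rewrite FE.
have [] // := @dominated_convergence _ _ _ (@counting nat R) setT measurableT
    (fun n i => (F n i)%:E) (fun i => (f i * rsum g)%:E)
    (fun i => (M%:E * (abse \o (EFin \o f)) i)%E).
- apply: aeW => i _; apply: cvg_EFin; first exact: nearW.
  apply: (@cvg_trans _ ((f i * \sum_(0 <= j < n - i) g j) @[n --> \oo])).
    apply: near_eq_cvg; exists i.+1 => // n /= ni; rewrite /F ni//.
  apply: cvgMr; rewrite -(cvg_shiftn i) /=.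
  by under eq_fun do rewrite addnK; exact: cvg_rsum.
- apply: integrableZl => //; apply: integrable_abse.
  by move: sf; rewrite /abs_summable enum_fun_nat.
- apply: aeW => i n _; rewrite /= lee_fin /F; case: ifPn => _; last first.
    by rewrite normr0 mulr_ge0// rsum_ge0.
  rewrite normrM mulrC ler_wpM2r// (le_trans (ler_norm_sum _ _ _))//.
move=> _ _ hc.
have E : (\int[@counting nat R]_i (f i * rsum g)%:E = (rsum f * rsum g)%:E)%E.
  under eq_integral do rewrite mulrC EFinM.
  have sf' := sf; rewrite /abs_summable enum_fun_nat in sf'.
  rewrite integralZl//; have := csum_integral f; rewrite enum_fun_nat => <-.
  by rewrite (rsumE sf); exact: muleC.
by rewrite E in hc; exact: (fine_cvg hc).
Qed.

End series.

End RealSums.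

(** * Green functions of signed substochastic matrices *)

Section SubstochasticMatrices.
Context {R : realType} {X : countType}.
Implicit Types (w : X -> X -> R) (x y z : X).
Variable p : X -> X -> R.
Hypotheses (p_ge0 : forall x y, 0 <= p x y)
  (p_summable : forall x, abs_summable (p x))
  (p_le1 : forall x, rsum (p x) <= 1).

Lemma mxpowS w n x y :
  mxpow w n.+1 x y = rsum (fun z => w x z * mxpow w n z y).
Proof. by []. Qed.

Lemma abs_summable_row w x (f : X -> R) (C : R) :
  (forall z, `|w x z| <= p x z) -> (forall z, `|f z| <= C) ->
  abs_summable (fun z => w x z * f z).
Proof.
move=> wp fC; apply: (@abs_summable_le _ _ _ (fun z => C * p x z)); last first.
  exact: abs_summableZ.
by move=> z; rewrite normrM mulrC ler_pM.
Qed.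

Lemma abs_summable_p x (f : X -> R) : (forall z, 0 <= f z <= 1) ->
  abs_summable (fun z => p x z * f z).
Proof.
move=> f01; apply: (@abs_summable_row p x f 1).
  by move=> z; rewrite ger0_norm.
by move=> z; have /andP[f0 f1] := f01 z; rewrite ger0_norm.
Qed.

Lemma mxpow_itv n x y : 0 <= mxpow p n x y <= 1.
Proof.
elim: n x => [|n IH] x; first by rewrite /mxpow/=; case: eqP; rewrite ?lexx ?ler01.
rewrite mxpowS rsum_ge0/=; last first.
  by move=> z; rewrite mulr_ge0//; case/andP: (IH z).
apply: le_trans (p_le1 x); apply: le_rsum => //; first exact: abs_summable_p.
by move=> z; rewrite ler_piMr//; case/andP: (IH z).
Qed.

Lemma mxpow_ge0 n x y : 0 <= mxpow p n x y.
Proof. by case/andP: (mxpow_itv n x y). Qed.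

Lemma mxpow_dominated w n x y : (forall x y, `|w x y| <= p x y) ->
  `|mxpow w n x y| <= mxpow p n x y.
Proof.
move=> wp; elim: n x => [|n IH] x.
  by rewrite /mxpow/= ger0_norm//; case: eqP.
have s1 : abs_summable (fun z => w x z * mxpow w n z y).
  apply: (@abs_summable_row w x _ 1) => // z.
  by rewrite (le_trans (IH z))//; case/andP: (mxpow_itv n z y).
rewrite !mxpowS (le_trans (ler_norm_rsum s1))//.
apply: le_rsum; first exact: abs_summable_norm.
  by apply: abs_summable_p => z; exact: mxpow_itv.
by move=> z; rewrite normrM ler_pM.
Qed.

Lemma abs_summable_mxpow w n x y : (forall x y, `|w x y| <= p x y) ->
  abs_summable (fun z => w x z * mxpow w n z y).
Proof.
move=> wp; apply: (@abs_summable_row w x _ 1) => // z.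
by rewrite (le_trans (mxpow_dominated n z y wp))//; case/andP: (mxpow_itv n z y).
Qed.

(** The Chapman-Kolmogorov sum, of which only the paths through y at time n are kept. *)
Lemma mxpowD_ge n m x y z : mxpow p n x y * mxpow p m y z <= mxpow p (n + m) x z.
Proof.
have pp u v : `|p u v| <= p u v by rewrite ger0_norm.
elim: n x => [|n IH] x.
  rewrite add0n /mxpow/= -/(mxpow p m y z) -/(mxpow p m x z).
  by case: eqP => [->|_]; rewrite ?mul1r// mul0r mxpow_ge0.
rewrite addSn !mxpowS mulrC -rsumZ; last exact: abs_summable_mxpow.
apply: le_rsum; first by apply: abs_summableZ; exact: abs_summable_mxpow.
  exact: abs_summable_mxpow.
by move=> u; rewrite mulrCA ler_wpM2l// mulrC.
Qed.

Definition escape x : R := 1 - rsum (p x).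

(** The probability that the chain started at x is alive after n steps. *)
Let survival n : X -> R := iter n (fun f x => rsum (fun z => p x z * f z)) (cst 1).

Let survival_itv n x : 0 <= survival n x <= 1.
Proof.
elim: n x => [|n IH] x /=; first by rewrite ler01 lexx.
rewrite rsum_ge0/=; last by move=> z; rewrite mulr_ge0//; case/andP: (IH z).
apply: le_trans (p_le1 x); apply: le_rsum => //; first exact: abs_summable_p.
by move=> z; rewrite ler_piMr//; case/andP: (IH z).
Qed.

(** Being at y at time k and escaping at the next step is one way to die between times k and k + 1.
    The differences of [survival] telescope. *)
Lemma mxpow_escape_sum n x y :
  \sum_(0 <= k < n) mxpow p k x y * escape y <= 1.
Proof.
have pp u v : `|p u v| <= p u v by rewrite ger0_norm.
have step k u : mxpow p k u y * escape y <= survival k u - survival k.+1 u.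
  elim: k u => [|k IH] u.
    rewrite /mxpow/= -[X in _ <= _ - X](_ : rsum (p u) = _); last first.
      by congr rsum; apply/funext => z; rewrite mulr1.
    by case: eqP => [->|_]; rewrite ?mul1r// mul0r subr_ge0.
  have s1 : abs_summable (fun z => p u z * survival k.+1 z).
    by apply: abs_summable_p => z; exact: survival_itv.
  have s2 : abs_summable (fun z => p u z * survival k z).
    by apply: abs_summable_p => z; exact: survival_itv.
  rewrite mxpowS mulrC -rsumZ; last exact: abs_summable_mxpow.
  have -> : survival k.+1 u - survival k.+2 u =
      rsum (fun z => -1 * (p u z * survival k.+1 z) + p u z * survival k z).
    by rewrite rsumZD// mulN1r addrC.
  apply: le_rsum; first by apply: abs_summableZ; exact: abs_summable_mxpow.
    exact: abs_summableZD.
  move=> z; rewrite mulN1r addrC -mulrBr mulrCA ler_wpM2l//.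
  by rewrite mulrC IH.
rewrite (@le_trans _ _ (\sum_(0 <= k < n) (survival k x - survival k.+1 x)))//.
  by apply: ler_sum => k _; exact: step.
have -> : \sum_(0 <= k < n) (survival k x - survival k.+1 x) = 1 - survival n x.
  elim: n => [|n IH]; first by rewrite big_nil subrr.
  by rewrite big_nat_recr//= IH /= addrA subrK.
by rewrite gerBl; case/andP: (survival_itv n x).
Qed.

Lemma mxpow_summable_escape x y : 0 < escape y ->
  abs_summable (fun n => mxpow p n x y).
Proof.
move=> y0; apply: (@abs_summable_bounded _ _ (escape y)^-1).
  by move=> n; exact: mxpow_ge0.
move=> n; rewrite -(ler_pM2r y0) mulVf ?gt_eqF//.
by rewrite mulr_suml; exact: mxpow_escape_sum.
Qed.

(** Each visit to y leads to z after m steps with a fixed positive probability, so the visits to y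
    are controlled by those to z. *)
Lemma mxpow_summable_reach x y z m : 0 < mxpow p m y z -> 0 < escape z ->
  abs_summable (fun n => mxpow p n x y).
Proof.
move=> yz z0; have sz := mxpow_summable_escape x z0.
apply: (@abs_summable_bounded _ _ ((mxpow p m y z)^-1 * rsum (fun n => mxpow p n x z))).
  by move=> n; exact: mxpow_ge0.
move=> n; rewrite -(ler_pM2l yz) mulrA mulfV ?gt_eqF// mul1r mulr_sumr.
apply: (@le_trans _ _ (\sum_(0 <= i < n) mxpow p (i + m) x z)).
  by apply: ler_sum => i _; rewrite mulrC mxpowD_ge.
rewrite (@le_trans _ _ (\sum_(0 <= i < m + n) mxpow p i x z))//; last first.
  by apply: ler_sum_rsum => // k; exact: mxpow_ge0.
rewrite (big_cat_nat (leq0n m) (leq_addr n m))/=.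
have -> : \sum_(m <= i < m + n) mxpow p i x z = \sum_(0 <= i < n) mxpow p (i + m) x z.
  by rewrite -{1}[m]add0n big_addn addKn.
rewrite lerDr.
by apply: sumr_ge0 => i _; exact: mxpow_ge0.
Qed.

Lemma mxpow_path_gt0 x (s : seq X) : path (fun u v => 0 < p u v) x s ->
  0 < mxpow p (size s) x (last x s).
Proof.
have pp u v : `|p u v| <= p u v by rewrite ger0_norm.
elim: s x => [|y s IH] x; first by rewrite /mxpow /= eqxx.
rewrite [path _ _ _]/= [last _ _]/= [size _]/=.
move=> /andP[xy /IH s0]; rewrite mxpowS.
apply: lt_le_trans (rsum_ge_term y (abs_summable_mxpow _ _ _ pp) _).
  exact: mulr_gt0.
by move=> z; rewrite mulr_ge0// mxpow_ge0.
Qed.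

End SubstochasticMatrices.

(** * Green functions with additional killing *)

Section Green.
Context {R : realType} {X : countType}.
Implicit Types (x y z : X) (L : seq (X * R)).
Variables (p w : X -> X -> R) (q : X -> R).
Hypotheses (p_ge0 : forall x y, 0 <= p x y)
  (p_summable : forall x, abs_summable (p x))
  (p_le1 : forall x, rsum (p x) <= 1)
  (p_transient : forall x y, abs_summable (fun n => mxpow p n x y))
  (q_gt0 : forall x, 0 < q x)
  (w_le : forall x y, `|w x y| <= p x y).

Definition killing L x : R := \sum_(a <- L | a.1 == x) a.2.

Definition nonneg_weights L := forall a, a \in L -> 0 <= a.2.

Lemma killing_ge0 L x : nonneg_weights L -> 0 <= killing L x.
Proof. by move=> L0; rewrite /killing big_seq_cond sumr_ge0// => a /andP[/L0]. Qed.

(** The factor is the probability that the jump, of rate [q x], comes before an independent killing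
    of rate [killing L x]. *)
Definition damped_mx L x y : R := q x / (q x + killing L x) * w x y.

(** The divisor is the total rate of leaving y, its inverse the mean time spent there per visit. *)
Definition green_term L n x y : R :=
  mxpow (damped_mx L) n x y / (q y + killing L y).

Definition green L x y : R := rsum (fun n => green_term L n x y).

Lemma rate_gt0 L x : nonneg_weights L -> 0 < q x + killing L x.
Proof. by move=> L0; rewrite ltr_pwDl// killing_ge0. Qed.

Lemma damped_mx_le L x y : nonneg_weights L -> `|damped_mx L x y| <= p x y.
Proof.
move=> L0; have r0 := rate_gt0 x L0.
rewrite /damped_mx normrM ger0_norm ?divr_ge0 ?(ltW r0) ?(ltW (q_gt0 x))//.
apply: le_trans (w_le x y); rewrite ler_piMl// ler_pdivrMr// mul1r lerDl.
exact: killing_ge0.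
Qed.

Lemma abs_summable_damped L x y : nonneg_weights L ->
  abs_summable (fun n => mxpow (damped_mx L) n x y).
Proof.
move=> L0; apply: abs_summable_le (p_transient x y) => n.
by apply: mxpow_dominated => // u v; exact: damped_mx_le.
Qed.

Lemma abs_summable_green L x y : nonneg_weights L ->
  abs_summable (fun n => green_term L n x y).
Proof.
move=> L0; rewrite /green_term; under eq_fun do rewrite mulrC.
by apply: abs_summableZ; exact: abs_summable_damped.
Qed.

Lemma abs_summable_wgreen L n x y : nonneg_weights L ->
  abs_summable (fun z => w x z * green_term L n z y).
Proof.
move=> L0; have r0 := rate_gt0 y L0.
apply: (@abs_summable_row _ _ _ p_summable w x _ ((q y + killing L y)^-1)) => // z.
rewrite /green_term normrM [`|_^-1|]ger0_norm ?invr_ge0 ?(ltW r0)//.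
rewrite ler_piMl ?invr_ge0 ?(ltW r0)//.
apply: le_trans (mxpow_dominated p_ge0 p_summable p_le1 n z y _) _.
  by move=> a b; exact: damped_mx_le.
by case/andP: (mxpow_itv p_ge0 p_summable p_le1 n z y).
Qed.

Lemma green_termS L n x y : nonneg_weights L ->
  green_term L n.+1 x y =
  q x / (q x + killing L x) * rsum (fun z => w x z * green_term L n z y).
Proof.
move=> L0.
have s1 : abs_summable (fun z => damped_mx L x z * mxpow (damped_mx L) n z y).
  by apply: (abs_summable_mxpow p_ge0) => // u v; exact: damped_mx_le.
rewrite -rsumZ; last exact: abs_summable_wgreen.
transitivity (rsum (fun z => (q y + killing L y)^-1 *
    (damped_mx L x z * mxpow (damped_mx L) n z y))).
  by rewrite rsumZ// /green_term mxpowS mulrC.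
by congr rsum; apply/funext => z; rewrite /damped_mx /green_term; ring.
Qed.

Lemma killing_cons u (k : R) L x :
  killing ((u, k) :: L) x = (u == x)%:R * k + killing L x.
Proof.
by rewrite /killing big_cons /=; case: eqP => _; rewrite ?mul1r// mul0r add0r.
Qed.

(* Paths are split at the first visit of [u] from which the weight is taken
   without the extra killing rate [k]. *)
Lemma green_term_convolution u (k : R) L n x y : 0 <= k -> nonneg_weights L ->
  green_term L n x y = green_term ((u, k) :: L) n x y +
    k * \sum_(j < n.+1) green_term ((u, k) :: L) j x u * green_term L (n - j) u y.
Proof.
move=> k0 L0; set L' := (u, k) :: L.
have L'0 : nonneg_weights L' by move=> a; rewrite inE => /predU1P[->|/L0].
have r0 z := rate_gt0 z L0; have r'0 z := rate_gt0 z L'0.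
have r'E z : q z + killing L' z = q z + killing L z + (u == z)%:R * k.
  by rewrite /L' killing_cons; ring.
elim: n x => [|n IH] x.
  (* For x = y = u this is 1 / r = 1 / r' + k / (r' r), where r' = r + k are the total rates at u;
     otherwise the convolution vanishes and both terms agree. *)
  rewrite big_ord1 subnn /green_term /mxpow/= [q y + killing L' y]r'E.
  have := r'0 y; rewrite r'E.
  have [uy|yu] := eqVneq u y.
    move=> r'y; have [xy|xu] := eqVneq x y; last first.
      by rewrite uy (negbTE xu) /= !mul0r mulr0 addr0.
    rewrite /= mul1r in r'y; rewrite /= ?r'E ?uy ?xy ?eqxx /= ?mul1r.
    by field; rewrite !gt_eqF.
  by rewrite /= !mul0r !mulr0 !addr0.
have sG := abs_summable_wgreen.
(* [E], [A] and [B] are the averages over the first jump of the three sums in the induction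
   hypothesis. *)
pose E := rsum (fun z => w x z * green_term L n z y).
pose A := rsum (fun z => w x z * green_term L' n z y).
pose B := \sum_(j < n.+1) rsum (fun z => w x z * green_term L' j z u) *
  green_term L (n - j) u y.
have EAB : E = A + k * B.
  rewrite /E (_ : (fun z => _) = (fun z =>
      w x z * green_term L' n z y + k * \sum_(j < n.+1)
        (green_term L (n - j) u y * (w x z * green_term L' j z u)))); last first.
    apply/funext => z; rewrite IH mulrDr; congr (_ + _).
    rewrite mulrCA; congr (_ * _); rewrite mulr_sumr; apply: eq_bigr => j _.
    by ring.
  have sj (j : 'I_n.+1) : abs_summable (fun z =>
      green_term L (n - j) u y * (w x z * green_term L' j z u)).
    by apply: abs_summableZ; exact: sG.
  rewrite rsumD; [|exact: sG|by apply: abs_summableZ; exact: abs_summable_sum].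
  rewrite rsumZ; last exact: abs_summable_sum.
  rewrite rsum_sum//; congr (_ + _ * _); apply: eq_bigr => j _.
  by rewrite rsumZ; [rewrite mulrC|exact: sG].
rewrite big_ord_recl subn0.
have -> : \sum_(i < n.+1) green_term L' (lift ord0 i) x u *
    green_term L (n.+1 - lift ord0 i) u y = q x / (q x + killing L' x) * B.
  rewrite /B mulr_sumr; apply: eq_bigr => j _.
  by rewrite /= /bump leq0n add1n subSS green_termS// mulrA.
rewrite (green_termS n x y L0) (green_termS n x y L'0) -/E -/A.
have -> : green_term L' (@ord0 n.+1) x u = (x == u)%:R / (q u + killing L' u) by [].
(* Away from u the total rates at x agree and the term j = 0 vanishes. At u the term j = 0 makes up
   for the difference of the rates. *)
have [xu|xu] := eqVneq x u; last first.
  rewrite r'E [u == x]eq_sym (negbTE xu) /= !mul0r add0r addr0 EAB; ring.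
rewrite /= mul1r (green_termS n u y L0).
have -> : rsum (fun z => w u z * green_term L n z y) = E by rewrite /E xu.
have := r0 x; have := r'0 x; rewrite xu !r'E eqxx /= mul1r EAB => h1 h2.
by field; rewrite !gt_eqF.
Qed.

(** Summing the convolution identity over the length of the paths turns it into a product of Green
    functions. *)
Lemma green_resolvent u (k : R) L x y : 0 <= k -> nonneg_weights L ->
  green L x y = green ((u, k) :: L) x y +
    k * (green ((u, k) :: L) x u * green L u y).
Proof.
move=> k0 L0.
have L'0 : nonneg_weights ((u, k) :: L) by move=> a; rewrite inE => /predU1P[->|/L0].
have [sc <-] := Cauchy_product (abs_summable_green x u L'0) (abs_summable_green u y L0).
rewrite -rsumZ// -rsumD//; last 2 first.
- exact: abs_summable_green.
- exact: abs_summableZ.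
by congr rsum; apply/funext => n; exact: green_term_convolution.
Qed.

(** The resolvent identity at y = u gives G'(x,u) = G(x,u) / (1 + k G(u,u)); substituting this back
    is the Sherman-Morrison formula. Since [w] is signed, the positivity of the denominator is a
    hypothesis. *)
Lemma green_cons u (k : R) L x y : 0 <= k -> nonneg_weights L ->
  0 < 1 + k * green L u u ->
  green ((u, k) :: L) x y =
  green L x y - k / (1 + k * green L u u) * green L x u * green L u y.
Proof.
move=> k0 L0 g0.
have e1 := green_resolvent u x y k0 L0.
have e2 := green_resolvent u x u k0 L0.
rewrite e1; move: g0 e2.
set a := green _ x u; set b := green L u u; set c := green L u y.
set a' := green _ x u => g0 ->.
by field; rewrite gt_eqF.
Qed.

End Green.

(** * Generators and measurability on trajectories *)

Section GeneratorFacts.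
Context {R : realType} {X : countType}.
Variable Q : X -> X -> R.
Hypothesis genQ : is_generator Q.

Let p := jump_mx Q.
Let q x := - Q x x.

Lemma jump_rate_gt0 x : 0 < q x.
Proof. by have [_ _ Q0 _ _] := genQ; rewrite /q oppr_gt0. Qed.

Lemma jump_mx_ge0 x y : 0 <= p x y.
Proof.
have [_ Qp Q0 _ _] := genQ; rewrite /p /jump_mx; case: eqP => // /eqP xy.
by rewrite mulNr -mulrN -invrN mulr_ge0 ?Qp// invr_ge0 oppr_ge0 ltW.
Qed.

Let Qpos x z : Num.max (Q x z) 0 = q x * p x z.
Proof.
have [_ Qp Q0 _ _] := genQ; rewrite /p /jump_mx.
have [->|xz] := eqVneq x z; first by rewrite mulr0 max_r// ltW.
rewrite max_l ?Qp// /q; field.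
by rewrite lt_eqF.
Qed.

Let Qneg x z : Num.max (- Q x z) 0 = (z == x)%:R * q x.
Proof.
have [_ Qp Q0 _ _] := genQ.
have [->|xz] := eqVneq z x; first by rewrite mul1r max_l// oppr_ge0 ltW.
by rewrite mul0r max_r// oppr_le0 Qp// eq_sym.
Qed.

Let csumQ x : (csum (Q x) =
  \esum_(z in [set: X]) (q x * p x z)%:E - (q x)%:E)%E.
Proof.
rewrite /csum; congr (_ - _)%E.
  by apply: eq_esum => z _; rewrite funeposE /= -Qpos EFin_max.
rewrite -[RHS](_ : (rsum (fun z => (z == x)%:R * q x))%:E = _)%E; last first.
  by rewrite (rsum_pred1 (fun=> q x)).
rewrite -rsumE; last exact: (abs_summable_pred1 (fun=> q x)).
rewrite csum_integral -esum_enum_fun; last first.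
  by move=> z; rewrite mulr_ge0// ltW// jump_rate_gt0.
by apply: eq_esum => z _; rewrite funenegE /= -Qneg EFin_max.
Qed.

(** The negative part of a row of [Q] sits on the diagonal and is finite, so an infinite positive
    part would make the row sum +oo, against its sign. *)
Lemma jump_mx_summable x : abs_summable (p x).
Proof.
have [_ _ _ Qs _] := genQ.
have sq : abs_summable (fun z => q x * p x z).
  apply: abs_summable_ge0P.
    by move=> z; rewrite mulr_ge0 ?jump_mx_ge0// ltW// jump_rate_gt0.
  by have := Qs x; rewrite csumQ; case: (esum _ _) => [r||]; rewrite ?ltry.
have := abs_summableZ (q x)^-1 sq.
by under eq_fun do rewrite mulKf ?gt_eqF ?jump_rate_gt0//.
Qed.

Let csumQE x : csum (Q x) = (q x * rsum (p x) - q x)%:E.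
Proof.
rewrite csumQ EFinB; congr (_ - _)%E.
have sq : abs_summable (fun z => q x * p x z) by apply: abs_summableZ; exact: jump_mx_summable.
rewrite -rsumZ ?jump_mx_summable//; last exact: jump_mx_summable.
rewrite -rsumE// csum_integral esum_enum_fun// => z.
by rewrite mulr_ge0 ?jump_mx_ge0// ltW// jump_rate_gt0.
Qed.

Lemma jump_mx_le1 x : rsum (p x) <= 1.
Proof.
have [_ _ _ Qs _] := genQ; have := Qs x; rewrite csumQE lee_fin subr_le0.
by rewrite -[leRHS]mulr1 ler_pM2l// jump_rate_gt0.
Qed.

Lemma escape_jump_gt0 x : (csum (Q x) < 0)%E -> 0 < escape p x.
Proof.
rewrite csumQE lte_fin subr_lt0 -[ltRHS]mulr1 ltr_pM2l ?jump_rate_gt0// => h.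
by rewrite subr_gt0.
Qed.

(** Either y itself has positive escape probability, or irreducibility gives a path from y to a
    state that has. *)
Lemma jump_mx_transient x y : abs_summable (fun n => mxpow p n x y).
Proof.
have [_ Qp _ _ [[irr [z /escape_jump_gt0 z0]]|esc]] := genQ; last first.
  apply: (mxpow_summable_escape jump_mx_ge0 jump_mx_summable jump_mx_le1).
  exact/escape_jump_gt0/esc.
have [s [sp sE]] := irr y z.
apply: (mxpow_summable_reach jump_mx_ge0 jump_mx_summable jump_mx_le1 _ _ z0).
rewrite -sE.
apply: (mxpow_path_gt0 jump_mx_ge0 jump_mx_summable jump_mx_le1).
apply: sub_path sp => u v /andP[uv Quv].
rewrite /p /jump_mx (negbTE uv) mulNr -mulrN -invrN divr_gt0//.
exact: jump_rate_gt0.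
Qed.

Variable S : X -> X -> R.
Hypothesis signS : is_sign_matrix S.

Lemma jump_mx_hadamard x y : jump_mx (hadamard Q S) x y = p x y * S x y.
Proof.
have [S1 _ _] := signS; rewrite /p /jump_mx /hadamard S1 mulr1.
by case: eqP => _; [rewrite mul0r|ring].
Qed.

Lemma normr_sign x y : `|S x y| = 1.
Proof. by have [_ _ /(_ x y)[]->] := signS; rewrite ?normrN normr1. Qed.

Lemma signed_jump_le x y : `|p x y * S x y| <= p x y.
Proof. by rewrite normrM normr_sign mulr1 ger0_norm// jump_mx_ge0. Qed.

Lemma damped_mx0 w : damped_mx w q [::] = w.
Proof.
apply/funext => x; apply/funext => y; rewrite /damped_mx /killing big_nil addr0.
by rewrite divff ?mul1r// gt_eqF// jump_rate_gt0.
Qed.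

Lemma inv_mx_hadamard x y :
  - inv_mx (hadamard Q S) x y = green (fun x y => p x y * S x y) q [::] x y.
Proof.
have [S1 _ _] := signS.
rewrite /green /green_term damped_mx0 /killing big_nil addr0.
under [X in _ = rsum X]eq_fun do rewrite mulrC.
rewrite rsumZ; last first.
  apply: abs_summable_le (jump_mx_transient x y) => n.
  apply: (mxpow_dominated jump_mx_ge0 jump_mx_summable jump_mx_le1).
  exact: signed_jump_le.
have -> : (fun x y => p x y * S x y) = jump_mx (hadamard Q S).
  by apply/funext => u; apply/funext => v; rewrite jump_mx_hadamard.
by rewrite /inv_mx /rsum [hadamard Q S y y]/hadamard S1 mulr1 /q invrN mulrC mulNr.
Qed.

Lemma inv_mx_generator x y :
  - inv_mx Q x y = rsum (fun n => mxpow p n x y) / q y.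
Proof. by rewrite /inv_mx /q invrN mulrN. Qed.

End GeneratorFacts.

(** * Measurability of functionals of a trajectory *)

Section TrajectoryMeasurability.
Context {R : realType} {X : countType}.
Implicit Types w : trajectories X R.

(** Through a map to a countable type every function becomes measurable; this is applied to the
    finite prefixes of the jump chain. *)
Lemma measurable_countable_comp d (T : measurableType d) d' (T' : measurableType d')
    (C : countType) (h : T -> C) (g : C -> T') :
  (forall c, measurable (h @^-1` [set c])) -> measurable_fun setT (g \o h).
Proof.
move=> mh _ B mB; rewrite setTI.
rewrite (_ : _ @^-1` B = \bigcup_n
    [set x | unpickle n = Some (h x) /\ B (g (h x))]).
  apply: bigcupT_measurable => n.
  have [[c [nc Bc]]|nc] := pselect (exists c, unpickle n = Some c /\ B (g c)).
    rewrite (_ : [set x | _] = h @^-1` [set c])//.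
    apply/seteqP; split=> x /=; rewrite nc; first by move=> [[->]].
    by move=> ->.
  rewrite (_ : [set x | _] = set0)//.
  by apply/seteqP; split=> x //= hx; apply: nc; exists (h x).
apply/seteqP; split=> x; last by move=> [n _ []].
by move=> Bx; exists (pickle (h x)) => //=; rewrite pickleK.
Qed.

Lemma measurable_chain n z : measurable [set w : trajectories X R | chain w n = z].
Proof. by apply: sub_gen_smallest; left; exists n, z. Qed.

Lemma measurable_jump_time n :
  measurable_fun setT (fun w => jump_time w n).
Proof.
move=> _ B mB; rewrite setTI; apply: sub_gen_smallest; right.
by exists n; exists B.
Qed.

Lemma measurable_trajectoriesP d (T : measurableType d) (f : T -> trajectories X R) :
  (forall n z, measurable [set x | chain (f x) n = z]) ->
  (forall n, measurable_fun setT (fun x => jump_time (f x) n)) ->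
  measurable_fun setT f.
Proof.
move=> mc mj.
refine (@measurability _ _ T (trajectories X R) setT f (@traj_cylinders X R) erefl _).
move=> _ [_ [[n [z ->]]|[n [B mB ->]]] <-]; rewrite setTI.
  exact: mc.
by have := mj n measurableT _ mB; rewrite setTI.
Qed.

Lemma measurable_holding_time n : measurable_fun setT (fun w => holding_time w n).
Proof. by apply: emeasurable_funB; exact: measurable_jump_time. Qed.

Lemma measurable_kill_after n : measurable_fun setT (@kill_after R X n).
Proof.
apply: measurable_trajectoriesP => k.
  move=> z; rewrite /kill_after /chain /=; case: leqP => _; first exact: measurable_chain.
  have [<-|/eqP zN] := eqVneq None z.
    by rewrite (_ : [set _ | _] = setT)//; apply/seteqP; split.
  by rewrite (_ : [set _ | _] = set0)//; apply/seteqP; split.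
rewrite /kill_after /jump_time /=; case: leqP => _; first exact: measurable_jump_time.
exact: measurable_cst.
Qed.

Definition chain_prefix n w : seq (option X) := mkseq (chain w) n.

Lemma measurable_chain_prefix n s : measurable (chain_prefix n @^-1` [set s]).
Proof.
rewrite (_ : _ @^-1` _ = if size s == n then
    \bigcap_(i in [set i | (i < n)%N]) [set w : trajectories X R | chain w i = nth None s i] else set0).
  case: eqP => // _; apply: fin_bigcap_measurable; first exact: finite_II.
  by move=> i _; exact: measurable_chain.
apply/seteqP; split=> w.
  move=> /= <-; rewrite size_mkseq eqxx => i /= ni.
  by rewrite nth_mkseq.
case: eqP => // sn h /=; apply: (@eq_from_nth _ None); rewrite size_mkseq// => i ni.
by rewrite nth_mkseq//; exact: (h i).
Qed.

Lemma measurable_prefix_fun n d' (T' : measurableType d')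
    (g : seq (option X) -> T') : measurable_fun setT (fun w => g (chain_prefix n w)).
Proof. by apply: measurable_countable_comp => c; exact: measurable_chain_prefix. Qed.

Lemma eta_someP w n : Defs.eta w = Some n <->
  chain w n.+1 = None /\ forall k, (k < n)%N -> chain w k.+1 <> None.
Proof.
rewrite /Defs.eta; case: pselect => [ex|nex]; last first.
  split => // -[h _]; exfalso; apply: nex; exists n; exact/eqP.
case: ex_minnP => m /eqP m0 mmin; split.
  move=> [<-]; split => // k km /eqP /mmin; by rewrite leqNgt km.
move=> [n0 nmin]; congr Some; apply/eqP; rewrite eqn_leq mmin ?n0//=.
by rewrite leqNgt; apply/negP => /nmin; exact.
Qed.

Lemma measurable_eta n : measurable [set w : trajectories X R | Defs.eta w = Some n].
Proof.
rewrite (_ : [set w | _] = [set w : trajectories X R | chain w n.+1 = None] `&`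
    \bigcap_(k in [set k | (k < n)%N]) ~` [set w : trajectories X R | chain w k.+1 = None]).
  apply: measurableI; first exact: measurable_chain.
  apply: fin_bigcap_measurable; first exact: finite_II.
  by move=> k _; apply: measurableC; exact: measurable_chain.
by apply/seteqP; split=> w /=; rewrite eta_someP => -[h1 h2]; split.
Qed.

Lemma measurable_final_sign S : measurable_fun setT (@final_sign R X S).
Proof.
move=> _ B mB; rewrite setTI.
pose f n w := \prod_(1 <= i < n.+1) jump_sign S (chain w i.-1) (chain w i).
have mf n : measurable_fun setT (f n).
  pose g (s : seq (option X)) := \prod_(1 <= i < n.+1)
    jump_sign S (nth None s i.-1) (nth None s i).
  rewrite (_ : f n = fun w => g (chain_prefix n.+1 w)).
    exact: measurable_prefix_fun.
  apply/funext => w; apply: eq_big_nat => i /andP[i1 ni].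
  by rewrite !nth_mkseq// (leq_ltn_trans (leq_pred i)).
pose N := \bigcup_n [set w : trajectories X R | Defs.eta w = Some n].
have mN : measurable N by apply: bigcupT_measurable => n; exact: measurable_eta.
rewrite (_ : _ @^-1` B = (\bigcup_n ([set w : trajectories X R | Defs.eta w = Some n] `&` f n @^-1` B)) `|`
    (~` N `&` [set _ | B 0])).
  apply: measurableU.
    apply: bigcupT_measurable => n; apply: measurableI; first exact: measurable_eta.
    by rewrite -[X in measurable X]setTI; exact: mf.
  have [B0|B0] := pselect (B 0).
    by rewrite (_ : [set _ | _] = setT) ?setIT; [exact: measurableC|apply/seteqP; split].
  by rewrite (_ : [set _ | _] = set0) ?setI0; [exact: measurable0|apply/seteqP; split].
apply/seteqP; split=> w /=; rewrite /final_sign.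
  case E : (Defs.eta w) => [n|] Bw; first by left; exists n.
  by right; split => // -[n _ /=]; rewrite E.
move=> [[n _ [/= -> //]]|[Nw B0]].
by case E : (Defs.eta w) => [n|]//; exfalso; apply: Nw; exists n.
Qed.

Lemma final_sign_norm_le1 S w : is_sign_matrix S -> `|final_sign S w| <= 1.
Proof.
move=> [_ _ S1]; rewrite /final_sign; case: (Defs.eta w) => [n|]; last by rewrite normr0.
rewrite normr_prod; apply: Num.Theory.prodr_ile1 => i _.
rewrite normr_ge0 /= /jump_sign; case: (chain w i.-1) => [u|]; last by rewrite normr1.
case: (chain w i) => [v|]; last by rewrite normr1.
by case: (S1 u v) => ->; rewrite ?normrN normr1.
Qed.

(** The jump times of an arbitrary element of [trajectories] need not increase, so several indices
    may qualify at time t; the second clause selects the least one. *)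
Lemma state_someP w (t : R) u : state w t = Some u <->
  exists n, [/\ (jump_time w n <= t%:E < jump_time w n.+1)%E,
    forall k, (k < n)%N -> ~~ (jump_time w k <= t%:E < jump_time w k.+1)%E &
    chain w n = Some u].
Proof.
rewrite /state; case: pselect => [ex|nex]; last first.
  by split => // -[n [h _ _]]; exfalso; apply: nex; exists n.
case: ex_minnP => m h mmin; split.
  move=> cu; exists m; split => // k km; apply/negP => /mmin.
  by rewrite leqNgt km.
move=> [n [h' nmin cn]]; rewrite -cn; congr (chain w _).
apply/eqP; rewrite eqn_leq mmin//= leqNgt; apply/negP => mn.
by have := nmin m mn; rewrite h.
Qed.

(** Being in u at time s is a measurable condition on the pair (w, s); the occupation time is a
    section integral, measurable by Tonelli. *)
Lemma measurable_occupation u : measurable_fun setT (fun w => occupation w +oo%E u).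
Proof.
pose J n := [set z : trajectories X R * R |
  (jump_time z.1 n <= z.2%:E < jump_time z.1 n.+1)%E].
have mj n : measurable_fun setT (fun z : trajectories X R * R => jump_time z.1 n).
  by apply: (measurableT_comp (f := fun w => jump_time w n)) => //; exact: measurable_jump_time.
have mt : measurable_fun setT (fun z : trajectories X R * R => z.2%:E).
  by apply/measurable_EFinP.
have mJ n : measurable (J n).
  rewrite (_ : J n = (setT `&` [set z | (jump_time z.1 n <= z.2%:E)%E]) `&`
      (setT `&` [set z | (z.2%:E < jump_time z.1 n.+1)%E])).
    by apply: measurableI; [exact: measurable_lee|exact: measurable_lte].
  apply/seteqP; split=> z /=; first by move=> /andP[].
  by move=> [[_ h1] [_ h2]]; apply/andP.
pose A := [set z : trajectories X R * R | 0 <= z.2] `&` \bigcup_n (J n `&`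
   (\bigcap_(k in [set k | (k < n)%N]) ~` J k) `&`
   [set z | chain z.1 n = Some u]).
have mA : measurable A.
  apply: measurableI.
    rewrite (_ : [set _ | _] = setT `&` snd @^-1` `[0 : R, +oo[%classic).
      exact: measurable_snd.
    by rewrite setTI; apply/seteqP; split=> z /=; rewrite in_itv/= andbT.
  apply: bigcupT_measurable => n; apply: measurableI.
    apply: measurableI => //; apply: fin_bigcap_measurable; first exact: finite_II.
    by move=> k _; exact: measurableC.
  rewrite -[X in measurable X]setTI.
  exact: (@measurable_fst _ _ _ _ measurableT _ (measurable_chain n (Some u))).
have -> : (fun w => occupation w +oo%E u) =
    (fun w => \int[lebesgue_measure]_s (\1_A (w, s))%:E)%E.
  apply/funext => w; rewrite /occupation integral_mkcond; apply: eq_integral => s _.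
  rewrite patchE !indicE.
  have -> : (s \in [set s : R | (0 <= s)%R /\ (s%:E <= +oo)%E]) = (0 <= s).
    by apply/idP/idP => [/set_mem[]//|s0]; apply/mem_set; split => //; exact: leey.
  case: ifPn => s0; last by rewrite memNset// => -[/=]; rewrite (negbTE s0).
  congr (_%:R%:E); congr nat_of_bool; apply/idP/idP => /set_mem /= h; apply/mem_set.
    move/state_someP : h => [n [h1 h2 h3]]; split => //=; exists n => //.
    by split => //; split => // k /= kn; apply/negP; exact: h2.
  move: h => [_ [n _ [[h1 h2] h3]]]; apply/state_someP; exists n; split => //.
  by move=> k kn; apply/negP; exact: h2.
apply: (@measurable_fun_fubini_tonelli_F _ _ _ _ _ lebesgue_measure
  (fun z : trajectories X R * R => (\1_A z)%:E)) => //.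
by apply/measurable_EFinP; exact: measurable_indic.
Qed.

Lemma occupation_ge0 w t u : (0 <= occupation w t u)%E.
Proof. by apply: integral_ge0 => s _; rewrite lee_fin. Qed.

End TrajectoryMeasurability.

(** * A trajectory killed after a given number of jumps *)

Section KilledTrajectory.
Context {R : realType} {X : countType}.
Variables (w : trajectories X R) (n : nat) (z : nat -> X).
Hypotheses (regw : regular_traj w)
  (chainw : forall i, (i <= n)%N -> chain w i = Some (z i))
  (holdw : forall i, (i <= n)%N -> holding_time w i \is a fin_num).

Let T i : R := fine (holding_time w i).
Let s i : R := fine (jump_time w i).

Let jumpE i : (i <= n.+1)%N -> jump_time w i = (s i)%:E.
Proof.
move=> iN; rewrite /s fineK//; elim: i iN => [|i IH] iN.
  by have [-> _ _] := regw.
have := holdw iN; rewrite /holding_time => h.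
by move: h; rewrite fin_numB => /andP[].
Qed.

Let jumpS i : (i <= n)%N -> s i.+1 = s i + T i.
Proof.
move=> iN.
rewrite /T /holding_time (jumpE (iN : (i.+1 <= n.+1)%N)) (jumpE (leqW iN)) /=.
by rewrite [RHS]addrC subrK.
Qed.

Let hold_gt0 i : (i <= n)%N -> 0 < T i.
Proof.
move=> iN; have [_ h _] := regw; have := h i.
rewrite chainw// jumpE ?(leqW iN)// jumpE// lte_fin jumpS// ltrDl.
by apply.
Qed.

Let jump_mono i j : (i <= j)%N -> (j <= n.+1)%N -> s i <= s j.
Proof.
move=> ij; elim: j ij => [|j IH] ij jN; first by move: ij; rewrite leqn0 => /eqP ->.
move: ij; rewrite leq_eqVlt => /predU1P[->//|ij].
rewrite (le_trans (IH ij (ltnW jN)))// jumpS// lerDl ltW// hold_gt0//.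
Qed.

Let jump_ge0 i : (i <= n.+1)%N -> 0 <= s i.
Proof.
by move=> iN; rewrite -[0](_ : s 0%N = _) ?jump_mono// /s; have [-> _ _] := regw.
Qed.

Lemma eta_kill_after : Defs.eta (kill_after n w) = Some n.
Proof.
apply/eta_someP; split; first by rewrite /chain /= ltnn.
by move=> k kn; rewrite /chain /= kn -/(chain w k.+1) chainw.
Qed.

Lemma final_sign_kill_after S :
  final_sign S (kill_after n w) = \prod_(i < n) S (z i) (z i.+1).
Proof.
rewrite /final_sign eta_kill_after big_add1 /= big_mkord; apply: eq_bigr => i _.
rewrite /chain /= ltn_ord (ltnW (ltn_ord i)) -!/(chain w _) !chainw//.
exact: ltnW.
Qed.

Let state_kill_after t u : state (kill_after n w) t = Some u <->
  exists i, [/\ (i <= n)%N, s i <= t < s i.+1 & z i = u].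
Proof.
rewrite state_someP; split.
  move=> [m [h _]]; rewrite {1}/chain /=; case: leqP => // mn cm.
  exists m; split => //.
    move: h; rewrite /jump_time /= (leqW mn) ltnS mn -!/(jump_time w _).
    by rewrite jumpE ?(leqW mn)// jumpE.
  by apply: Some_inj; rewrite -chainw.
move=> [i [iN h zu]]; exists i; split.
- rewrite /jump_time /= (leqW iN) ltnS iN -!/(jump_time w _).
  by rewrite jumpE ?(leqW iN)// jumpE.
- move=> k ki; rewrite /jump_time /= ltnS.
  have kn : (k <= n)%N by rewrite (leq_trans (ltnW ki)).
  rewrite (leqW kn) kn -!/(jump_time w _) jumpE ?(leqW kn)// jumpE//.
  rewrite !lee_fin !lte_fin negb_and -leNgt; apply/orP; right.
  by case/andP: h => h _; rewrite (le_trans _ h)// jump_mono// leqW.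
- by rewrite /chain /= iN -/(chain w i) chainw// zu.
Qed.

Lemma occupation_kill_after u : occupation (kill_after n w) +oo%E u =
  (\sum_(i < n.+1) (z i == u)%:R * T i)%:E.
Proof.
(* The intervals between consecutive jump times are disjoint, so at most one term of the sum is
   nonzero. *)
have E t : \1_[set r : R | state (kill_after n w) r = Some u] t =
    \sum_(i < n.+1) (z i == u)%:R * \1_(`[s i, s i.+1[%classic) t.
  rewrite indicE; have [|nst] := boolP (t \in _).
    move/set_mem/state_kill_after => [i [iN h zu]].
    rewrite (bigD1 (Ordinal (iN : (i < n.+1)%N)))//= zu eqxx indicE mem_set ?mulr1/=; last first.
      by rewrite in_itv.
    rewrite big1 ?addr0// => j /eqP ji; rewrite indicE memNset ?mulr0//=.
    rewrite in_itv/= => h'; apply: ji; apply/val_inj => /=; apply/eqP.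
    have /andP[h1 h2] := h; have /andP[h3 h4] := h'.
    rewrite eqn_leq -ltnS -[X in _ && X]ltnS; apply/andP; split; rewrite ltnNge.
      apply/negP => ij; have := le_lt_trans h3 h2; rewrite ltNge jump_mono//.
      by rewrite ltnW// ltnS ltn_ord.
    apply/negP => ij; have := le_lt_trans h1 h4; rewrite ltNge jump_mono//.
    exact: leqW.
  rewrite big1//= => i _; have [zu|_] := eqVneq (z i) u; last by rewrite mul0r.
  rewrite indicE memNset ?mulr0//= in_itv/= => h.
  move/negP: nst; apply; apply/mem_set/state_kill_after.
  by exists i; split => //; rewrite -ltnS.
rewrite /occupation; under eq_integral do rewrite E -sumEFin.
have mD : measurable [set r : R | (0 <= r)%R /\ (r%:E <= +oo)%E].
  rewrite (_ : [set r | _] = `[0, +oo[%classic)//; apply/seteqP; split=> r /=.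
    by move=> [r0 _]; rewrite in_itv/= r0.
  by rewrite in_itv/= andbT => r0; split => //; exact: leey.
rewrite ge0_integral_sum//; last first.
  by move=> i; apply/measurable_EFinP; apply: measurable_funM.
rewrite -sumEFin; apply: eq_bigr => i _.
under eq_integral do rewrite EFinM.
rewrite ge0_integralZl//; last by apply/measurable_EFinP; apply: measurable_funTS; exact: measurable_indic.
rewrite EFinM; congr (_ * _)%E.
rewrite integral_indic//.
have iN : (i <= n)%N by rewrite -ltnS.
rewrite (_ : _ `&` _ = `[s i, s i.+1[%classic).
  rewrite /= lebesgue_measure_itv/= lte_fin ifT; first by rewrite -EFinB jumpS// addrC addKr.
  by rewrite jumpS// ltrDl hold_gt0.
apply/seteqP; split=> t /=; first by move=> [].
rewrite in_itv/= => h; split => //; split; last exact: leey.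
by case/andP: h => h _; rewrite (le_trans _ h)// jump_ge0// leqW.
Qed.

End KilledTrajectory.

(** * Path probabilities *)

Section CountablePartition.
Context {R : realType} {d : measure_display} {T : measurableType d}.
Variables (m : {measure set T -> \bar R}) (I : countType) (A : I -> set T).
Hypotheses (mA : forall v, measurable (A v)) (tA : trivIset setT A).

Lemma integral_countable_bigcup (f : T -> R) :
  m.-integrable (\bigcup_v A v) (EFin \o f) ->
  (\int[m]_(x in \bigcup_v A v) (f x)%:E =
   (rsum (fun v => fine (\int[m]_(x in A v) (f x)%:E)))%:E)%E.
Proof.
(* The partition is listed as a sequence, padded with empty sets, to use countable additivity over
   the integers. *)
pose F n := if pickle_inv n is Some v then A v else set0.
have mF n : measurable (F n) by rewrite /F; case: (pickle_inv n).
have tF : trivIset setT F.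
  move=> i j _ _ [x []]; rewrite /F; case Ei : (pickle_inv i) => [u|]//.
  case Ej : (pickle_inv j) => [v|]// Aux Avx.
  have uv : u = v by apply: tA => //; exists x.
  by have := @pickle_invK I i; have := @pickle_invK I j; rewrite Ei Ej uv /= => -> ->.
have FE : \bigcup_v A v = \bigcup_n F n.
  apply/seteqP; split=> x.
    by move=> [v _ Avx]; exists (pickle v) => //; rewrite /F pickleK_inv.
  by move=> [n _]; rewrite /F; case: (pickle_inv n) => // v Avx; exists v.
rewrite FE => fi; rewrite integral_bigcup//.
have sF := integrable_summable tF mF fi.
have E n : (\int[m]_(x in F n) (f x)%:E =
    (enum_fun (fun v => fine (\int[m]_(x in A v) (f x)%:E)) n)%:E)%E.
  rewrite /enum_fun -[LHS]fineK; last first.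
    apply: integrable_fin_num => //; apply: (integrableS _ _ _ fi) => //.
      exact: bigcupT_measurable.
    exact: bigcup_sup.
  rewrite /F; case: (pickle_inv n) => [v|]//.
  by rewrite integral_set0.
have sE : summable [set: nat] (EFin \o enum_fun (fun v => fine (\int[m]_(x in A v) (f x)%:E))).
  by move: sF; congr (summable _ _ ); apply/funext => n /=; rewrite E.
have ss : abs_summable (fun v => fine (\int[m]_(x in A v) (f x)%:E)).
  rewrite /abs_summable; apply/integrableP; split => //.
  by rewrite ge0_integral_count// nneseries_esumT.
rewrite -rsumE// csum_integral integral_count//.
by apply: eq_eseriesr => n _; rewrite E.
Qed.

End CountablePartition.

Section PathFormula.
Context {R : realType} {X : countType}.
Variables (Q : X -> X -> R).
Hypothesis genQ : is_generator Q.
Context {d : measure_display} {T : measurableType d}.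
Variables (P : X -> probability T R) (W : {mfun T >-> trajectories X R}).
Hypothesis mkv : is_markov_process Q P W.
Variables (y : X) (kill : bool).

Let p := jump_mx Q.
Let q x := - Q x x.
Let hold i w : R := fine (holding_time (W w) i).

(* [kill] tells which of the two readings of [killed_from_law] applies: the path
   jumps to the cemetery right after time [n], or its continuation is ignored. *)
Definition kill_prob (u : X) : R := if kill then escape p u else 1.

Lemma measurable_chain_process n z : measurable [set w | chain (W w) n = z].
Proof.
have mW : measurable_fun setT W by [].
by have := mW measurableT _ (measurable_chain n z); rewrite setTI.
Qed.

Lemma measurable_hold_process i : measurable_fun setT (fun w => holding_time (W w) i).
Proof.
by apply: (measurableT_comp (f := fun w => holding_time w i)) => //; exact: measurable_holding_time.
Qed.

Lemma measurable_hold i : measurable_fun setT (hold i).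
Proof. by apply: (measurableT_comp (f := fine)) => //; exact: measurable_hold_process. Qed.

Definition path_event n (z : nat -> X) : set T :=
  [set w | (forall i, (i <= n)%N -> chain (W w) i = Some (z i)) /\
           (kill -> chain (W w) n.+1 = None)].

(** Finiteness is part of the event: the law of the holding times is given on images under [EFin],
    whereas [fine] would send an infinite time to 0. *)
Definition cylinder n (z : nat -> X) (B : nat -> set R) : set T :=
  [set w | path_event n z w /\ forall i, (i <= n)%N ->
     holding_time (W w) i \is a fin_num /\ B i (hold i w)].

Lemma measurable_path_event n z : measurable (path_event n z).
Proof.
rewrite (_ : path_event n z =
    (\bigcap_(i in [set i | (i < n.+1)%N]) [set w | chain (W w) i = Some (z i)]) `&`
    (if kill then [set w | chain (W w) n.+1 = None] else setT)).
  apply: measurableI; last by case: kill => //; exact: measurable_chain_process.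
  apply: fin_bigcap_measurable; first exact: finite_II.
  by move=> i _; exact: measurable_chain_process.
rewrite /path_event; apply/seteqP; split=> w /=.
  by move=> [h1 h2]; split => //; case: kill h2 => //= h2; exact: h2.
by move=> [h1 h2]; split => // k; move: h2; rewrite k.
Qed.

Lemma measurable_cylinder n z B : (forall i, measurable (B i)) ->
  measurable (cylinder n z B).
Proof.
move=> mB.
rewrite (_ : cylinder n z B = path_event n z `&`
    \bigcap_(i in [set i | (i < n.+1)%N])
      ((fun w => holding_time (W w) i) @^-1` [set x | x \is a fin_num] `&` hold i @^-1` B i)).
  apply: measurableI; first exact: measurable_path_event.
  apply: fin_bigcap_measurable; first exact: finite_II.
  move=> i _; apply: measurableI.
    have := emeasurable_fin_num measurableT (measurable_hold_process i).
    by rewrite setTI.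
  by rewrite -[X in measurable X]setTI; exact: measurable_hold.
by apply/seteqP; split=> w [h1 h2]; split => // i ni; exact: h2.
Qed.

Let EFin_imageP (B : set R) (h : \bar R) :
  (EFin @` B) h <-> h \is a fin_num /\ B (fine h).
Proof.
split; first by move=> [r Br <-].
by move=> [hf Bh]; exists (fine h) => //; rewrite fineK.
Qed.

Lemma path_event_prob x n z : P x (path_event n z) =
  ((z 0%N == x)%:R * \prod_(i < n) p (z i) (z i.+1) * kill_prob (z n))%:E.
Proof.
have [_ c2 _] := mkv; rewrite /path_event /kill_prob.
case: kill.
  (* A killed path is a prefix with one more state, the cemetery, whose transition probability is
     the escape probability of z n. *)
  have := c2 x n.+1 (fun i => if (i <= n)%N then Some (z i) else None).
  rewrite leq0n big_ord_recr /= leqnn ltnn mulrA => h.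
  rewrite (_ : [set w | _] = [set w | forall i, (i <= n.+1)%N ->
    chain (W w) i = (if (i <= n)%N then Some (z i) else None)]).
    rewrite h; congr ((_ * _ * _)%:E).
    by apply: eq_bigr => i _; rewrite ltn_ord (ltnW (ltn_ord i)).
  apply/seteqP; split=> w /=.
    move=> [h1 h2] i; rewrite leq_eqVlt => /predU1P[->|]; first by rewrite ltnn h2.
    by rewrite ltnS => iN; rewrite iN h1.
  move=> h1; split; last by move=> _; have := h1 n.+1 (leqnn _); rewrite ltnn.
  by move=> i iN; have := h1 i (leqW iN); rewrite iN.
have := c2 x n (fun i => Some (z i)); rewrite mulr1 => <-.
congr (P x _); apply/seteqP; split=> w /=; first by move=> [].
by move=> h; split.
Qed.

Lemma cylinder_prob x n z B : (forall i, measurable (B i)) ->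
  P x (cylinder n z B) = (P x (path_event n z) *
    \prod_(i < n.+1) exponential_prob (q (z i)) (B i))%E.
Proof.
move=> mB; have [_ _ c3] := mkv; rewrite /cylinder /path_event.
case: kill.
  have := c3 x n.+1 (fun i => if (i <= n)%N then Some (z i) else None) B mB.
  rewrite big_ord_recr /= ltnn mule1 => h.
  rewrite [X in P x X = _](_ : _ = [set w | forall i, (i <= n.+1)%N ->
     chain (W w) i = (if (i <= n)%N then Some (z i) else None) /\
     ((if (i <= n)%N then Some (z i) else None) <> None ->
       (EFin @` B i) (holding_time (W w) i))]).
    rewrite h; congr (P x _ * _)%E.
      apply/seteqP; split=> w /=.
        move=> h1; split; last by move=> _; have := h1 n.+1 (leqnn _); rewrite ltnn.
        by move=> i iN; have := h1 i (leqW iN); rewrite iN.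
      move=> [h1 h2] i; rewrite leq_eqVlt => /predU1P[->|]; first by rewrite ltnn h2.
      by rewrite ltnS => iN; rewrite iN h1.
    by apply: eq_bigr => i _; rewrite -ltnS ltn_ord.
  apply/seteqP; split=> w /=.
    move=> [[h1 h2] h3] i; rewrite leq_eqVlt => /predU1P[->|]; first by rewrite ltnn h2.
    rewrite ltnS => iN; rewrite iN h1//; split => // _.
    by apply/EFin_imageP; exact: h3.
  move=> h1; split.
    split; last by move=> _; have := h1 n.+1 (leqnn _); rewrite ltnn => -[].
    by move=> i iN; have := h1 i (leqW iN); rewrite iN => -[].
  move=> i iN; have := h1 i (leqW iN); rewrite iN => -[_ hB].
  by apply/EFin_imageP; exact: hB.
have := c3 x n (fun i => Some (z i)) B mB.
rewrite [X in P x X = _ -> _](_ : _ = [set w | ((forall i, (i <= n)%N ->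
    chain (W w) i = Some (z i)) /\ (false -> chain (W w) n.+1 = None)) /\
    forall i, (i <= n)%N -> holding_time (W w) i \is a fin_num /\ B i (hold i w)]).
  move=> ->; congr (P x _ * _)%E; apply/seteqP; split=> w /=; last by move=> [].
  by move=> h; split.
apply/seteqP; split=> w /=.
  move=> h; split; first by split => // i /h[].
  by move=> i /h[_ h1]; apply/EFin_imageP; exact: h1.
move=> [[h1 _] h2] i iN; split; first exact: h1.
by move=> _; apply/EFin_imageP; exact: h2.
Qed.

End PathFormula.

(** * Exponential damping of holding times *)

Section ExponentialWeights.
Context {R : realType}.
Implicit Types (q k : R).
Notation leb := (@lebesgue_measure R).

(** The absolute value keeps the damping bounded on the whole line; it has no effect on holding
    times, which are nonnegative. *)
Lemma bounded_measurable_expR_norm k : 0 <= k ->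
  bounded_measurable (fun t : R => expR (- (k * `|t|))).
Proof.
move=> k0; split.
  apply: (measurableT_comp (f := expR)) => //; apply: measurableT_comp => //.
  exact: measurable_funM.
exists 1 => t; rewrite ger0_norm ?expR_ge0// -expR0 ler_expR oppr_le0.
exact: mulr_ge0.
Qed.

Lemma integral_exponential_damped q k : 0 < q -> 0 <= k ->
  (\int[leb]_x (exponential_pdf q x * expR (- (k * `|x|)))%:E = (q / (q + k))%:E)%E.
Proof.
move=> q0 k0; have qk0 : 0 < q + k by lra.
have E x : exponential_pdf q x * expR (- (k * `|x|)) = q / (q + k) * exponential_pdf (q + k) x.
  have [x0|x0] := ltP x 0; first by rewrite !lt0_exponential_pdf// mul0r mulr0.
  rewrite !exponential_pdfE// ger0_norm// -mulrA -expRD mulrA divfK ?gt_eqF//.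
  by congr (q * expR _); ring.
under eq_integral do rewrite E EFinM.
rewrite integralZl//; last exact: integrable_exponential_pdf.
by rewrite integral_exponential_pdf// mule1.
Qed.

Lemma fin_exponential_prob q B : 0 < q -> measurable B ->
  exponential_prob q B = (fine (exponential_prob q B))%:E.
Proof.
move=> q0 mB; rewrite fineK// integrable_fin_num//.
by apply: (integrableS _ _ _ (integrable_exponential_pdf q0)).
Qed.

Lemma exponential_prob_setT q : 0 < q -> exponential_prob q [set: R] = 1%E.
Proof. exact: integral_exponential_pdf. Qed.

(** Independence is known only through indicators of one holding time against a weight [w] that
    carries all the others. Monotone classes replace the indicator by the damping, which contributes
    q / (q + k), the Laplace transform of the exponential law. *)
Lemma weighted_exponential d (T : measurableType d) (m : {finite_measure set T -> \bar R})
    (w phi : T -> R) (M q k : R) : 0 < q -> 0 <= k ->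
  bounded_measurable w -> measurable_fun setT phi ->
  (forall C, measurable C ->
    \int[m]_x (w x * \1_C (phi x))%:E = (M * fine (exponential_prob q C))%:E)%E ->
  (\int[m]_x (w x * expR (- (k * `|phi x|)))%:E = (M * (q / (q + k)))%:E)%E.
Proof.
move=> q0 k0 bw mphi H.
have ie := integrable_exponential_pdf q0.
have iw2 : leb.-integrable setT (EFin \o (fun t => M * exponential_pdf q t)).
  exact: (integrableZl measurableT M ie).
have C2 C : measurable C -> (\int[leb]_t (M * exponential_pdf q t * \1_C t)%:E =
    (M * fine (exponential_prob q C))%:E)%E.
  move=> mC; rewrite integral_indicM//.
  under eq_integral do rewrite EFinM.
  by rewrite integralZl// ?EFinM -?fin_exponential_prob//; apply: (integrableS _ _ _ ie).
have W C : measurable C -> weighted_eq m leb phi id w (fun t => M * exponential_pdf q t) (\1_C).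
  by move=> mC; rewrite /weighted_eq H// C2.
have := @weighted_eq_bounded _ _ _ _ _ _ _ m leb phi id w (fun t => M * exponential_pdf q t)
  mphi (@measurable_id _ _ _) (bounded_integrable m bw) iw2 measurable.
move=> /(_ _ _ _ W _ (bounded_measurable_expR_norm k0)) => -> //.
- under eq_integral do rewrite -mulrA EFinM.
  rewrite integralZl// ?integral_exponential_damped//.
  by apply: (le_integrable measurableT _ _ ie) => //; [
    apply/measurable_EFinP; apply: measurable_funM;
      [exact: measurable_exponential_pdf|by have [] := bounded_measurable_expR_norm k0]
  | move=> t _ /=; rewrite lee_fin normrM ler_piMr// ger0_norm ?expR_ge0//;
    rewrite -expR0 ler_expR oppr_le0 mulr_ge0].
- by rewrite smallest_id//; exact: sigma_algebra_measurable.
- by move=> A B mA mB; exact: measurableI.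
- by have := W setT measurableT; rewrite (_ : \1_setT = cst 1)//; apply/funext => x; rewrite indicT.
Qed.

End ExponentialWeights.

Section PathWeight.
Context {R : realType} {X : countType}.
Implicit Types (L : seq (X * R)) (w : trajectories X R).

Definition occupation_field w : fields X R := fun u => fine (occupation w +oo%E u).

Lemma measurable_occupation_field : measurable_fun setT occupation_field.
Proof.
apply/measurable_fieldsP => u.
by apply: (measurableT_comp (f := fine)) => //; exact: measurable_occupation.
Qed.

Lemma occupation_field_ge0 w u : 0 <= occupation_field w u.
Proof. by rewrite /occupation_field fine_ge0// occupation_ge0. Qed.

Definition path_weight (S : X -> X -> R) L w : R :=
  final_sign S w * laplace L (occupation_field w).

Lemma bounded_measurable_path_weight S L : is_sign_matrix S -> nonneg_weights L ->
  bounded_measurable (path_weight S L).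
Proof.
move=> sS L0; split.
  apply: measurable_funM; first exact: measurable_final_sign.
  exact: (measurableT_comp (measurable_laplace L) measurable_occupation_field).
exists 1 => w; rewrite normrM mulr_ile1//; first exact: final_sign_norm_le1.
rewrite ger0_norm ?laplace_le1 ?(ltW (laplace_gt0 _ _))// => u.
exact: occupation_field_ge0.
Qed.

(** The sum over [L] is exchanged with the sum over the visits, so that each holding time collects
    the total rate at its state. *)
Lemma path_weight_kill_after S L w n (z : nat -> X) :
  regular_traj w -> (forall i, (i <= n)%N -> chain w i = Some (z i)) ->
  (forall i, (i <= n)%N -> holding_time w i \is a fin_num) ->
  path_weight S L (kill_after n w) = \prod_(i < n) S (z i) (z i.+1) *
    \prod_(i < n.+1) expR (- (killing L (z i) * `|fine (holding_time w i)|)).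
Proof.
move=> rw cw hw; rewrite /path_weight (final_sign_kill_after cw); congr (_ * _).
rewrite -expR_sum /laplace; congr expR; rewrite sumrN; congr (- _).
have h0 i : (i <= n)%N -> 0 <= fine (holding_time w i).
  move=> iN; rewrite fine_ge0// /holding_time.
  have [_ h _] := rw; have := h i; rewrite cw// => lt.
  have := hw i iN; rewrite /holding_time fin_numB => /andP[f1 f2].
  by rewrite sube_ge0 ?f2//; apply: ltW; exact: lt.
transitivity (\sum_(i < n.+1) \sum_(a <- L) a.2 * ((z i == a.1)%:R * fine (holding_time w i))).
  rewrite exchange_big /=; apply: eq_bigr => a _.
  by rewrite /occupation_field (occupation_kill_after rw cw hw) /= mulr_sumr.
apply: eq_bigr => i _; rewrite ger0_norm ?h0 -1?ltnS// /killing mulr_suml big_mkcond /=.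
rewrite [RHS]big_mkcond /=; apply: eq_bigr => a _.
by rewrite eq_sym; case: eqP; rewrite ?mul1r ?mul0r ?mulr0.
Qed.

End PathWeight.

(** * Weight of a single path of the jump chain *)

Section PathIntegral.
Context {R : realType} {X : countType}.
Variables (Q S : X -> X -> R).
Hypotheses (genQ : is_generator Q) (signS : is_sign_matrix S).
Context {d : measure_display} {T : measurableType d}.
Variables (P : X -> probability T R) (W : {mfun T >-> trajectories X R}).
Hypothesis mkv : is_markov_process Q P W.
Variables (L : seq (X * R)) (kill : bool).
Hypothesis L0 : nonneg_weights L.

Let q x := - Q x x.
Let p := jump_mx Q.
Let hold i w : R := fine (holding_time (W w) i).
Let damped := damped_mx (fun x y => p x y * S x y) q L.

Let q_gt0 x : 0 < q x. Proof. exact: jump_rate_gt0. Qed.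

Lemma bounded_measurable_indic_cylinder n z B : (forall i, measurable (B i)) ->
  bounded_measurable (\1_(cylinder W kill n z B) : T -> R).
Proof. by move=> mB; apply: bounded_measurable_indic; exact: measurable_cylinder. Qed.

Let bounded_damping k (K : nat -> R) : (forall i, 0 <= K i) ->
  bounded_measurable (fun w => \prod_(i < k) expR (- (K i * `|hold i w|))).
Proof.
move=> K0; elim: k => [|k IH].
  by under eq_fun do rewrite big_ord0; exact: bounded_measurable_cst.
under eq_fun do rewrite big_ord_recr /=.
apply: bounded_measurableM => //.
have [m1 [M h]] := bounded_measurable_expR_norm (K0 k).
split; last by exists M => w; exact: h.
exact: (measurableT_comp m1 (measurable_hold W k)).
Qed.

(** Interpolates between indicators and damping: the first k holding times are damped, the others
    still restricted to sets. The induction converts one holding time at a time. *)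
Let cylinder_weighted x n z k (B : nat -> set R) : (k <= n.+1)%N ->
  (forall i, measurable (B i)) ->
  (\int[P x]_w (\1_(cylinder W kill n z (fun i => if (i < k)%N then setT else B i)) w *
       \prod_(i < k) expR (- (killing L (z i) * `|hold i w|)))%:E =
   (fine (P x (path_event W kill n z)) *
     \prod_(i < n.+1) (if (i < k)%N then q (z i) / (q (z i) + killing L (z i))
                       else fine (exponential_prob (q (z i)) (B i))))%:E)%E.
Proof.
elim: k B => [|k IH] B kN mB.
  under eq_integral do rewrite big_ord0 mulr1.
  rewrite integral_indic//; last exact: measurable_cylinder.
  rewrite setIT; apply: etrans (cylinder_prob mkv kill x n z mB) _.
  rewrite EFinM fineK ?fin_num_measure//; last exact: measurable_path_event.
  rewrite -prodEFin; congr (_ * _)%E; apply: eq_bigr => i _.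
  exact: fin_exponential_prob (q_gt0 _) (mB _).
under eq_integral do rewrite big_ord_recr /= mulrA.
pose i0 := Ordinal kN.
have mif j C : (forall i : nat, measurable (C i : set R)) ->
    forall i, measurable (if (i < j)%N then setT else C i).
  by move=> mC i; case: ifP.
pose M := fine (P x (path_event W kill n z)) *
  \prod_(i < n.+1 | i != i0) (if (i < k)%N then q (z i) / (q (z i) + killing L (z i))
                       else fine (exponential_prob (q (z i)) (B i))).
rewrite (@weighted_exponential _ _ _ _ _ _ M (q (z k)))//.
- rewrite /M -mulrA; congr (_ * _)%:E; rewrite [RHS](bigD1 i0)//= ltnSn mulrC.
  congr (_ * _); apply: eq_bigr => i ii0.
  by rewrite ltnS [(i <= k)%N]leq_eqVlt (negbTE (ii0 : i != k :> nat)).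
- exact: killing_ge0.
- apply: bounded_measurableM; last by apply: (bounded_damping _ (K := fun i => killing L (z i))) => i; exact: killing_ge0.
  by apply: bounded_measurable_indic_cylinder; exact: (mif k.+1 B mB).
- exact: measurable_hold.
(* The indicator of [C] for the k-th holding time is absorbed into the cylinder, which brings back
   the induction hypothesis. *)
move=> C mC; pose B' i := if i == k then C else B i.
have mB' i : measurable (B' i) by rewrite /B'; case: ifP.
transitivity (\int[P x]_w (\1_(cylinder W kill n z (fun i => if (i < k)%N then setT else B' i)) w *
       \prod_(i < k) expR (- (killing L (z i) * `|hold i w|)))%:E)%E.
  apply: eq_integral => w _; rewrite mulrAC; congr ((_ * _)%:E).
  rewrite -[LHS]/((\1_ _ \* (\1_(hold k @^-1` C)))%R w) -indicI.
  congr (\1_ _ w); apply/seteqP; split=> t /=.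
    move=> [[h1 h2] Ct]; split => // i iN; have [h3 h4] := h2 i iN; split => //.
    move: h4; rewrite /B' ltnS [(i <= k)%N]leq_eqVlt.
    by have [-> _|ik] := eqVneq i k; [rewrite ltnn|].
  move=> [h1 h2]; split.
    split => // i iN; have [h3 h4] := h2 i iN; split => //.
    move: h4; rewrite /B' ltnS [(i <= k)%N]leq_eqVlt.
    by case: (eqVneq i k) => [_|_]; case: ifP.
  by have [_] := h2 k kN; rewrite /B' ltnn eqxx.
rewrite IH//; last exact: ltnW.
rewrite /M -mulrA; congr (_ * _)%:E; rewrite (bigD1 i0)//= ltnn /B' eqxx mulrC.
congr (_ * _); apply: eq_bigr => i ii0.
by rewrite (negbTE (ii0 : i != k :> nat)).
Qed.

Lemma path_event_integral x n z :
  (\int[P x]_(w in path_event W kill n z) (path_weight S L (kill_after n (W w)))%:E =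
   ((z 0%N == x)%:R * \prod_(i < n) damped (z i) (z i.+1) *
    (kill_prob Q kill (z n) * (q (z n) / (q (z n) + killing L (z n)))))%:E)%E.
Proof.
have [regW _ _] := mkv.
set E := path_event _ _ _ _; pose C := cylinder W kill n z (fun=> setT).
have mE : measurable E by exact: measurable_path_event.
have mC : measurable C by exact: measurable_cylinder.
have CE : C `<=` E by move=> w [].
(* The holding times along the path are almost surely finite, because the exponential laws have
   total mass 1. *)
have PC : P x C = P x E.
  rewrite /C (cylinder_prob mkv)// big1 ?mule1// => i _.
  exact: exponential_prob_setT (q_gt0 _).
have nullD : P x (E `\` C) = 0%E.
  rewrite measureD// ?ltey_eq ?fin_num_measure// setIidr//.
  by change (P x E - P x C = 0)%E; rewrite PC subee// fin_num_measure.
have bW : bounded_measurable (fun w => path_weight S L (kill_after n (W w))).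
  have [m1 [M h]] := bounded_measurable_path_weight signS L0.
  split; last by exists M => w; exact: h.
  exact: (measurableT_comp m1 (measurableT_comp (measurable_kill_after n) _)).
rewrite (negligible_integral _ mE _ nullD); last 2 first.
- exact: measurableD.
- by apply: (integrableS measurableT) => //; exact: (bounded_integrable (P x) bW).
rewrite setDD setIidr// -integral_indicM//.
transitivity ((\prod_(i < n) S (z i) (z i.+1))%:E * \int[P x]_w (\1_C w *
    \prod_(i < n.+1) expR (- (killing L (z i) * `|hold i w|)))%:E)%E.
  rewrite -integralZl//; last first.
    apply: bounded_integrable; apply: bounded_measurableM.
      exact: bounded_measurable_indic.
    by apply: (bounded_damping _ (K := fun i => killing L (z i))) => i; exact: killing_ge0.
  apply: eq_integral => w _; rewrite -EFinM mulrCA; congr EFin.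
  rewrite indicE; have [/set_mem [[h1 h2] h3]|] := boolP (w \in C); last first.
    by rewrite mulr0 mul0r.
  rewrite mulr1 mul1r (path_weight_kill_after S L (regW w) h1)// => i iN.
  by have [] := h3 i iN.
have -> : C = cylinder W kill n z (fun i => if (i < n.+1)%N then setT else setT).
  by congr cylinder; apply/funext => i; case: ifP.
rewrite (@cylinder_weighted x n z n.+1 (fun=> setT))// -EFinM; congr EFin.
rewrite /E (path_event_prob mkv) /=.
rewrite (eq_bigr (fun i : 'I_n.+1 => q (z i) / (q (z i) + killing L (z i)))); last first.
  by move=> i _; rewrite ltn_ord.
rewrite big_ord_recr /=.
have -> : \prod_(i < n) damped (z i) (z i.+1) = \prod_(i < n) S (z i) (z i.+1) *
    \prod_(i < n) jump_mx Q (z i) (z i.+1) *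
    \prod_(i < n) (q (z i) / (q (z i) + killing L (z i))).
  by rewrite -!big_split /=; apply: eq_bigr => i _; rewrite /damped /damped_mx /p; ring.
by ring.
Qed.

End PathIntegral.

(** * Sum over the paths to a given last state *)

Section LastVisit.
Context {R : realType} {X : countType}.
Variables (Q S : X -> X -> R).
Hypotheses (genQ : is_generator Q) (signS : is_sign_matrix S).
Context {d : measure_display} {T : measurableType d}.
Variables (P : X -> probability T R) (W : {mfun T >-> trajectories X R}).
Hypothesis mkv : is_markov_process Q P W.
Variables (y : X) (kill : bool).

Let q x := - Q x x.
Let p := jump_mx Q.

(** [regular_traj] does not force the chain to stay in the cemetery; the transition probabilities
    exclude leaving it only up to a null set. *)
Definition revival : set T :=
  [set w | exists i, chain (W w) i = None /\ chain (W w) i.+1 <> None].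

Lemma measurable_revival : measurable revival.
Proof.
rewrite (_ : revival = \bigcup_i ([set w | chain (W w) i = None] `\`
   [set w | chain (W w) i.+1 = None])).
  by apply: bigcup_measurable => i _; apply: measurableD; exact: measurable_chain_process.
apply/seteqP; split=> w; first by move=> [i [h1 h2]]; exists i.
by move=> [i _ [h1 h2]]; exists i.
Qed.

Lemma revival_null x : P x revival = 0%E.
Proof.
have [_ c2 _] := mkv.
(* Revivals are covered by the countably many finite prefixes containing one; each has probability 0
   by the zero factor for leaving the cemetery. *)
pose F n := if @unpickle (seq (option X)) n is Some s then
    if has (fun i => (nth None s i == None) && (nth None s i.+1 != None)) (iota 0 (size s).-1)
    then [set w | forall i, (i <= (size s).-1)%N -> chain (W w) i = nth None s i] else set0
  else set0.
have Fneg n : (P x).-negligible (F n).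
  rewrite /F; case: unpickle => [s|]; last exact: negligible_set0.
  case: ifPn => [/hasP[i]|_]; last exact: negligible_set0.
  rewrite mem_iota add0n /= => iN /andP[/eqP h1 h2].
  exists [set w | forall i, (i <= (size s).-1)%N -> chain (W w) i = nth None s i]; split => //.
    rewrite (_ : [set w | _] = \bigcap_(i in [set i | (i < (size s).-1.+1)%N])
       [set w | chain (W w) i = nth None s i]) //.
    apply: fin_bigcap_measurable; first exact: finite_II.
    by move=> j _; exact: measurable_chain_process.
  apply: etrans (c2 x (size s).-1 (nth None s)) _; congr EFin.
  rewrite (bigD1 (Ordinal iN))//= h1.
  by case: (nth None s i.+1) h2 => //= a _; rewrite mul0r mulr0.
apply/(negligibleP (P x) measurable_revival).
apply: negligibleS (negligible_bigcup Fneg) => w [i [h1 h2]].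
exists (pickle (mkseq (chain (W w)) i.+2)) => //.
rewrite /F pickleK size_mkseq ifT; first by move=> j jN; rewrite nth_mkseq.
apply/hasP; exists i; first by rewrite mem_iota add0n /=.
by rewrite !nth_mkseq// h1 eqxx; apply/eqP.
Qed.

Lemma chain_dead w j m : ~ revival w -> chain (W w) j = None -> chain (W w) (j + m) = None.
Proof.
move=> nr h; elim: m => [|m IH]; first by rewrite addn0.
rewrite addnS; have [//|h'] := pselect (chain (W w) (j + m).+1 = None).
by case: nr; exists (j + m)%N.
Qed.

(** The path is prescribed up to time k and free during m further steps, after which it is at y. *)
Definition visit_event k m (z : nat -> X) : set T :=
  [set w | (forall i, (i <= k)%N -> chain (W w) i = Some (z i)) /\
           chain (W w) (k + m) = Some y /\ (kill -> chain (W w) (k + m).+1 = None)].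

Definition last_visit n : set T :=
  [set w | chain (W w) n = Some y /\ (kill -> chain (W w) n.+1 = None)].

Lemma measurable_last_visit n : measurable (last_visit n).
Proof.
rewrite (_ : last_visit n = [set w | chain (W w) n = Some y] `&`
    (if kill then [set w | chain (W w) n.+1 = None] else setT)).
  apply: measurableI; first exact: measurable_chain_process.
  by case: kill => //; exact: measurable_chain_process.
rewrite /last_visit; apply/seteqP; split=> w /=.
  by move=> [h1 h2]; split => //; case: kill h2 => //= h2; exact: h2.
by move=> [h1 h2]; split => // k; move: h2; rewrite k.
Qed.

Lemma measurable_visit_event k m z : measurable (visit_event k m z).
Proof.
rewrite (_ : visit_event k m z = path_event W false k z `&` last_visit (k + m)).
  by apply: measurableI; [exact: measurable_path_event|exact: measurable_last_visit].
apply/seteqP; split=> w; last by move=> [[h1 _] h2].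
by move=> [h1 h2]; split => //; split.
Qed.

Variable L : seq (X * R).
Hypothesis L0 : nonneg_weights L.

Let damped := damped_mx (fun x y => p x y * S x y) q L.

Let bounded_weight n : bounded_measurable (fun w => path_weight S L (kill_after n (W w))).
Proof.
have [m1 [M h]] := bounded_measurable_path_weight signS L0.
split; last by exists M => w; exact: h.
exact: (measurableT_comp m1 (measurableT_comp (measurable_kill_after n) _)).
Qed.

Let integrable_weight x n A : measurable A ->
  (P x).-integrable A (EFin \o (fun w => path_weight S L (kill_after n (W w)))).
Proof.
by move=> mA; apply: (integrableS measurableT) => //; exact: (bounded_integrable (P x)).
Qed.

(** Induction on the number m of free steps: the event splits according to the state at time k + 1,
    and summing over that state produces one more factor of the matrix power. *)
Lemma visit_event_integral x m k z :
  (\int[P x]_(w in visit_event k m z) (path_weight S L (kill_after (k + m) (W w)))%:E =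
   ((z 0%N == x)%:R * \prod_(i < k) damped (z i) (z i.+1) *
    (kill_prob Q kill y * (q y / (q y + killing L y)) * mxpow damped m (z k) y))%:E)%E.
Proof.
elim: m k z => [|m IH] k z.
  rewrite addn0 /=; have [zy|zy] := eqVneq (z k) y; last first.
    rewrite (_ : visit_event k 0 z = set0) ?integral_set0 ?mulr0//.
    apply/seteqP; split=> w //= [h1 [h2 _]].
    by move: h2; rewrite addn0 h1// => -[] /eqP; rewrite (negbTE zy).
  rewrite mulr1 -zy -(path_event_integral genQ signS mkv)//; congr integral.
  apply/seteqP; split=> w; first by move=> [h1 [_ h2]]; split => //; rewrite addn0 in h2.
  by move=> [h1 h2]; split => //; rewrite addn0 h1// zy.
pose zv v i := if i == k.+1 then v else z i.
pose A v := visit_event k.+1 m (zv v).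
have mA v : measurable (A v) by exact: measurable_visit_event.
have mE : measurable (visit_event k m.+1 z) by exact: measurable_visit_event.
have mU : measurable (\bigcup_v A v).
  exact: countable_bigcupT_measurable.
have zvE v i : (i <= k)%N -> zv v i = z i by move=> ik; rewrite /zv ltn_eqF.
have zvk v : zv v k.+1 = v by rewrite /zv eqxx.
have UE : \bigcup_v A v `<=` visit_event k m.+1 z.
  move=> w [v _ [h1 [h2 h3]]]; split; last by rewrite -addSnnS.
  by move=> i ik; rewrite h1 ?zvE// leqW.
(* The chain can be in the cemetery at time k + 1 and at y later only if it revives. *)
have null : P x (visit_event k m.+1 z `\` \bigcup_v A v) = 0%E.
  apply/(negligibleP (P x) (measurableD mE mU)).
  apply: (@negligibleS _ _ _ (P x) revival); last first.
    exact/(negligibleP (P x) measurable_revival)/revival_null.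
  move=> w [[h1 [h2 h3]] h4]; apply: contrapT => nr; apply: h4.
  case E : (chain (W w) k.+1) => [v|]; last first.
    by move: (chain_dead m nr E); rewrite addSnnS h2.
  exists v => //; split; last by rewrite addSnnS.
  move=> i; rewrite leq_eqVlt => /predU1P[->|]; first by rewrite zvk.
  by rewrite ltnS => ik; rewrite h1// zvE.
rewrite (negligible_integral (measurableD mE mU) mE _ null); last exact: integrable_weight.
rewrite setDD setIidr// integral_countable_bigcup//; last 2 first.
- move=> u v _ _ [w [[h1 _] [h2 _]]].
  by move: (h1 _ (leqnn _)); rewrite (h2 _ (leqnn _)) !zvk => -[].
- exact: integrable_weight.
set c := kill_prob Q kill y * _; congr EFin.
rewrite (_ : (fun v => _) = (fun v => ((z 0%N == x)%:R * \prod_(i < k) damped (z i) (z i.+1) * c) *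
    (damped (z k) v * mxpow damped m v y))); last first.
  apply/funext => v; rewrite -addSnnS IH /= zvk zvE// big_ord_recr /= zvE// zvk.
  rewrite (eq_bigr (fun i : 'I_k => damped (z i) (z i.+1))); last first.
    by move=> i _; rewrite !zvE//; exact: ltnW.
  by rewrite -/c; ring.
rewrite rsumZ; last first.
  apply: (abs_summable_mxpow (p := p)) => //.
  - by move=> u v; exact: jump_mx_ge0.
  - by move=> u; exact: jump_mx_summable.
  - by move=> u; exact: jump_mx_le1.
  - move=> u v; apply: damped_mx_le => //.
    + by move=> u'; exact: jump_rate_gt0.
    + by move=> u' v'; apply: signed_jump_le.
by rewrite mxpowS; ring.
Qed.

Lemma last_visit_integral x n :
  (\int[P x]_(w in last_visit n) (path_weight S L (kill_after n (W w)))%:E =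
   (kill_prob Q kill y * (q y / (q y + killing L y)) * mxpow damped n x y)%:E)%E.
Proof.
have [_ c2 _] := mkv.
have VE : visit_event 0 n (fun=> x) `<=` last_visit n by move=> w [_].
have mV := measurable_visit_event 0 n (fun=> x).
have mV' := measurable_last_visit n.
have mC := measurable_chain_process W 0 (Some x).
have null : P x (last_visit n `\` visit_event 0 n (fun=> x)) = 0%E.
  apply/(negligibleP (P x) (measurableD mV' mV)).
  apply: (@negligibleS _ _ _ (P x) (~` [set w | chain (W w) 0 = Some x])).
    move=> w [h1 h2] /= h3; apply: h2; split => //.
    by move=> i; rewrite leqn0 => /eqP ->.
  apply/(negligibleP (P x) (measurableC mC)).
  apply: etrans (probability_setC (P x) mC) _.
  have := c2 x 0%N (fun=> Some x); rewrite eqxx big_ord0 mulr1.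
  rewrite (_ : [set w | _] = [set w | chain (W w) 0 = Some x]); last first.
    apply/seteqP; split=> w /=; first exact.
    by move=> h i; rewrite leqn0 => /eqP ->.
  by move=> ->; rewrite subee.
rewrite (negligible_integral (measurableD mV' mV) mV' _ null); last exact: integrable_weight.
rewrite setDD setIidr//; have := visit_event_integral x n 0 (fun=> x).
by rewrite add0n => ->; rewrite eqxx big_ord0 !mul1r.
Qed.

End LastVisit.

(** * The conditioned path measure *)

Section IntegralFacts.
Import HBNNSimple.
Context {R : realType} {d : measure_display} {T : measurableType d}.

(* [mu_meas] is only a set function: its integral is that of a measure which
   agrees with it on measurable sets. *)
Lemma eq_integral_measurable (m1 m2 : set T -> \bar R) (f : T -> \bar R) :
  (forall A, measurable A -> m1 A = m2 A) ->
  (\int[m1]_x f x = \int[m2]_x f x)%E.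
Proof.
move=> m12; rewrite /integral /=.
have h (h : {nnsfun T >-> R}) : sintegral m1 h = sintegral m2 h.
  by rewrite /sintegral; apply: eq_fsbigr => r _; rewrite m12.
by congr (ereal_sup _ - ereal_sup _)%E; apply: eq_imagel => g _.
Qed.

Lemma integral_mscale (m : {measure set T -> \bar R}) (k : {nonneg R}) (f : T -> \bar R) :
  m.-integrable setT f ->
  (\int[mscale k m]_x f x = k%:num%:E * \int[m]_x f x)%E.
Proof.
move=> fi; have mf := measurable_int _ fi.
have E (g : T -> \bar R) : measurable_fun setT g -> (forall t, 0 <= g t)%E ->
    (\int[mscale k m]_x g x = k%:num%:E * \int[m]_x g x)%E.
  by move=> mg g0; apply: ge0_integral_mscale.
rewrite [LHS]integralE (E _ (measurable_funepos mf))// (E _ (measurable_funeneg mf))//.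
rewrite -muleBr//; first by rewrite [in RHS]integralE.
by rewrite fin_num_adde_defl// fin_numN integrable_neg_fin_num.
Qed.

Lemma integral_mfrestr (m : {measure set T -> \bar R}) D (mD : measurable D)
    (mDoo : (m D < +oo)%E) (F : T -> R) : bounded_measurable F ->
  (\int[mfrestr mD mDoo]_x (F x)%:E = \int[m]_(x in D) (F x)%:E)%E.
Proof.
move=> bF; rewrite -integral_indicM//.
have i1 : m.-integrable setT (EFin \o (\1_D : T -> R)).
  apply/integrableP; split; first exact/measurable_EFinP.
  under eq_integral do rewrite /= ger0_norm//.
  by rewrite integral_indic// setIT.
have H C : measurable C -> (mfrestr mD mDoo (id @^-1` C) = \int[m]_(x in C) (\1_D x)%:E)%E.
  by move=> mC; rewrite integral_indic// setIC.
rewrite (weighted_eq_density (@measurable_id _ _ _) i1 H bF).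
by under eq_integral do rewrite mulrC.
Qed.

Lemma finite_bounded_integrable (m : {measure set T -> \bar R}) (F : T -> R) :
  (m setT < +oo)%E -> bounded_measurable F -> m.-integrable setT (EFin \o F).
Proof.
move=> moo [mF [M FM]].
apply: (le_integrable measurableT _ _ (g := cst `|M|%:E)).
- exact/measurable_EFinP.
- by move=> t _; rewrite /= lee_fin normr_id (le_trans (FM t))// ler_norm.
apply/integrableP; split => //.
rewrite (eq_integral (cst `|M|%:E)) ?integral_cst ?lte_mul_pinfty//.
by move=> t _; rewrite /= normr_id.
Qed.

Lemma nneseries_rsum (f : nat -> R) : abs_summable f ->
  (\sum_(0 <= n <oo) (f n)%:E = (rsum f)%:E)%E.
Proof.
move=> sf; have h : (\sum_(0 <= k < n) (f k)%:E)%E @[n --> \oo] --> (rsum f)%:E.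
  under eq_fun do rewrite sumEFin.
  by apply: cvg_EFin; [exact: nearW|exact: cvg_rsum].
exact: cvg_lim h.
Qed.

Lemma measure_eq_off (m : {measure set T -> \bar R}) (A B N : set T) :
  measurable A -> measurable B -> measurable N -> m N = 0%E ->
  (forall w, ~ N w -> A w <-> B w) -> m A = m B.
Proof.
move=> mA mB mN N0 AB.
have E C : measurable C -> m C = m (C `\` N).
  move=> mC; rewrite (measureDI m mC mN).
  by rewrite (subset_measure0 (measurableI _ _ mC mN) mN (@subIsetr _ _ _) N0) adde0.
rewrite E// [RHS]E//; congr (m _); apply/seteqP; split=> w [h1 h2]; split => //.
  by apply/AB.
by apply/AB.
Qed.

End IntegralFacts.

(** * A common formula for both readings of the conditional law *)

Section ConditionedPath.
Context {R : realType} {X : countType}.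
Variables (Q : X -> X -> R).
Hypothesis genQ : is_generator Q.
Context {d : measure_display} {T : measurableType d}.
Variables (P : X -> probability T R) (W : {mfun T >-> trajectories X R}).
Hypothesis mkv : is_markov_process Q P W.
Variables (x y : X).

Let q u := - Q u u.
Let p := jump_mx Q.
Let G := rsum (fun n => mxpow p n x y).
Let law : set (trajectories X R) -> \bar R := distribution (P x) W.

Let q_gt0 u : 0 < q u. Proof. exact: jump_rate_gt0. Qed.

Let G_summable : abs_summable (fun n => mxpow p n x y).
Proof. exact: jump_mx_transient. Qed.

(** The case of positive signs and no additional killing of [last_visit_integral], where the path
    weight is 1. *)
Lemma last_visit_prob kill n :
  P x (last_visit W y kill n) = (kill_prob Q kill y * mxpow p n x y)%:E.
Proof.
have [regW _ _] := mkv.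
have s1 : is_sign_matrix (fun _ _ : X => 1 : R) by split => // *; left.
have L0 : nonneg_weights ([::] : seq (X * R)) by [].
have mV := measurable_last_visit W y kill n.
have := last_visit_integral genQ s1 mkv y kill L0 x n.
rewrite /killing big_nil addr0 divff ?gt_eqF ?jump_rate_gt0// mulr1.
rewrite (_ : damped_mx _ _ _ = p); last first.
  rewrite damped_mx0//.
  by apply/funext => u; apply/funext => v; rewrite mulr1.
move=> <-; rewrite (eq_integral (cst 1%E)) ?integral_cst ?mul1e// => w _.
rewrite /path_weight /laplace big_nil oppr0 expR0 mulr1 /final_sign.
(* A trajectory killed after n always has a finite [eta], so the dummy value of [final_sign] does
   not occur. *)
case E : (Defs.eta _) => [m|].
  by rewrite big1_seq// => i _; rewrite /jump_sign; case: chain => // a; case: chain.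
move: E; rewrite /Defs.eta; case: pselect => // -[]; exists n.
by rewrite /chain /= ltnn.
Qed.

Let killed_visit C n : set T :=
  [set w | C (W w) /\ (Defs.eta (W w) = Some n /\ chain (W w) n = Some y)].

Let killing_visit kill C n : set T :=
  last_visit W y kill n `&` [set w | C (kill_after n (W w))].

Let mW : measurable_fun setT W. Proof. by []. Qed.

Let mkillW n : measurable_fun setT (fun w => kill_after n (W w)).
Proof. exact: (measurableT_comp (measurable_kill_after n) mW). Qed.

Let measurable_killing_visit kill C n : measurable C -> measurable (killing_visit kill C n).
Proof.
move=> mC; apply: measurableI; first exact: measurable_last_visit.
by rewrite -[X in measurable X]setTI; exact: mkillW.
Qed.

Let measurable_killed_visit C n : measurable C -> measurable (killed_visit C n).
Proof.
move=> mC.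
have h : measurable (C `&` ([set w | Defs.eta w = Some n] `&` [set w | chain w n = Some y])).
  by apply: measurableI => //; apply: measurableI;
    [exact: measurable_eta|exact: measurable_chain].
by have := mW measurableT h; rewrite setTI.
Qed.

(** Off the revivals, a chain that is in the cemetery at time n + 1 stays there and its later jump
    times are infinite, so the trajectory is its own version killed after n. *)
Let killed_visitE C n : measurable C ->
  P x (killed_visit C n) = P x (killing_visit true C n).
Proof.
move=> mC; have [regW _ _] := mkv.
apply: (@measure_eq_off _ _ _ (P x) _ _ (revival W)).
- exact: measurable_killed_visit.
- exact: measurable_killing_visit.
- exact: measurable_revival.
- exact: (revival_null mkv).
move=> w nr.
have killE : chain (W w) n.+1 = None -> kill_after n (W w) = W w.
  move=> h; rewrite /kill_after; case E : (W w) => [c t]; congr pair.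
    apply/funext => k; case: leqP => [_|nk]; first by rewrite -[c]/((c, t).1) -E.
    have := chain_dead (k - n.+1) nr h; rewrite subnKC// => <-.
    by rewrite /chain E.
  apply/funext => k; case: leqP => [_|nk]; first by rewrite /jump_time.
  have [_ _ h'] := regW w.
  case: k nk => // k nk.
  have := chain_dead (k - n.+1) nr h; rewrite subnKC// => /h'.
  by rewrite /jump_time E.
split.
  move=> [CW [/eta_someP [h1 h2] h3]]; split; first by split.
  by rewrite /= killE.
move=> [[h1 h2] h3].
have h4 := h2 isT; move: h3; rewrite /= killE// => CW; split => //; split => //.
apply/eta_someP; split => // k kn h5.
have := chain_dead (n - k.+1) nr h5.
by rewrite subnKC// h1.
Qed.

Lemma killed_from_prob C : measurable C ->
  (law (C `&` killed_from y) = \sum_(0 <= n <oo) P x (killing_visit true C n))%E.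
Proof.
move=> mC; rewrite /law /distribution /pushforward.
rewrite (_ : W @^-1` _ = \bigcup_n killed_visit C n); last first.
  apply/seteqP; split=> w; first by move=> [h1 [n [h2 h3]]]; exists n.
  by move=> [n _ [h1 [h2 h3]]]; split => //; exists n.
rewrite measure_bigcup//; last 2 first.
- by move=> n _; exact: measurable_killed_visit.
- by move=> i j _ _ [w [[_ [h1 _]] [_ [h2 _]]]]; move: h1; rewrite h2 => -[].
transitivity (\sum_(0 <= n <oo) P x (killed_visit C n))%E.
  by apply: eq_eseriesl => n; rewrite in_setT.
by apply: eq_eseriesr => n _; exact: killed_visitE.
Qed.

Let kill := law (killed_from y) != 0%E.

Let sum_last_visit k : (\sum_(0 <= n <oo) P x (last_visit W y k n) =
  (kill_prob Q k y * G)%:E)%E.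
Proof.
rewrite (_ : (fun n => _) = fun n => \sum_(0 <= i < n) (kill_prob Q k y * mxpow p i x y)%:E)%E; last first.
  by apply/funext => n; apply: eq_bigr => i _; rewrite last_visit_prob.
by rewrite nneseries_rsum ?rsumZ//; exact: abs_summableZ.
Qed.

Let law_killed_from : law (killed_from y) = (kill_prob Q true y * G)%:E.
Proof.
rewrite -[killed_from y]setTI killed_from_prob// -sum_last_visit.
by apply: eq_eseriesr => n _; rewrite /killing_visit setIT.
Qed.

(** In the conditioned case the event has nonzero probability, namely escape probability times G; in
    the other case the factor is 1. *)
Lemma kill_prob_neq0 : G != 0 -> kill_prob Q kill y != 0.
Proof.
move=> G0; rewrite /kill_prob; case: ifP => [|_]; last exact: oner_neq0.
by rewrite /kill law_killed_from; apply: contraNneq => h; rewrite /kill_prob h mul0r.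
Qed.

(** Both readings are the sum over n of the laws of the process killed after a visit to y at time n,
    divided by the total mass [kill_prob] times G. *)
Lemma mu_measE C : measurable C ->
  (mu_meas Q P W x y C = (G / q y / (kill_prob Q kill y * G))%:E *
    \sum_(0 <= n <oo) P x (killing_visit kill C n))%E.
Proof.
move=> mC; rewrite /mu_meas inv_mx_generator -/p -/G -/law [in RHS]EFinM -muleA.
congr (_ * _)%E; rewrite /killed_from_law.
have [k0|k0] := boolP kill.
  rewrite ifF ?(negbTE k0)// muleC; congr (_%:E * _)%E; last exact: killed_from_prob.
  by rewrite law_killed_from.
rewrite ifT; last exact: (negbNE k0).
rewrite muleC; congr (_%:E * _)%E.
  rewrite /kill_prob mul1r; congr (_^-1).
  have := sum_last_visit false; rewrite /kill_prob mul1r => h.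
  rewrite -[G]/(fine G%:E) -h; congr fine; apply: eq_eseriesr => n _.
  by congr (P x _); apply/seteqP; split => w; [move=> h'; split|case].
apply: eq_eseriesr => n _; congr (P x _).
by apply/seteqP; split => w [h1 h2]; [split => //; split|split => //; case: h1].
Qed.

End ConditionedPath.

(** * The conditioned path law as a finite measure *)

Section ConditionedPathMeasure.
Context {R : realType} {X : countType}.
Variables (Q : X -> X -> R).
Hypothesis genQ : is_generator Q.
Context {d : measure_display} {T : measurableType d}.
Variables (P : X -> probability T R) (W : {mfun T >-> trajectories X R}).
Hypothesis mkv : is_markov_process Q P W.
Variables (x y : X).

Let q u := - Q u u.
Let p := jump_mx Q.
Let G := rsum (fun n => mxpow p n x y).
Let kill := distribution (P x) W (killed_from y) != 0%E.
Let c := G / q y / (kill_prob Q kill y * G).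

Let q_gt0 u : 0 < q u. Proof. exact: jump_rate_gt0. Qed.

Let p_ge0 u v : 0 <= p u v. Proof. exact: jump_mx_ge0. Qed.

Let mxpow_p_ge0 n u v : 0 <= mxpow p n u v.
Proof.
exact: (mxpow_ge0 (jump_mx_ge0 genQ) (jump_mx_summable genQ) (jump_mx_le1 genQ)).
Qed.

Let kill_prob_ge0 : 0 <= kill_prob Q kill y.
Proof.
rewrite /kill_prob; case: ifP => // _; rewrite subr_ge0.
exact: jump_mx_le1.
Qed.

Let c_ge0 : 0 <= c.
Proof.
have G0 : 0 <= G by apply: rsum_ge0 => n.
by rewrite !divr_ge0// ?mulr_ge0// ltW.
Qed.

Let mkillW n : measurable_fun setT (fun w => kill_after n (W w)).
Proof. exact: (measurableT_comp (measurable_kill_after n) _). Qed.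

Let visit_finite n : (P x (last_visit W y kill n) < +oo)%E.
Proof. by rewrite (last_visit_prob genQ mkv) ltry. Qed.

(** The probability restricted to a last visit at time n, pushed forward by killing after n. *)
Let visit_measure n : {measure set (trajectories X R) -> \bar R} :=
  measure_function_pushforward__canonical__measure_function_Measure
    (mfrestr (measurable_last_visit W y kill n) (visit_finite n)) (mkillW n).

Let path_measure : {measure set (trajectories X R) -> \bar R} :=
  mscale (NngNum c_ge0) (mseries visit_measure 0).

Let path_measureE C : measurable C -> mu_meas Q P W x y C = path_measure C.
Proof.
move=> mC; rewrite (mu_measE genQ mkv)//; congr (_ * _)%E.
by apply: eq_eseriesr => n _; rewrite setIC.
Qed.

Let path_measure_finite : (path_measure setT < +oo)%E.
Proof.
rewrite -path_measureE// (mu_measE genQ mkv)//.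
rewrite (_ : (fun n => _) = fun n =>
    \sum_(0 <= i < n) (kill_prob Q kill y * mxpow p i x y)%:E)%E; last first.
  apply/funext => n; apply: eq_bigr => i _.
  by rewrite -(last_visit_prob genQ mkv); congr (P x _); rewrite setIT.
rewrite nneseries_rsum; first by rewrite -EFinM ltry.
by apply: abs_summableZ; exact: jump_mx_transient.
Qed.

Section Weights.
Variables (S : X -> X -> R) (L : seq (X * R)).
Hypotheses (signS : is_sign_matrix S) (L0 : nonneg_weights L).

Let w u v := p u v * S u v.
Let Gd := green w q L x y.

Let bw : bounded_measurable (path_weight S L).
Proof. exact: bounded_measurable_path_weight. Qed.

Let visit_measure_integral (F : trajectories X R -> R) n : bounded_measurable F ->
  (\int[visit_measure n]_t (F t)%:E =
   \int[P x]_(v in last_visit W y kill n) (F (kill_after n (W v)))%:E)%E.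
Proof.
move=> bF; have [mF [M FM]] := bF.
have bFk : bounded_measurable (fun v => F (kill_after n (W v))).
  by split; [exact: (measurableT_comp mF (mkillW n))|exists M].
rewrite -(integral_mfrestr (measurable_last_visit W y kill n) (visit_finite n))//.
have mFE : measurable_fun setT (EFin \o F) by exact/measurable_EFinP.
have iF := bounded_integrable (mfrestr (measurable_last_visit W y kill n) (visit_finite n)) bFk.
exact: (integral_pushforward (mkillW n) mFE iF measurableT).
Qed.

Lemma path_measure_integral :
  (\int[path_measure]_t (path_weight S L t)%:E = Gd%:E)%E.
Proof.
pose r n := kill_prob Q kill y * (q y / (q y + killing L y)) * mxpow (damped_mx w q L) n x y.
have rate0 : 0 < q y + killing L y by apply: rate_gt0.
have wp u v : `|w u v| <= p u v by apply: signed_jump_le.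
have dp u v : `|damped_mx w q L u v| <= p u v by apply: damped_mx_le.
have rp n : `|mxpow (damped_mx w q L) n x y| <= mxpow p n x y.
  exact: (mxpow_dominated p_ge0 (jump_mx_summable genQ) (jump_mx_le1 genQ)).
have sd : abs_summable (fun n => mxpow (damped_mx w q L) n x y).
  by apply: abs_summable_le rp _; exact: jump_mx_transient.
have E n : (\int[visit_measure n]_t (path_weight S L t)%:E = (r n)%:E)%E.
  by rewrite visit_measure_integral// (last_visit_integral genQ signS mkv).
have [M WM] := bw.2.
have visitT n : visit_measure n setT = (kill_prob Q kill y * mxpow p n x y)%:E.
  by rewrite -(last_visit_prob genQ mkv); congr (P x _); rewrite preimage_setT setTI.
have ivm n : (visit_measure n).-integrable setT (EFin \o path_weight S L).
  by apply: finite_bounded_integrable => //; rewrite visitT ltry.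
(* The masses of the visit measures are summable by transience, so both parts of a bounded weight
   can be integrated against the series. *)
have bound (f : trajectories X R -> \bar R) : measurable_fun setT f ->
    (forall t, 0 <= f t <= M%:E)%E ->
    (\sum_(0 <= n <oo) `|\int[visit_measure n]_t f t| < +oo)%E.
  move=> mf f0M; apply: (@le_lt_trans _ _
    (\sum_(0 <= n <oo) (M * (kill_prob Q kill y * mxpow p n x y))%:E)%E).
    apply: lee_nneseries => // n _.
    rewrite gee0_abs; last by apply: integral_ge0 => t _; have /andP[] := f0M t.
    apply: (@le_trans _ _ (\int[visit_measure n]_t (cst M%:E t))%E).
      by apply: ge0_le_integral => // t _; have /andP[h1 h2] := f0M t => //; exact: le_trans h1 h2.
    by rewrite integral_cst// EFinM -visitT.
  rewrite nneseries_rsum ?ltry//; do 2!apply: abs_summableZ.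
  exact: jump_mx_transient.
have M0 : 0 <= M by apply: le_trans (WM point).
rewrite integral_mscale; last first.
  apply: finite_bounded_integrable => //.
  change (\sum_(0 <= n <oo) visit_measure n setT < +oo)%E.
  rewrite (_ : (fun n => _) = fun n =>
      \sum_(0 <= i < n) (kill_prob Q kill y * mxpow p i x y)%:E)%E; last first.
    by apply/funext => n; apply: eq_bigr => i _; exact: visitT.
  by rewrite nneseries_rsum ?ltry//; apply: abs_summableZ; exact: jump_mx_transient.
rewrite integral_measure_series//; last 3 first.
- by apply/measurable_EFinP; case: bw.
- apply: bound.
  + by apply: measurable_funeneg; apply/measurable_EFinP; case: bw.
  + move=> t; rewrite funeneg_ge0 funenegE /= -EFin_max lee_fin ge_max M0 andbT lerNl.
    by have := WM t; rewrite ler_norml => /andP[].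
- apply: bound.
  + by apply: measurable_funepos; apply/measurable_EFinP; case: bw.
  + move=> t; rewrite funepos_ge0 funeposE /= -EFin_max lee_fin ge_max M0 andbT.
    exact: le_trans (ler_norm _) (WM t).
under eq_eseriesr do rewrite E.
rewrite nneseries_rsum; last exact: abs_summableZ.
rewrite rsumZ// -EFinM; congr EFin; rewrite /Gd /green /green_term /=.
under [X in _ = rsum X]eq_fun do rewrite mulrC.
rewrite rsumZ//.
(* If y cannot be reached from x, the damped powers, dominated by those of p, vanish and both sides
   are 0. Otherwise the normalization cancels. *)
have [G0|G0] := eqVneq G 0.
  rewrite (_ : rsum _ = 0) ?mulr0//.
  rewrite (_ : (fun n => _) = cst 0) ?rsum0//; apply/funext => n.
  apply/eqP; rewrite -normr_le0 (le_trans (rp n))// -G0.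
  by apply: (rsum_ge_term (f := fun n => mxpow p n x y)) => //; exact: jump_mx_transient.
have k0 := kill_prob_neq0 genQ mkv G0.
have q0 := gt_eqF (q_gt0 y); have r0 := gt_eqF rate0.
rewrite /c mulrA; congr (_ * _); field.
by rewrite q0 r0 G0 k0.
Qed.

End Weights.

(** A single measure serves all weights, as the uniqueness of Laplace transforms requires. *)
Lemma mu_meas_measure : exists m : {finite_measure set (trajectories X R) -> \bar R},
  (forall C, measurable C -> mu_meas Q P W x y C = m C) /\
  forall S L, is_sign_matrix S -> nonneg_weights L ->
    (\int[m]_t (path_weight S L t)%:E = (green (fun u v => p u v * S u v) q L x y)%:E)%E.
Proof.
exists (mfrestr measurableT path_measure_finite); split=> [C mC|S L sS L0].
  rewrite path_measureE//; change (path_measure C = path_measure (C `&` setT)).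
  by rewrite setIT.
rewrite integral_mfrestr; first exact: path_measure_integral sS L0.
exact: bounded_measurable_path_weight.
Qed.

End ConditionedPathMeasure.

(** * The isomorphism *)

Section Isomorphism.
Context {R : realType} {X : countType}.
Variables (Q S : X -> X -> R).
Hypotheses (genQ : is_generator Q) (signS : is_sign_matrix S).

Let q u := - Q u u.
Let w u v := jump_mx Q u v * S u v.
Let gr := green w q.

Section Field.
Context {d : measure_display} {T : measurableType d}.
Variables (P : probability T R) (Z : X -> {RV P >-> R}).
Hypothesis gZ : is_centered_gaussian_field Z (fun x y => - inv_mx (hadamard Q S) x y).

Definition half_square_field v : fields X R := fun u => Z u v ^+ 2 / 2.

Lemma measurable_half_square_field : measurable_fun setT half_square_field.
Proof.
by apply/measurable_fieldsP => u; apply: measurable_funM => //; exact: measurable_funX.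
Qed.

Lemma half_square_field_ge0 v u : 0 <= half_square_field v u.
Proof. by rewrite /half_square_field divr_ge0// sqr_ge0. Qed.

(** Each entry of [L] updates the field by [tilted_sqr] and the Green function by [green_cons], with
    the same result; the positivity required by the latter comes from [tilted_variance_ge0]. *)
Lemma tilted_laplace L : nonneg_weights L ->
  exists c, tilted P (fun u => Z u : T -> R) (fun v => laplace L (half_square_field v)) c (gr L).
Proof.
have mZ u : measurable_fun setT (Z u : T -> R) by [].
have Z2 := gaussian_field_sqr_integrable gZ.
elim: L => [_|[u k] L IH kL0].
  exists 1; have := tilted_gaussian_field gZ.
  rewrite (_ : (fun v => _) = cst 1); last first.
    by apply/funext => v; rewrite /laplace big_nil oppr0 expR0.
  rewrite (_ : gr [::] = fun x y => - inv_mx (hadamard Q S) x y)//.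
  by apply/funext => x; apply/funext => y; rewrite inv_mx_hadamard.
have L0 : nonneg_weights L by move=> a aL; apply: kL0; rewrite inE aL orbT.
have k0 : 0 <= k by apply: (kL0 (u, k)); rewrite mem_head.
have [c te] := IH L0.
exists (c / Num.sqrt (1 + k * gr L u u)).
have := tilted_sqr mZ Z2 u k0 te.
rewrite (_ : (fun v => _ * _) = (fun v => laplace ((u, k) :: L) (half_square_field v))); last first.
  apply/funext => v; rewrite /laplace big_cons opprD expRD mulrC.
  by rewrite /half_square_field.
rewrite (_ : (fun x y => _) = gr ((u, k) :: L))//.
apply/funext => x; apply/funext => y; rewrite /gr (green_cons (p := jump_mx Q))//.
- exact: jump_mx_ge0.
- exact: jump_mx_summable.
- exact: jump_mx_le1.
- exact: jump_mx_transient.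
- exact: jump_rate_gt0.
- by move=> a b; exact: signed_jump_le.
- by rewrite ltr_pwDl// mulr_ge0// (tilted_variance_ge0 mZ Z2 u te).
Qed.

End Field.

Lemma laplaceD (L : seq (X * R)) (f g : X -> R) :
  laplace L (fun u => f u + g u) = laplace L f * laplace L g.
Proof.
rewrite /laplace -expRD -opprD -big_split /=; congr (expR (- _)).
by apply: eq_bigr => a _; rewrite mulrDr.
Qed.

Section Product.
Context {dZ : measure_display} {TZ : measurableType dZ}.
Variables (PZ : probability TZ R) (Z : X -> {RV PZ >-> R}).
Hypothesis gZ : is_centered_gaussian_field Z (fun x y => - inv_mx (hadamard Q S) x y).
Variables (m : {finite_measure set (trajectories X R) -> \bar R}) (x y : X).
Hypothesis mE : forall L, nonneg_weights L ->
  (\int[m]_t (path_weight S L t)%:E = (gr L x y)%:E)%E.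

Let phi (t : trajectories X R * TZ) : fields X R :=
  fun u => half_square_field Z t.2 u + occupation_field t.1 u.

Let wt (t : trajectories X R * TZ) : R := final_sign S t.1.

Let mphi : measurable_fun setT phi.
Proof.
apply/measurable_fieldsP => u; apply: measurable_funD.
  have h := measurableT_comp (measurable_coord u) (measurable_half_square_field Z).
  exact: (measurableT_comp h measurable_snd).
have h := measurableT_comp (measurable_coord u) (@measurable_occupation_field R X).
exact: (measurableT_comp h measurable_fst).
Qed.

Let phi_ge0 t u : 0 <= phi t u.
Proof. by rewrite addr_ge0// ?half_square_field_ge0// occupation_field_ge0. Qed.

Let bwt : bounded_measurable wt.
Proof.
split; first exact: (measurableT_comp (measurable_final_sign S) measurable_fst).
by exists 1 => t; exact: final_sign_norm_le1.
Qed.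

Let iprod (F : trajectories X R * TZ -> R) : bounded_measurable F ->
  (m \x PZ)%E.-integrable setT (EFin \o F).
Proof.
move=> bF; apply: finite_bounded_integrable => //.
apply: (@le_lt_trans _ _ (m setT * PZ setT)%E).
  rewrite le_eqVlt; apply/orP; left; apply/eqP.
  by apply: etrans (product_measure1E m PZ measurableT measurableT); rewrite setXTT.
by rewrite ltey_eq fin_numM// fin_num_measure.
Qed.

Let weight_bounded (F : fields X R -> R) : bounded_measurable F ->
  bounded_measurable (fun t => wt t * F (phi t)).
Proof.
move=> [mF [M FM]]; apply: bounded_measurableM => //.
by split; [exact: (measurableT_comp mF mphi)|exists M].
Qed.

Lemma isomorphism_product (F : fields X R -> R) : bounded_measurable F ->
  (\int[PZ]_v (Z x v * Z y v * F (half_square_field Z v))%:E =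
   \int[m]_t \int[PZ]_v (final_sign S t *
     F (fun u => half_square_field Z v u + occupation_field t u)%R)%:E)%E.
Proof.
move=> bF.
transitivity (\int[m \x PZ]_t (wt t * F (phi t))%:E)%E; last first.
  rewrite -[LHS](integral12_prod_meas1 (f := EFin \o (fun t => wt t * F (phi t)))).
    by [].
  exact: iprod (weight_bounded bF).
apply: (@laplace_unique R X _ _ _ _ PZ (m \x PZ)%E (half_square_field Z) phi
   (fun v => Z x v * Z y v) wt) => //.
- exact: measurable_half_square_field.
- by have := gaussian_fieldM_integrable gZ x y.
- exact: iprod.
- by move=> v u; exact: half_square_field_ge0.
move=> L L0.
have [c te] := tilted_laplace gZ L0.
have mZ u : measurable_fun setT (Z u : TZ -> R) by [].
have Z2 := gaussian_field_sqr_integrable gZ.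
rewrite (tilted_covariance mZ Z2 x y te).
have bl (f : TZ -> fields X R) : measurable_fun setT f -> (forall v u, 0 <= f v u) ->
    bounded_measurable (fun v => laplace L (f v)).
  move=> mf f0; split; first exact: (measurableT_comp (measurable_laplace L) mf).
  by exists 1 => v; rewrite ger0_norm ?laplace_le1// ltW// laplace_gt0.
have bL : bounded_measurable (fun t => wt t * laplace L (phi t)).
  apply: bounded_measurableM => //.
  split; first exact: (measurableT_comp (measurable_laplace L) mphi).
  by exists 1 => t; rewrite ger0_norm ?laplace_le1// ltW// laplace_gt0.
rewrite -[RHS](integral12_prod_meas1 (f := EFin \o (fun t => wt t * laplace L (phi t)))); last first.
  exact: iprod bL.
(* The phase identity for the empty combination at phase 0 gives the total mass. *)
have Ee : (\int[PZ]_v (laplace L (half_square_field Z v))%:E = c%:E)%E.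
  have [_ _ _ _ /(_ [::] 0)] := te.
  under eq_integral do rewrite /lincomb big_nil addr0 cos0 mul1r.
  by move=> ->; rewrite /quadcomb big_nil mul0r oppr0 expR0 cos0 mul1r mulr1.
(* For a fixed path the Laplace functional of the sum of the two fields factors, and the field
   integrates to c. *)
transitivity (\int[m]_t (c%:E * (path_weight S L t)%:E))%E.
  rewrite integralZl//; last exact: bounded_integrable (bounded_measurable_path_weight signS L0).
  by rewrite mE.
apply: eq_integral => t _; rewrite -Ee muleC -integralZl//; last first.
  apply: bounded_integrable; apply: bl; first exact: measurable_half_square_field.
  by move=> v u; exact: half_square_field_ge0.
apply: eq_integral => v _; rewrite -EFinM; congr EFin.
by rewrite /= laplaceD /path_weight /wt /= mulrAC mulrA.
Qed.

End Product.
End Isomorphism.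

Theorem mainTheorem1 (R : realType) (X : countType) (Q S : X -> X -> R)
    (dZ : measure_display) (OmegaZ : measurableType dZ)
    (PZ : probability OmegaZ R) (Z : X -> {RV PZ >-> R})
    (dW : measure_display) (OmegaW : measurableType dW)
    (P : X -> probability OmegaW R) (W : {mfun OmegaW >-> trajectories X R}) :
  is_generator Q ->
  is_sign_matrix S ->
  is_centered_gaussian_field Z (fun x y => - inv_mx (hadamard Q S) x y) ->
  is_markov_process Q P W ->
  forall (x y : X) (F : fields X R -> R),
    measurable_fun setT F ->
    (exists M : R, forall f, `|F f| <= M) ->
    ('E_PZ[fun v => (Z x v * Z y v * F (fun u => (Z u v) ^+ 2 / 2))%R] =
     \int[mu_meas Q P W x y]_w
       'E_PZ[fun v => (F (fun u => (Z u v) ^+ 2 / 2 + fine (occupation w +oo%E u))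
                       * final_sign S w)%R])%E.
Proof.
move=> genQ signS gZ mkv x y F mF bF.
have [m [mE Em]] := mu_meas_measure genQ mkv x y.
rewrite (eq_integral_measurable _ mE).
have EE (f : OmegaZ -> R) : ('E_PZ[f] = \int[PZ]_v (f v)%:E)%E by rewrite unlock.
rewrite EE; apply: etrans (isomorphism_product genQ signS gZ _ (conj mF bF)) _.
  by move=> L L0; exact: Em.
by apply: eq_integral => w _; rewrite EE; apply: eq_integral => v _; rewrite mulrC.
Qed.
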